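(* Let $\mathcal{C}$ be a small category and let $\mathcal{D}\subset\mathcal{C}$ be a full subcategory. Define $\mathbb{F}\in\mathrm{sSets}^{\mathcal{D}^{op}\times\mathcal{C}}$ by $\mathbb{F}(d,c):=\mathrm{mor}_{\mathcal{C}}(d,c)$ for $d\in\mathcal{D}$, $c\in\mathcal{C}$, where the set $\mathrm{mor}_{\mathcal{C}}(d,c)$ is seen as a constant (discrete) simplicial set. Choose one cofibrant approximation $\vartheta\colon\mathbb{E}\to\mathbb{F}$ of $\mathbb{F}$ in the model category $\mathcal{U}_{\mathrm{sSets}}(\mathcal{D}^{op}\times\mathcal{C},\,\mathcal{D}^{op}\times\mathcal{D})$. Let $\mathcal{S}$ be a cofibrantly generated simplicial model category and let $X\in\mathcal{S}^{\mathcal{C}}$ be a diagram. Let $\eta\colon qX\to X$ be an objectwise cofibrant approximation of $X$. Then the morphism $$\xi_X\colon\ \mathbb{E}\otimes^{\mathcal{C}}_{\mathcal{D}}\mathrm{res}^{\mathcal{C}}_{\mathcal{D}}(qX)\longrightarrow X$$ defined in the context is a cofibrant approximation of $X$ in the model category $\mathcal{U}_{\mathcal{S}}(\mathcal{C},\mathcal{D})$. In particular, if $X\in\mathcal{S}^{\mathcal{C}}$ is objectwise cofibrant, then $\mathbb{E}\otimes^{\mathcal{C}}_{\mathcal{D}}\mathrm{res}^{\mathcal{C}}_{\mathcal{D}}X\to X$ (the same morphism with $qX=X$, $\eta=\mathrm{id}_X$) is a cofibrant approximation of $X$ in $\mathcal{U}_{\mathcal{S}}(\mathcal{C},\mathc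al{D})$.
   Context: Model categories are complete, cocomplete and have functorial factorizations. $\mathcal{S}^{\mathcal{C}}$ denotes the category of functors (diagrams) $\mathcal{C}\to\mathcal{S}$, and $\mathrm{res}^{\mathcal{C}}_{\mathcal{D}}\colon\mathcal{S}^{\mathcal{C}}\to\mathcal{S}^{\mathcal{D}}$ is restriction. $\mathrm{sSets}$ is the category of simplicial sets with its usual model structure. Relative model structure: for a cofibrantly generated model category $\mathcal{S}$, a small category $\mathcal{C}$ and a subcategory $\mathcal{D}\subset\mathcal{C}$, $\mathcal{U}_{\mathcal{S}}(\mathcal{C},\mathcal{D})$ denotes $\mathcal{S}^{\mathcal{C}}$ with the model structure (known to exist) in which a morphism $f$ is a weak equivalence (resp. fibration) iff $f(d)$ is a weak equivalence (resp. fibration) in $\mathcal{S}$ for every object $d$ of $\mathcal{D}$; cofibrations are determined by the left lifting property with respect to trivial fibrations. A cofibrant approximation of $X$ in a model category is a weak equivalence $Y\to X$ with $Y$ cofibrant. An objectwise cofibrant approximation of a diagram $X\in\mathcal{S}^{\mathcal{C}}$ is a morphism $\eta\colon qX\to X$ in $\mathcal{S}^{\mathcal{C}}$ such that for every $c\in\mathcal{C}$, $qX(c)$ is cofibrant in $\mathcal{S}$ and $\eta(c)$ is a weak equivalence. A diagram is objectwise cofibrant if $X(c)$ is cofibrant for every $c\in\mathcal{C}$. A simplicial model category (in Hirschhorn's sense: enriched, tensored and cotensored over all simplicial sets, with axiom SM7) has an action (tensor) $\odot\colon\mathrm{sSets}\times\mathcal{S}\to\mathcal{S}$. For $\mathcal{X}\in\mathrm{sSets}^{\mathcal{D}^{op}\times\mathcal{C}}$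 and $Y\in\mathcal{S}^{\mathcal{D}}$, the diagram $\mathcal{X}\otimes^{\mathcal{C}}_{\mathcal{D}}Y\in\mathcal{S}^{\mathcal{C}}$ is given at $c\in\mathcal{C}$ by $$\mathrm{coeq}\Big(\coprod_{(\alpha\colon b\to b')\in\mathcal{D}}\mathcal{X}(b',c)\odot Y(b)\rightrightarrows\coprod_{a\in\mathcal{D}}\mathcal{X}(a,c)\odot Y(a)\Big),$$ the two maps being induced on the summand $\alpha$ by $\mathcal{X}(\alpha,c)\odot Y(b)$ and $\mathcal{X}(b',c)\odot Y(\alpha)$. The morphism $\xi_X$ is the composite $$\mathbb{E}\otimes^{\mathcal{C}}_{\mathcal{D}}\mathrm{res}^{\mathcal{C}}_{\mathcal{D}}qX\xrightarrow{\vartheta\otimes\mathrm{id}}\mathbb{F}\otimes^{\mathcal{C}}_{\mathcal{D}}\mathrm{res}^{\mathcal{C}}_{\mathcal{D}}qX\xrightarrow{\mathrm{ev}}qX\xrightarrow{\eta}X,$$ where $\mathrm{ev}$ at $c\in\mathcal{C}$ is induced by the maps $\mathbb{F}(d,c)\odot qX(d)\cong\coprod_{f\in\mathrm{mor}_{\mathcal{C}}(d,c)}qX(d)\to qX(c)$ equal to $qX(f)$ on the summand $f$. (Equivalently $\mathrm{ev}$ is the canonical isomorphism $\mathbb{F}\otimes^{\mathcal{C}}_{\mathcal{D}}\mathrm{res}^{\mathcal{C}}_{\mathcal{D}}qX\cong\mathrm{ind}^{\mathcal{C}}_{\mathcal{D}}\mathrm{res}^{\mathcal{C}}_{\mathcal{D}}qX$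 followed by the counit of the adjunction $(\mathrm{ind}^{\mathcal{C}}_{\mathcal{D}},\mathrm{res}^{\mathcal{C}}_{\mathcal{D}})$, where $\mathrm{ind}^{\mathcal{C}}_{\mathcal{D}}$ is the left adjoint of restriction.) *)

(* Defs.v *)
From mathcomp Require Import all_boot.
From Stdlib Require Import FunctionalExtensionality ProofIrrelevance.

Set Implicit Arguments.
Unset Strict Implicit.
Unset Printing Implicit Defensive.

(* [small] is one fixed universe of small sets.  Every hom-set is small, and a
   small category also has a small set of objects.  The category [SET] below
   forces [small] to lie strictly below the universe of objects of a general
   category, so that (co)completeness really is about small diagrams only. *)
Definition small := Type.

Record category_on (Ob : Type) := CategoryOn {
  Hom : Ob -> Ob -> small;
  idm : forall x, Hom x x;
  compm : forall x y z, Hom y z -> Hom x y -> Hom x z;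
  compm_idl : forall x y (f : Hom x y), compm (idm y) f = f;
  compm_idr : forall x y (f : Hom x y), compm f (idm x) = f;
  compmA : forall x y z w (h : Hom z w) (g : Hom y z) (f : Hom x y),
    compm h (compm g f) = compm (compm h g) f
}.
Arguments Hom {Ob} _ _ _.
Arguments idm {Ob} _ _.
Arguments compm {Ob _ x y z} _ _.
Arguments compm_idl {Ob _ x y} _.
Arguments compm_idr {Ob _ x y} _.
Arguments compmA {Ob _ x y z w} _ _ _.

Notation "g ∘ f" := (compm g f) (at level 40, left associativity).

Record category := Category { Ob :> Type; Ob_str :> category_on Ob }.

Record small_category := SmallCategory {
  sOb : small;
  sOb_str : category_on sOb
}.

Coercion category_of_small (C : small_category) : category :=
  Category (sOb_str C).

Definition is_iso (C : category) (x y : C) (f : Hom C x y) : Prop :=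
  exists g : Hom C y x, g ∘ f = idm C x /\ f ∘ g = idm C y.

Record iso (C : category) (x y : C) := Iso {
  iso_to : Hom C x y;
  iso_from : Hom C y x;
  iso_from_to : iso_from ∘ iso_to = idm C x;
  iso_to_from : iso_to ∘ iso_from = idm C y
}.

Definition op_on (Ob : Type) (C : category_on Ob) : category_on Ob.
Proof.
refine (@CategoryOn Ob (fun x y => Hom C y x) (fun x => idm C x)
  (fun x y z g f => f ∘ g) _ _ _).
- by move=> x y f; rewrite compm_idr.
- by move=> x y f; rewrite compm_idl.
- by move=> x y z w h g f; rewrite compmA.
Defined.

Definition prod_on (A B : Type) (C : category_on A) (D : category_on B) :
  category_on (A * B).
Proof.
refine (@CategoryOn (A * B)
  (fun x y => (Hom C x.1 y.1 * Hom D x.2 y.2)%type)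
  (fun x => (idm C x.1, idm D x.2))
  (fun x y z g f => (g.1 ∘ f.1, g.2 ∘ f.2)) _ _ _).
- by move=> x y [f1 f2]; rewrite !compm_idl.
- by move=> x y [f1 f2]; rewrite !compm_idr.
- by move=> x y z w [h1 h2] [g1 g2] [f1 f2]; rewrite !compmA.
Defined.

Definition op (C : category) : category := Category (op_on C).
Definition prodc (C D : category) : category := Category (prod_on C D).
Definition sop (C : small_category) : small_category :=
  SmallCategory (op_on (sOb_str C)).
Definition sprodc (C D : small_category) : small_category :=
  SmallCategory (prod_on (sOb_str C) (sOb_str D)).

Definition full_sub_on (Ob : Type) (C : category_on Ob) (P : Ob -> Prop) :
  category_on {x : Ob | P x}.
Proof.
refine (@CategoryOn {x : Ob | P x} (fun x y => Hom C (sval x) (sval y))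
  (fun x => idm C (sval x)) (fun x y z g f => g ∘ f) _ _ _).
- by move=> x y f; rewrite compm_idl.
- by move=> x y f; rewrite compm_idr.
- by move=> x y z w h g f; rewrite compmA.
Defined.

(* A full subcategory is given by its class of objects. *)
Definition full_sub (C : small_category) (P : sOb C -> Prop) : small_category :=
  SmallCategory (full_sub_on (sOb_str C) P).

Record functor (C D : category) := Functor {
  fob :> C -> D;
  fmap : forall x y, Hom C x y -> Hom D (fob x) (fob y);
  fmap_id : forall x, fmap (idm C x) = idm D (fob x);
  fmap_comp : forall x y z (g : Hom C y z) (f : Hom C x y),
    fmap (g ∘ f) = fmap g ∘ fmap f
}.
Arguments fmap {C D} _ {x y} _.

Definition compf (A B C : category) (G : functor B C) (F : functor A B) :
  functor A C.
Proof.
refine (@Functor A C (fun x => G (F x)) (fun x y f => fmap G (fmap F f)) _ _).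
- by move=> x; rewrite !fmap_id.
- by move=> x y z g f; rewrite !fmap_comp.
Defined.

Definition full_incl (C : small_category) (P : sOb C -> Prop) :
  functor (full_sub P) C.
Proof.
by refine (@Functor (full_sub P) C (fun x => sval x) (fun x y f => f) _ _).
Defined.

Definition res (C : small_category) (S : category) (P : sOb C -> Prop)
  (X : functor C S) : functor (full_sub P) S := compf X (full_incl P).

Record nat_trans (C : small_category) (S : category) (F G : functor C S) :
  small := NatTrans {
  nt : forall c : sOb C, Hom S (F c) (G c);
  nt_nat : forall (c c' : sOb C) (u : Hom C c c'),
    nt c' ∘ fmap F u = fmap G u ∘ nt c
}.

Lemma nat_trans_eq (C : small_category) (S : category) (F G : functor C S)
  (a b : nat_trans F G) : (forall c, nt a c = nt b c) -> a = b.
Proof.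
case: a b => [a Ha] [b Hb] /= E.
have {}E : a = b by apply: functional_extensionality_dep.
by subst b; congr NatTrans; apply: proof_irrelevance.
Qed.

Definition nat_id (C : small_category) (S : category) (F : functor C S) :
  nat_trans F F.
Proof.
refine (@NatTrans C S F F (fun c => idm S (F c)) _).
by move=> c c' u; rewrite compm_idl compm_idr.
Defined.

Definition nat_comp (C : small_category) (S : category) (F G H : functor C S)
  (b : nat_trans G H) (a : nat_trans F G) : nat_trans F H.
Proof.
refine (@NatTrans C S F H (fun c => nt b c ∘ nt a c) _).
by move=> c c' u; rewrite -compmA nt_nat compmA nt_nat compmA.
Defined.

Definition fun_on (C : small_category) (S : category) :
  category_on (functor C S).
Proof.
refine (@CategoryOn (functor C S) (@nat_trans C S) (@nat_id C S)
  (@nat_comp C S) _ _ _).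
- by move=> F G a; apply: nat_trans_eq => c; apply: compm_idl.
- by move=> F G a; apply: nat_trans_eq => c; apply: compm_idr.
- by move=> F G H K h g f; apply: nat_trans_eq => c; apply: compmA.
Defined.

Definition Fun (C : small_category) (S : category) : category :=
  Category (fun_on C S).

Definition SET : category.
Proof.
by refine (@Category small (@CategoryOn small (fun A B => A -> B)
  (fun A a => a) (fun A B C g f a => g (f a)) _ _ _)).
Defined.

Record cocone (J : small_category) (C : category) (F : functor J C) := Cocone {
  apex :> C;
  leg : forall j : sOb J, Hom C (F j) apex;
  leg_nat : forall (i j : sOb J) (u : Hom J i j), leg j ∘ fmap F u = leg i
}.

Record is_colimit (J : small_category) (C : category) (F : functor J C)
  (T : cocone F) := IsColimit {
  colim_desc : forall K : cocone F, Hom C T K;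
  colim_fac : forall (K : cocone F) j, colim_desc K ∘ leg T j = leg K j;
  colim_uniq : forall (K : cocone F) (f : Hom C T K),
    (forall j, f ∘ leg T j = leg K j) -> f = colim_desc K
}.

Record colimit (J : small_category) (C : category) (F : functor J C) :=
  Colimit { colim :> cocone F; colimP : is_colimit colim }.

Definition cocomplete (C : category) :=
  forall (J : small_category) (F : functor J C), colimit F.

(* J-indexed limits in C are J^op-indexed colimits in C^op. *)
Definition complete (C : category) := cocomplete (op C).

Record coproduct (C : category) (I : small) (A : I -> C) := Coproduct {
  cp_ob :> C;
  cp_in : forall i, Hom C (A i) cp_ob;
  cp_desc : forall Z : C, (forall i, Hom C (A i) Z) -> Hom C cp_ob Z;
  cp_fac : forall Z (g : forall i, Hom C (A i) Z) i, cp_desc g ∘ cp_in i = g i;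
  cp_uniq : forall Z (g : forall i, Hom C (A i) Z) (f : Hom C cp_ob Z),
    (forall i, f ∘ cp_in i = g i) -> f = cp_desc g
}.
Arguments cp_in {C I A} _ _.
Arguments cp_desc {C I A} _ {Z} _.
Arguments cp_fac {C I A} _ {Z} _ _.
Arguments cp_uniq {C I A} _ {Z} _ {f} _.

Record coequalizer (C : category) (x y : C) (f g : Hom C x y) := Coequalizer {
  ce_ob :> C;
  ce_proj : Hom C y ce_ob;
  ce_eq : ce_proj ∘ f = ce_proj ∘ g;
  ce_desc : forall (Z : C) (h : Hom C y Z), h ∘ f = h ∘ g -> Hom C ce_ob Z;
  ce_fac : forall Z (h : Hom C y Z) (e : h ∘ f = h ∘ g),
    ce_desc e ∘ ce_proj = h;
  ce_uniq : forall Z (h : Hom C y Z) (e : h ∘ f = h ∘ g) (k : Hom C ce_ob Z),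
    k ∘ ce_proj = h -> k = ce_desc e
}.
Arguments ce_proj {C x y f g} _.
Arguments ce_eq {C x y f g} _.
Arguments ce_desc {C x y f g} _ {Z h} _.
Arguments ce_fac {C x y f g} _ {Z h} _.
Arguments ce_uniq {C x y f g} _ {Z h} _ {k} _.

Definition discrete (I : small) : small_category.
Proof.
refine (@SmallCategory I (@CategoryOn I (fun i j => i = j) (@erefl I)
  (fun i j k e' e => etrans e e') _ _ _)).
- by move=> x y f; apply: proof_irrelevance.
- by move=> x y f; apply: proof_irrelevance.
- by move=> *; apply: proof_irrelevance.
Defined.

Definition discrete_functor (C : category) (I : small) (A : I -> C) :
  functor (discrete I) C.
Proof.
refine (@Functor (discrete I) C A
  (fun i j (e : i = j) => match e with erefl => idm C (A i) end) _ _).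
- by [].
- by move=> i j k /= e' e; case: k / e'; case: j / e; rewrite compm_idl.
Defined.

Definition discrete_cocone (C : category) (I : small) (A : I -> C) (Z : C)
  (g : forall i, Hom C (A i) Z) : cocone (discrete_functor A).
Proof.
refine (@Cocone _ C (discrete_functor A) Z g _).
by move=> i j /= e; case: j / e; apply: compm_idr.
Defined.

Definition coprod (C : category) (cC : cocomplete C) (I : small) (A : I -> C) :
  coproduct A.
Proof.
refine (@Coproduct C I A (cC _ (discrete_functor A))
  (leg (cC _ (discrete_functor A)))
  (fun Z g => colim_desc (colimP (cC _ _)) (discrete_cocone g)) _ _).
- by move=> Z g i; apply: (colim_fac (colimP _) (discrete_cocone g)).
- by move=> Z g f Hf; apply: (@colim_uniq _ _ _ _ _ (discrete_cocone g)).
Defined.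

(* The category with two objects and two parallel arrows [false -> true],
   indexed by [bool]. *)
Definition pair_hom (i j : bool) : small :=
  match i, j with
  | false, false | true, true => unit
  | false, true => bool
  | true, false => void
  end.

Definition parallel_pair : small_category.
Proof.
refine (@SmallCategory bool (@CategoryOn bool pair_hom
  (fun i => if i return pair_hom i i then tt else tt)
  (fun i j k => match i, j, k
     return pair_hom j k -> pair_hom i j -> pair_hom i k with
     | false, false, false | true, true, true => fun _ _ => tt
     | false, false, true => fun g _ => g
     | false, true, true => fun _ f => f
     | false, true, false | true, true, false => fun g _ => match g with end
     | true, false, _ => fun _ f => match f with end
     end) _ _ _)).
- by case=> [] [] // [].
- by case=> [] [] // [].
- by case=> [] [] [] [] //= [] //= [] //= [].
Defined.

Definition pair_functor (C : category) (x y : C) (f g : Hom C x y) :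
  functor parallel_pair C.
Proof.
refine (@Functor parallel_pair C (fun i : bool => if i then y else x)
  (fun i j => match i, j
     return pair_hom i j -> Hom C (if i then y else x) (if j then y else x) with
     | false, false => fun _ => idm C x
     | true, true => fun _ => idm C y
     | false, true => fun b => if b then g else f
     | true, false => fun e => match e with end
     end) _ _).
- by case.
- by case=> [] [] [] //= u v; rewrite ?compm_idl ?compm_idr //; case: u v => [] [].
Defined.

Lemma pair_cocone_eq (C : category) (x y : C) (f g : Hom C x y)
  (K : cocone (pair_functor f g)) :
  (leg K true : Hom C y K) ∘ f = leg K false /\
  (leg K true : Hom C y K) ∘ g = leg K false.
Proof.
by split; [exact: (@leg_nat _ _ _ K false true false)
          |exact: (@leg_nat _ _ _ K false true true)].
Qed.

Definition pair_cocone (C : category) (x y : C) (f g : Hom C x y) (Z : C)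
  (h : Hom C y Z) (e : h ∘ f = h ∘ g) : cocone (pair_functor f g).
Proof.
refine (@Cocone _ C (pair_functor f g) Z
  (fun i : bool => if i return Hom C (if i then y else x) Z then h else h ∘ f)
  _).
by case=> [] [] //= u; rewrite ?compm_idr //; case: u.
Defined.

Definition coeq (C : category) (cC : cocomplete C) (x y : C)
  (f g : Hom C x y) : coequalizer f g.
Proof.
refine (@Coequalizer C x y f g (cC _ (pair_functor f g))
  (leg (cC _ (pair_functor f g)) true)
  (etrans (proj1 (pair_cocone_eq _)) (esym (proj2 (pair_cocone_eq _))))
  (fun Z h e => colim_desc (colimP (cC _ _)) (pair_cocone e)) _ _).
- by move=> Z h e; apply: (colim_fac (colimP _) (pair_cocone e) true).
- move=> Z h e k Hk.
  apply: (@colim_uniq _ _ _ _ _ (pair_cocone e)) => -[] //=.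
  by rewrite -(proj1 (pair_cocone_eq _)) compmA Hk.
Defined.

Definition is_initial (C : category) (x : C) : Prop :=
  forall y : C, exists! f : Hom C x y, True.

Definition is_pushout (C : category) (a b x y : C) (i : Hom C a b)
  (u : Hom C a x) (v : Hom C b y) (f : Hom C x y) : Prop :=
  f ∘ u = v ∘ i /\
  forall (z : C) (p : Hom C x z) (q : Hom C b z), p ∘ u = q ∘ i ->
    exists! h : Hom C y z, h ∘ f = p /\ h ∘ v = q.

Definition has_lift (C : category) (a b x y : C)
  (i : Hom C a b) (p : Hom C x y) : Prop :=
  forall (u : Hom C a x) (v : Hom C b y), p ∘ u = v ∘ i ->
    exists h : Hom C b x, h ∘ i = u /\ p ∘ h = v.

Definition is_retract (C : category) (x y x' y' : C)
  (f : Hom C x y) (g : Hom C x' y') : Prop :=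
  exists (i : Hom C x x') (r : Hom C x' x) (j : Hom C y y') (s : Hom C y' y),
    [/\ r ∘ i = idm C x, s ∘ j = idm C y, g ∘ i = j ∘ f & f ∘ r = s ∘ g].

Record model_data (C : category) := ModelData {
  weq : forall x y : C, Hom C x y -> Prop;
  fib : forall x y : C, Hom C x y -> Prop;
  cof : forall x y : C, Hom C x y -> Prop
}.
Arguments weq {C} _ {x y} _.
Arguments fib {C} _ {x y} _.
Arguments cof {C} _ {x y} _.

Definition triv_fib (C : category) (M : model_data C) (x y : C)
  (f : Hom C x y) : Prop := fib M f /\ weq M f.
Definition triv_cof (C : category) (M : model_data C) (x y : C)
  (f : Hom C x y) : Prop := cof M f /\ weq M f.

Record functorial_factorization (C : category)
  (L R : forall x y : C, Hom C x y -> Prop) := FunctorialFactorization {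
  ff_ob : forall x y : C, Hom C x y -> C;
  ff_l : forall (x y : C) (f : Hom C x y), Hom C x (ff_ob f);
  ff_r : forall (x y : C) (f : Hom C x y), Hom C (ff_ob f) y;
  ff_fac : forall (x y : C) (f : Hom C x y), ff_r f ∘ ff_l f = f;
  ff_lP : forall (x y : C) (f : Hom C x y), L x (ff_ob f) (ff_l f);
  ff_rP : forall (x y : C) (f : Hom C x y), R (ff_ob f) y (ff_r f);
  ff_map : forall (x y x' y' : C) (f : Hom C x y) (f' : Hom C x' y')
    (u : Hom C x x') (v : Hom C y y'),
    v ∘ f = f' ∘ u -> Hom C (ff_ob f) (ff_ob f');
  ff_map_l : forall x y x' y' f f' u v (e : v ∘ f = f' ∘ u),
    @ff_map x y x' y' f f' u v e ∘ ff_l f = ff_l f' ∘ u;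
  ff_map_r : forall x y x' y' f f' u v (e : v ∘ f = f' ∘ u),
    ff_r f' ∘ @ff_map x y x' y' f f' u v e = v ∘ ff_r f;
  ff_map_id : forall x y f (e : idm C y ∘ f = f ∘ idm C x),
    @ff_map x y x y f f (idm C x) (idm C y) e = idm C (ff_ob f);
  ff_map_comp : forall x y x' y' x'' y'' f f' f'' u v u' v'
    (e : v ∘ f = f' ∘ u) (e' : v' ∘ f' = f'' ∘ u')
    (e'' : (v' ∘ v) ∘ f = f'' ∘ (u' ∘ u)),
    @ff_map x y x'' y'' f f'' (u' ∘ u) (v' ∘ v) e'' =
    @ff_map x' y' x'' y'' f' f'' u' v' e' ∘ @ff_map x y x' y' f f' u v e
}.

Record model_structure (C : category) := ModelStructure {
  mod_data :> model_data C;
  mod_complete : complete C;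
  mod_cocomplete : cocomplete C;
  mod_2of3 : forall (x y z : C) (g : Hom C y z) (f : Hom C x y),
    [/\ weq mod_data f -> weq mod_data g -> weq mod_data (g ∘ f),
        weq mod_data f -> weq mod_data (g ∘ f) -> weq mod_data g
      & weq mod_data g -> weq mod_data (g ∘ f) -> weq mod_data f];
  mod_retract : forall (x y x' y' : C) (f : Hom C x y) (g : Hom C x' y'),
    is_retract f g ->
    [/\ weq mod_data g -> weq mod_data f, fib mod_data g -> fib mod_data f
      & cof mod_data g -> cof mod_data f];
  mod_lift_cof : forall (a b x y : C) (i : Hom C a b) (p : Hom C x y),
    cof mod_data i -> triv_fib mod_data p -> has_lift i p;
  mod_lift_triv_cof : forall (a b x y : C) (i : Hom C a b) (p : Hom C x y),
    triv_cof mod_data i -> fib mod_data p -> has_lift i p;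
  mod_fac_cof : functorial_factorization
    (fun x y => @cof C mod_data x y) (fun x y => @triv_fib C mod_data x y);
  mod_fac_fib : functorial_factorization
    (fun x y => @triv_cof C mod_data x y) (fun x y => @fib C mod_data x y)
}.

Definition cofibrant (C : category) (M : model_data C) (x : C) : Prop :=
  exists (o : C) (f : Hom C o x), is_initial o /\ cof M f.

Definition cofibrant_approximation (C : category) (M : model_data C)
  (y x : C) (f : Hom C y x) : Prop := cofibrant M y /\ weq M f.

(* Ordinals are represented by small well-ordered sets. *)
Record well_order := WellOrder {
  wo : small;
  wlt : wo -> wo -> Prop;
  wlt_wf : well_founded wlt;
  wlt_trans : forall x y z, wlt x y -> wlt y z -> wlt x z;
  wlt_total : forall x y, [\/ wlt x y, x = y | wlt y x]
}.
Arguments wlt {_} _ _.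

Coercion wo_sort (W : well_order) : Type := wo W.

Definition wle (W : well_order) (x y : W) : Prop := x = y \/ wlt x y.

Lemma wle_trans (W : well_order) (x y z : W) : wle y z -> wle x y -> wle x z.
Proof.
by move=> [<-|yz] // [->|xy]; right => //; apply: wlt_trans yz.
Qed.

Definition wo_category (W : well_order) : small_category.
Proof.
refine (@SmallCategory (wo W) (@CategoryOn (wo W) (@wle W) (fun x => or_introl erefl)
  (@wle_trans W) _ _ _)).
- by move=> *; apply: proof_irrelevance.
- by move=> *; apply: proof_irrelevance.
- by move=> *; apply: proof_irrelevance.
Defined.

Definition is_succ (W : well_order) (x y : W) : Prop :=
  wlt x y /\ forall z, wlt x z -> wle y z.

Definition is_limit (W : well_order) (x : W) : Prop :=
  (exists y, wlt y x) /\
  forall y, wlt y x -> exists z, wlt y z /\ wlt z x.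

(* An infinite ordinal is a regular cardinal iff it is a limit ordinal equal to
   its own cofinality. *)
Definition regular_cardinal (W : well_order) : Prop :=
  [/\ inhabited W,
      forall x : W, exists y, wlt x y
    & forall (x : W) (f : {y : W | wlt y x} -> W),
        exists b, forall y, wlt (f y) b].

Definition below (W : well_order) (C : category)
  (X : functor (wo_category W) C) (x : W) :=
  compf X (full_incl (C := wo_category W) (fun y => wlt y x)).

Definition below_cocone (W : well_order) (C : category)
  (X : functor (wo_category W) C) (x : W) : cocone (below X x).
Proof.
refine (@Cocone _ C (below X x) (X x)
  (fun y => fmap X (or_intror (proj2_sig y) :
     Hom (wo_category W) (sval y) x)) _).
move=> i j u; rewrite /= -fmap_comp; congr fmap; exact: (proof_irrelevance (wle (sval i) x)).
Defined.

Definition is_sequence (W : well_order) (C : category)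
  (X : functor (wo_category W) C) : Prop :=
  forall x, is_limit x -> exists _ : is_colimit (below_cocone X x), True.

Definition succ_maps_in (W : well_order) (C : category)
  (X : functor (wo_category W) C)
  (P : forall x y : C, Hom C x y -> Prop) : Prop :=
  forall (x y : W) (h : is_succ x y),
    P _ _ (fmap X (or_intror h.1 : Hom (wo_category W) x y)).

(* The two clauses say that colim_w Hom(a, X w) -> Hom(a, colim X) is bijective;
   the colimit on the left is over a directed poset. *)
Definition small_relative_to (C : category)
  (P : forall x y : C, Hom C x y -> Prop) (a : C) : Prop :=
  exists kappa : well_order,
  forall W : well_order, regular_cardinal W ->
  (exists f : kappa -> W, injective f) ->
  forall X : functor (wo_category W) C, is_sequence X -> succ_maps_in X P ->
  forall (T : cocone X) (_ : is_colimit T),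
    (forall g : Hom C a T, exists (w : W) (h : Hom C a (X w)), leg T w ∘ h = g)
    /\ (forall (w : W) (h h' : Hom C a (X w)), leg T w ∘ h = leg T w ∘ h' ->
        exists (w' : W) (u : Hom (wo_category W) w w'),
          fmap X u ∘ h = fmap X u ∘ h').

Record map_set (C : category) := MapSet {
  ms_idx : small;
  ms_dom : ms_idx -> C;
  ms_cod : ms_idx -> C;
  ms_map : forall i, Hom C (ms_dom i) (ms_cod i)
}.

Definition pushout_of (C : category) (I : map_set C) (x y : C)
  (f : Hom C x y) : Prop :=
  exists (i : ms_idx I) (u : Hom C (ms_dom i) x) (v : Hom C (ms_cod i) y),
    is_pushout (ms_map i) u v f.

Definition relative_cell_complex (C : category) (I : map_set C) (x y : C)
  (f : Hom C x y) : Prop :=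
  exists (W : well_order) (o : W) (X : functor (wo_category W) C) (T : cocone X)
    (_ : is_colimit T) (a : Hom C x (X o)) (b : Hom C T y),
    [/\ forall w, wle o w, is_sequence X,
        succ_maps_in X (fun x' y' => @pushout_of C I x' y')
      & [/\ is_iso a, is_iso b & f = b ∘ leg T o ∘ a]].

Definition permits_small_object_argument (C : category) (I : map_set C) :=
  forall i : ms_idx I,
    small_relative_to (fun x y => @relative_cell_complex C I x y) (ms_dom i).

Definition rlp (C : category) (I : map_set C) (x y : C) (p : Hom C x y) : Prop :=
  forall i : ms_idx I, has_lift (ms_map i) p.

Definition cofibrantly_generated (C : category) (M : model_data C) : Prop :=
  (exists I : map_set C, permits_small_object_argument I /\
     forall (x y : C) (p : Hom C x y), triv_fib M p <-> rlp I p) /\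
  (exists J : map_set C, permits_small_object_argument J /\
     forall (x y : C) (p : Hom C x y), fib M p <-> rlp J p).

(* U_S(C, D), where only the objects of D (those satisfying [P]) matter. *)
Definition relative_model (C : small_category) (P : sOb C -> Prop)
  (S : category) (M : model_data S) : model_data (Fun C S) :=
  let w (X Y : Fun C S) (f : Hom (Fun C S) X Y) :=
    forall d, P d -> weq M (nt f d) in
  let p (X Y : Fun C S) (f : Hom (Fun C S) X Y) :=
    forall d, P d -> fib M (nt f d) in
  @ModelData (Fun C S) w p
    (fun A B i => forall (X Y : Fun C S) (f : Hom (Fun C S) X Y),
       p X Y f -> w X Y f -> has_lift i f).

Definition objectwise_cofibrant (C : small_category) (S : category)
  (M : model_data S) (X : Fun C S) : Prop :=
  forall c : sOb C, cofibrant M (fob X c).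

Definition objectwise_cofibrant_approximation (C : small_category)
  (S : category) (M : model_data S) (Y X : Fun C S)
  (f : Hom (Fun C S) Y X) : Prop :=
  objectwise_cofibrant M Y /\ forall c, weq M (nt f c).

Lemma sig_eq (A : Type) (P : A -> Prop) (a b : {x : A | P x}) :
  sval a = sval b -> a = b.
Proof.
case: a b => [a Ha] [b Hb] /= E; subst b; congr exist; exact: proof_irrelevance.
Qed.

Record mono_map (m n : nat) : small := MonoMap {
  mfun :> 'I_m.+1 -> 'I_n.+1;
  mfun_mono : forall i j : 'I_m.+1, i <= j -> mfun i <= mfun j
}.

Lemma mono_map_eq (m n : nat) (f g : mono_map m n) :
  (forall i, f i = g i) -> f = g.
Proof.
case: f g => [f Hf] [g Hg] /= E.
have {}E : f = g by apply: functional_extensionality_dep.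
by subst g; congr MonoMap; apply: proof_irrelevance.
Qed.

Definition mono_id (n : nat) : mono_map n n := @MonoMap n n id (fun i j h => h).

Definition mono_comp (m n p : nat) (g : mono_map n p) (f : mono_map m n) :
  mono_map m p :=
  @MonoMap m p (fun i => g (f i))
    (fun i j h => mfun_mono g (mfun_mono f h)).

(* The object n of Delta is the ordered set 'I_n.+1. *)
Definition Delta : small_category.
Proof.
by refine (@SmallCategory nat (@CategoryOn nat mono_map mono_id mono_comp
  _ _ _)) => *; apply: mono_map_eq.
Defined.

Definition sSet : category := Fun (sop Delta) SET.

Definition simp (X : sSet) (n : nat) : small := fob X n.

Definition sact (X : sSet) (m n : nat) (t : mono_map m n) :
  simp X n -> simp X m := @fmap (sop Delta) SET X n m t.

Definition sapp (X Y : sSet) (f : Hom sSet X Y) (n : nat) :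
  simp X n -> simp Y n := nt f n.

Lemma sact_id (X : sSet) n (x : simp X n) : sact (mono_id n) x = x.
Proof. exact: (congr1 (fun h => h x) (@fmap_id (sop Delta) SET X n)). Qed.

Lemma sact_comp (X : sSet) m n p (s : mono_map n p) (t : mono_map m n)
  (x : simp X p) : sact (mono_comp s t) x = sact t (sact s x).
Proof.
exact: (congr1 (fun h => h x) (@fmap_comp (sop Delta) SET X p n m t s)).
Qed.

Lemma sapp_nat (X Y : sSet) (f : Hom sSet X Y) m n (t : mono_map m n)
  (x : simp X n) : sapp f (sact t x) = sact t (sapp f x).
Proof. exact: (congr1 (fun h => h x) (@nt_nat _ _ _ _ f n m t)). Qed.

Lemma shom_eq (X Y : sSet) (f g : Hom sSet X Y) :
  (forall n (x : simp X n), sapp f x = sapp g x) -> f = g.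
Proof.
move=> E; apply: nat_trans_eq => n; apply: functional_extensionality => x.
exact: E.
Qed.

Definition mk_sSet (A : nat -> small)
  (act : forall m n, mono_map m n -> A n -> A m)
  (act_id : forall n (x : A n), act n n (mono_id n) x = x)
  (act_comp : forall m n p (s : mono_map n p) (t : mono_map m n) (x : A p),
    act m p (mono_comp s t) x = act m n t (act n p s x)) : sSet.
Proof.
refine (@Functor (sop Delta) SET A (fun n m t => act m n t) _ _).
- by move=> n; apply: functional_extensionality => x; apply: act_id.
- move=> p n m t s; apply: functional_extensionality => x; exact: act_comp.
Defined.

Definition mk_shom (X Y : sSet) (f : forall n, simp X n -> simp Y n)
  (f_nat : forall m n (t : mono_map m n) (x : simp X n),
    f m (sact t x) = sact t (f n x)) : Hom sSet X Y.
Proof.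
refine (@NatTrans (sop Delta) SET X Y f _).
by move=> n m t; apply: functional_extensionality => x; apply: f_nat.
Defined.

Definition sdisc (A : small) : sSet :=
  @mk_sSet (fun _ => A) (fun _ _ _ a => a) (fun _ _ => erefl)
    (fun _ _ _ _ _ _ => erefl).

Definition sdisc_map (A B : small) (f : A -> B) : Hom sSet (sdisc A) (sdisc B) :=
  @mk_shom (sdisc A) (sdisc B) (fun _ => f) (fun _ _ _ _ => erefl).

Definition std (n : nat) : sSet.
Proof.
by refine (@mk_sSet (fun m => mono_map m n) (fun m p t s => mono_comp s t) _ _)
  => *; apply: mono_map_eq.
Defined.

Definition std_map (m n : nat) (t : mono_map m n) : Hom sSet (std m) (std n).
Proof.
by refine (@mk_shom (std m) (std n) (fun _ s => mono_comp t s) _) => *;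
  apply: mono_map_eq.
Defined.

(* The simplices of the k-th horn miss some vertex other than k. *)
Definition in_horn (n : nat) (k : 'I_n.+1) (m : nat) (s : mono_map m n) : Prop :=
  exists i : 'I_n.+1, i <> k /\ forall j, s j <> i.

Definition horn (n : nat) (k : 'I_n.+1) : sSet.
Proof.
refine (@mk_sSet (fun m => {s : mono_map m n | in_horn k s})
  (fun m p t s => exist _ (mono_comp (sval s) t) _) _ _).
Unshelve.
- by move=> p s; apply: sig_eq; apply: mono_map_eq.
- by move=> m q p t t' s; apply: sig_eq; apply: mono_map_eq.
- by case: s => s [i [ik hi]]; exists i; split=> // j; apply: hi.
Defined.

Definition horn_incl (n : nat) (k : 'I_n.+1) : Hom sSet (horn k) (std n) :=
  @mk_shom (horn k) (std n) (fun _ s => sval s) (fun _ _ _ _ => erefl).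

Definition sprod (X Y : sSet) : sSet.
Proof.
refine (@mk_sSet (fun n => (simp X n * simp Y n)%type)
  (fun m n t x => (sact t x.1, sact t x.2)) _ _).
- by move=> n [x y] /=; rewrite !sact_id.
- by move=> m n p s t [x y] /=; rewrite !sact_comp.
Defined.

Definition spair (X Y : sSet) (n : nat) (x : simp X n) (y : simp Y n) :
  simp (sprod X Y) n := (x, y).

Definition sprod_map (X Y X' Y' : sSet) (f : Hom sSet X X')
  (g : Hom sSet Y Y') : Hom sSet (sprod X Y) (sprod X' Y').
Proof.
refine (@mk_shom (sprod X Y) (sprod X' Y')
  (fun n x => (sapp f x.1, sapp g x.2)) _).
by move=> m n t [x y]; rewrite /= !sapp_nat.
Defined.

Definition ihom (K L : sSet) : sSet.
Proof.
refine (@mk_sSet (fun n => Hom sSet (sprod K (std n)) L)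
  (fun m n t h => h ∘ sprod_map (idm sSet K) (std_map t)) _ _).
- move=> n h; apply: shom_eq => p [x s]; congr (sapp h (_, _)).
  exact: mono_map_eq.
- by move=> m n p s t h; apply: shom_eq.
Defined.

Definition ihom_map (K K' L L' : sSet) (f : Hom sSet K K') (g : Hom sSet L L') :
  Hom sSet (ihom K' L) (ihom K L').
Proof.
refine (@mk_shom (ihom K' L) (ihom K L')
  (fun n h => g ∘ h ∘ sprod_map f (idm sSet (std n))) _).
by move=> m n t h; apply: shom_eq.
Defined.

Definition spullback (X Y Z : sSet) (f : Hom sSet X Z) (g : Hom sSet Y Z) : sSet.
Proof.
refine (@mk_sSet
  (fun n => {p : simp X n * simp Y n | sapp f p.1 = sapp g p.2})
  (fun m n t p => exist _ (sact t (sval p).1, sact t (sval p).2) _) _ _).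
Unshelve.
- by move=> n [[x y] h]; apply: sig_eq; rewrite /= !sact_id.
- by move=> m n q s t [[x y] h]; apply: sig_eq; rewrite /= !sact_comp.
- by case: p => -[x y] h; rewrite !sapp_nat h.
Defined.

Definition vtx (n : nat) (i : 'I_n.+1) (m : nat) : mono_map m n :=
  @MonoMap m n (fun _ => i) (fun _ _ _ => leqnn i).

Definition kan_fibration (X Y : sSet) (p : Hom sSet X Y) : Prop :=
  forall (n : nat) (k : 'I_n.+1), 0 < n -> has_lift (horn_incl k) p.

Definition kan_complex (K : sSet) : Prop :=
  forall (n : nat) (k : 'I_n.+1) (u : Hom sSet (horn k) K), 0 < n ->
    exists h : Hom sSet (std n) K, h ∘ horn_incl k = u.

Definition shomotopic (X K : sSet) (f g : Hom sSet X K) : Prop :=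
  exists H : Hom sSet (sprod X (std 1)) K, forall n (x : simp X n),
    sapp H (spair x (vtx ord0 n : simp (std 1) n)) = sapp f x /\
    sapp H (spair x (vtx ord_max n : simp (std 1) n)) = sapp g x.

(* f is a weak equivalence iff f^* : [Y, K] -> [X, K] is bijective for every Kan
   complex K; homotopy of maps into a Kan complex is an equivalence relation. *)
Definition weak_homotopy_equivalence (X Y : sSet) (f : Hom sSet X Y) : Prop :=
  forall K : sSet, kan_complex K ->
    (forall u : Hom sSet X K, exists v : Hom sSet Y K, shomotopic (v ∘ f) u) /\
    (forall v w : Hom sSet Y K,
       shomotopic (v ∘ f) (w ∘ f) -> shomotopic v w).

Definition smono (X Y : sSet) (f : Hom sSet X Y) : Prop :=
  forall n, injective (@sapp X Y f n).

Definition kan_quillen : model_data sSet :=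
  ModelData weak_homotopy_equivalence kan_fibration smono.

(* The degenerate n-simplex on a vertex. *)
Definition sdeg (X : sSet) (n : nat) (x : simp X 0) : simp X n :=
  sact (vtx ord0 n) x.

Lemma sact_sdeg (X : sSet) m n (t : mono_map m n) (x : simp X 0) :
  sact t (sdeg n x) = sdeg m x.
Proof.
by rewrite /sdeg -sact_comp; congr sact; apply: mono_map_eq => i; apply: val_inj.
Qed.

Lemma sapp_sdeg (X Y : sSet) (f : Hom sSet X Y) n (x : simp X 0) :
  sapp f (sdeg n x) = sdeg n (sapp f x).
Proof. exact: sapp_nat. Qed.

Record simplicial_structure (S : category) := SimplicialStructure {
  Map : S -> S -> sSet;
  mcomp : forall X Y Z : S, Hom sSet (sprod (Map Y Z) (Map X Y)) (Map X Z);
  vert : forall X Y : S, Hom S X Y -> simp (Map X Y) 0;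
  unvert : forall X Y : S, simp (Map X Y) 0 -> Hom S X Y;
  vertK : forall X Y, cancel (@vert X Y) (@unvert X Y);
  unvertK : forall X Y, cancel (@unvert X Y) (@vert X Y);
  vert_comp : forall (X Y Z : S) (g : Hom S Y Z) (f : Hom S X Y),
    vert (g ∘ f) = sapp (mcomp X Y Z) (spair (vert g) (vert f));
  mcompA : forall (X Y Z W : S) n (h : simp (Map Z W) n) (g : simp (Map Y Z) n)
    (f : simp (Map X Y) n),
    sapp (mcomp X Z W) (spair h (sapp (mcomp X Y Z) (spair g f))) =
    sapp (mcomp X Y W) (spair (sapp (mcomp Y Z W) (spair h g)) f);
  mcomp_idl : forall (X Y : S) n (f : simp (Map X Y) n),
    sapp (mcomp X Y Y) (spair (sdeg n (vert (idm S Y))) f) = f;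
  mcomp_idr : forall (X Y : S) n (f : simp (Map X Y) n),
    sapp (mcomp X X Y) (spair f (sdeg n (vert (idm S X)))) = f
}.
Arguments Map {S} _ _ _.
Arguments mcomp {S} _ _ _ _.
Arguments vert {S} _ {X Y} _.
Arguments unvert {S} _ {X Y} _.

Definition Map_post (S : category) (E : simplicial_structure S) (A X Y : S)
  (p : Hom S X Y) : Hom sSet (Map E A X) (Map E A Y).
Proof.
refine (@mk_shom (Map E A X) (Map E A Y)
  (fun n f => sapp (mcomp E A X Y) (spair (sdeg n (vert E p)) f)) _).
by move=> m n t f; rewrite -sapp_nat -(sact_sdeg t).
Defined.

Definition Map_pre (S : category) (E : simplicial_structure S) (A B X : S)
  (i : Hom S A B) : Hom sSet (Map E B X) (Map E A X).
Proof.
refine (@mk_shom (Map E B X) (Map E A X)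
  (fun n f => sapp (mcomp E A B X) (spair f (sdeg n (vert E i)))) _).
by move=> m n t f; rewrite -sapp_nat -(sact_sdeg t).
Defined.

(* Map(B, X) -> Map(A, X) x_{Map(A, Y)} Map(B, Y) *)
Definition pullback_hom (S : category) (E : simplicial_structure S)
  (A B X Y : S) (i : Hom S A B) (p : Hom S X Y) :
  Hom sSet (Map E B X) (spullback (Map_post E A p) (Map_pre E Y i)).
Proof.
refine (@mk_shom (Map E B X) (spullback (Map_post E A p) (Map_pre E Y i))
  (fun n f => exist _ (sapp (Map_pre E X i) f, sapp (Map_post E B p) f)
     (mcompA _ _ _)) _).
by move=> m n t f; apply: sig_eq; congr (_, _); apply: sapp_nat.
Defined.

(* [tensor (K, X)] is K ⊙ X and [cotensor (K, Y)] is Y^K. *)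
Record tensor_structure (S : category) (E : simplicial_structure S) :=
  TensorStructure {
  tensor : functor (prodc sSet S) S;
  cotensor : functor (prodc (op sSet) S) S;
  tensor_iso : forall (K : sSet) (X Y : S),
    iso (C := sSet) (Map E (tensor (K, X)) Y) (ihom K (Map E X Y));
  tensor_iso_nat : forall (K K' : sSet) (X X' Y Y' : S)
    (k : Hom sSet K K') (f : Hom S X X') (g : Hom S Y Y'),
    iso_to (tensor_iso K X Y') ∘
      (Map_pre E Y' (fmap tensor ((k, f) : Hom (prodc sSet S) (K, X) (K', X')))
       ∘ Map_post E (tensor (K', X')) g) =
    ihom_map k (Map_pre E Y' f ∘ Map_post E X' g) ∘ iso_to (tensor_iso K' X' Y);
  cotensor_iso : forall (K : sSet) (X Y : S),
    iso (C := sSet) (Map E X (cotensor (K, Y))) (ihom K (Map E X Y));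
  cotensor_iso_nat : forall (K K' : sSet) (X X' Y Y' : S)
    (k : Hom sSet K K') (f : Hom S X X') (g : Hom S Y Y'),
    iso_to (cotensor_iso K X Y') ∘
      (Map_pre E (cotensor (K, Y')) f ∘
       Map_post E X' (fmap cotensor
         ((k, g) : Hom (prodc (op sSet) S) (K', Y) (K, Y')))) =
    ihom_map k (Map_pre E Y' f ∘ Map_post E X' g) ∘ iso_to (cotensor_iso K' X' Y)
}.
Arguments tensor {S E} _.

Record simplicial_model_category := SimplicialModelCategory {
  smc_cat :> category;
  smc_mod : model_structure smc_cat;
  smc_simp : simplicial_structure smc_cat;
  smc_tens : tensor_structure smc_simp;
  smc_SM7 : forall (A B X Y : smc_cat) (i : Hom smc_cat A B)
    (p : Hom smc_cat X Y), cof smc_mod i -> fib smc_mod p ->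
    fib kan_quillen (pullback_hom smc_simp i p) /\
    (weq smc_mod i \/ weq smc_mod p ->
     weq kan_quillen (pullback_hom smc_simp i p))
}.

Lemma vert_post_pre (S : category) (E : simplicial_structure S)
  (A B X Y : S) (i : Hom S A B) (f : Hom S B X) (p : Hom S X Y) :
  vert E (p ∘ f ∘ i) = sapp (Map_pre E Y i) (sapp (Map_post E B p) (vert E f)).
Proof.
have s0 (Z Z' : S) (h : Hom S Z Z') : sdeg 0 (vert E h) = vert E h.
  rewrite -[RHS](@sact_id (Map E Z Z') 0); congr sact.
  by apply: mono_map_eq => j; rewrite [j]ord1; apply: val_inj.
by rewrite !vert_comp /= !s0.
Qed.

Lemma Map_post_id (S : category) (E : simplicial_structure S) (A X : S) :
  Map_post E A (idm S X) = idm sSet (Map E A X).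
Proof. by apply: shom_eq => n x; apply: mcomp_idl. Qed.

Lemma Map_pre_id (S : category) (E : simplicial_structure S) (A X : S) :
  Map_pre E X (idm S A) = idm sSet (Map E A X).
Proof. by apply: shom_eq => n x; apply: mcomp_idr. Qed.

Definition sprod_pt (K : sSet) : Hom sSet K (sprod K (std 0)).
Proof.
refine (@mk_shom K (sprod K (std 0))
  (fun n x => spair x (vtx ord0 n : simp (std 0) n)) _).
by move=> m n t x; congr (_, _); apply: mono_map_eq.
Defined.

Definition sprod_fst (K L : sSet) : Hom sSet (sprod K L) K :=
  @mk_shom (sprod K L) K (fun n x => x.1) (fun _ _ _ _ => erefl).

Definition adj (S : category) (E : simplicial_structure S)
  (T : tensor_structure E) (K : sSet) (X Y : S)
  (f : Hom S (tensor T (K, X)) Y) : Hom sSet K (Map E X Y) :=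
  (sapp (iso_to (tensor_iso T K X Y)) (vert E f)
     : Hom sSet (sprod K (std 0)) (Map E X Y)) ∘ sprod_pt K.

Definition unadj (S : category) (E : simplicial_structure S)
  (T : tensor_structure E) (K : sSet) (X Y : S)
  (g : Hom sSet K (Map E X Y)) : Hom S (tensor T (K, X)) Y :=
  unvert E (sapp (iso_from (tensor_iso T K X Y))
    (g ∘ sprod_fst K (std 0) : simp (ihom K (Map E X Y)) 0)).

Lemma adjK (S : category) (E : simplicial_structure S)
  (T : tensor_structure E) (K : sSet) (X Y : S) :
  cancel (@adj S E T K X Y) (@unadj S E T K X Y).
Proof.
move=> f; rewrite /unadj.
rewrite (_ : adj f ∘ sprod_fst K (std 0) =
  (sapp (iso_to (tensor_iso T K X Y)) (vert E f)
     : Hom sSet (sprod K (std 0)) (Map E X Y))); last first.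
  apply: shom_eq => n [x s]; rewrite /adj.
  apply: (congr1 (fun r : simp (std 0) n => @sapp (sprod K (std 0)) _
    (sapp (iso_to (tensor_iso T K X Y)) (vert E f)) n (spair x r))).
  by apply: mono_map_eq => j; rewrite [s j]ord1; apply: val_inj.
have := iso_from_to (tensor_iso T K X Y).
move/(congr1 (fun h => @sapp (Map E (tensor T (K, X)) Y)
  (Map E (tensor T (K, X)) Y) h 0 (vert E f))) => e.
exact: (etrans (congr1 (@unvert S E _ _) e) (vertK E f)).
Qed.

Lemma unadjK (S : category) (E : simplicial_structure S)
  (T : tensor_structure E) (K : sSet) (X Y : S) :
  cancel (@unadj S E T K X Y) (@adj S E T K X Y).
Proof.
move=> g; rewrite /adj /unadj unvertK.
have := iso_to_from (tensor_iso T K X Y).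
move/(congr1 (fun h => @sapp (ihom K (Map E X Y)) (ihom K (Map E X Y)) h 0
  (g ∘ sprod_fst K (std 0)))) => e.
rewrite (_ : sapp (iso_to _) _ = (g ∘ sprod_fst K (std 0)
  : simp (ihom K (Map E X Y)) 0)); last exact: e.
by apply: shom_eq.
Qed.

Lemma adj_nat (S : category) (E : simplicial_structure S)
  (T : tensor_structure E) (K K' : sSet) (X X' Y Y' : S)
  (k : Hom sSet K K') (h : Hom S X X') (g : Hom S Y Y')
  (f : Hom S (tensor T (K', X')) Y) :
  adj (g ∘ f ∘ fmap (tensor T) ((k, h) : Hom (prodc sSet S) (K, X) (K', X'))) =
  Map_pre E Y' h ∘ Map_post E X' g ∘ adj f ∘ k.
Proof.
rewrite /adj vert_post_pre.
have := tensor_iso_nat T k h g.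
move/(congr1 (fun h => @sapp _ _ h 0 (vert E f))) => e.
rewrite [X in X ∘ _ = _]e.
by apply: shom_eq => n x.
Qed.

Lemma adj_post (S : category) (E : simplicial_structure S)
  (T : tensor_structure E) (K : sSet) (X Y Y' : S) (g : Hom S Y Y')
  (f : Hom S (tensor T (K, X)) Y) : adj (g ∘ f) = Map_post E X g ∘ adj f.
Proof.
have := adj_nat (idm sSet K) (idm S X) g f.
rewrite (_ : fmap _ _ = idm S (tensor T (K, X))); last exact: fmap_id.
by rewrite compm_idr Map_pre_id compm_idl compm_idr.
Qed.

Definition disc_tr (S : category) (E : simplicial_structure S) (A : small)
  (Y Z : S) (g : A -> Hom S Y Z) : Hom sSet (sdisc A) (Map E Y Z) :=
  @mk_shom (sdisc A) (Map E Y Z) (fun n a => sdeg n (vert E (g a)))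
    (fun m n t a => esym (sact_sdeg t (vert E (g a)))).

Definition disc_in (S : category) (E : simplicial_structure S)
  (T : tensor_structure E) (A : small) (Y : S) (a : A) :
  Hom S Y (tensor T (sdisc A, Y)) :=
  unvert E (sapp (adj (idm S (tensor T (sdisc A, Y)))) (a : simp (sdisc A) 0)).

Lemma vert_disc_in (S : category) (E : simplicial_structure S)
  (T : tensor_structure E) (A : small) (Y Z : S)
  (f : Hom S (tensor T (sdisc A, Y)) Z) (a : A) :
  vert E (f ∘ disc_in T Y a) = sapp (adj f) (a : simp (sdisc A) 0).
Proof.
rewrite -[in RHS](compm_idr f) adj_post /disc_in.
rewrite -[LHS](congr1 (vert E) (compm_idr _)) vert_post_pre unvertK Map_pre_id.
by [].
Qed.

(* For a discrete simplicial set A, the object A ⊙ Y is the coproduct of copies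
   of Y indexed by A. *)
Definition disc_tensor (S : category) (E : simplicial_structure S)
  (T : tensor_structure E) (A : small) (Y : S) : coproduct (fun _ : A => Y).
Proof.
refine (@Coproduct S A (fun _ => Y) (tensor T (sdisc A, Y))
  (fun a => disc_in T Y a) (fun Z g => unadj T (disc_tr E g)) _ _).
- move=> Z g a; apply: (can_inj (@vertK S E _ _)).
  rewrite vert_disc_in unadjK /=.
  rewrite -[RHS](@sact_id (Map E Y Z) 0); congr sact.
  by apply: mono_map_eq => j; rewrite [j]ord1; apply: val_inj.
- move=> Z g f Hf; apply: (can_inj (@adjK S E T _ _ _)); rewrite unadjK.
  apply: shom_eq => n a /=; rewrite -(Hf a) vert_disc_in.
  exact: (sapp_nat (adj f) (vtx ord0 n) (a : simp (sdisc A) 0)).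
Defined.

Record arrow (D : small_category) : small := Arrow {
  src : sOb D;
  tgt : sOb D;
  arr : Hom D src tgt
}.

Definition act_l (D C : small_category) (X : Fun (sprodc (sop D) C) sSet)
  (b b' : sOb D) (u : Hom D b b') (c : sOb C) :
  Hom sSet (fob X (b', c)) (fob X (b, c)) :=
  @fmap (sprodc (sop D) C) sSet X (b', c) (b, c) (u, idm C c).

Definition act_r (D C : small_category) (X : Fun (sprodc (sop D) C) sSet)
  (a : sOb D) (c c' : sOb C) (h : Hom C c c') :
  Hom sSet (fob X (a, c)) (fob X (a, c')) :=
  @fmap (sprodc (sop D) C) sSet X (a, c) (a, c') (idm D a, h).

Definition tmap_l (S : category) (E : simplicial_structure S)
  (T : tensor_structure E) (K K' : sSet) (k : Hom sSet K K') (Y : S) :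
  Hom S (tensor T (K, Y)) (tensor T (K', Y)) :=
  @fmap (prodc sSet S) S (tensor T) (K, Y) (K', Y) (k, idm S Y).

Definition tmap_r (S : category) (E : simplicial_structure S)
  (T : tensor_structure E) (K : sSet) (Y Y' : S) (f : Hom S Y Y') :
  Hom S (tensor T (K, Y)) (tensor T (K, Y')) :=
  @fmap (prodc sSet S) S (tensor T) (K, Y) (K, Y') (idm sSet K, f).

Lemma tmap_l_id (S : category) (E : simplicial_structure S)
  (T : tensor_structure E) (K : sSet) (Y : S) :
  tmap_l T (idm sSet K) Y = idm S (tensor T (K, Y)).
Proof. exact: (@fmap_id (prodc sSet S) S (tensor T) (K, Y)). Qed.

Lemma tmap_l_comp (S : category) (E : simplicial_structure S)
  (T : tensor_structure E) (K K' K'' : sSet) (k' : Hom sSet K' K'')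
  (k : Hom sSet K K') (Y : S) :
  tmap_l T (k' ∘ k) Y = tmap_l T k' Y ∘ tmap_l T k Y.
Proof.
rewrite /tmap_l -(@fmap_comp (prodc sSet S) S (tensor T)) /=.
by congr fmap; rewrite /= compm_idl.
Qed.

Lemma tmap_lr (S : category) (E : simplicial_structure S)
  (T : tensor_structure E) (K K' : sSet) (k : Hom sSet K K') (Y Y' : S)
  (f : Hom S Y Y') :
  tmap_l T k Y' ∘ tmap_r T K f = tmap_r T K' f ∘ tmap_l T k Y.
Proof.
rewrite /tmap_l /tmap_r -!(@fmap_comp (prodc sSet S) S (tensor T)) /=.
congr fmap; congr (_, _).
by rewrite compm_idl compm_idr.
Qed.

Lemma act_r_id (D C : small_category) (X : Fun (sprodc (sop D) C) sSet) a c :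
  act_r X a (idm C c) = idm sSet (fob X (a, c)).
Proof. exact: (@fmap_id _ _ X (a, c)). Qed.

Lemma act_r_comp (D C : small_category) (X : Fun (sprodc (sop D) C) sSet) a
  (c c' c'' : sOb C) (h' : Hom C c' c'') (h : Hom C c c') :
  act_r X a (h' ∘ h) = act_r X a h' ∘ act_r X a h.
Proof.
rewrite /act_r -[RHS](@fmap_comp (sprodc (sop D) C) sSet X).
by congr fmap; congr (_, _); rewrite /= compm_idl.
Qed.

Lemma act_lr (D C : small_category) (X : Fun (sprodc (sop D) C) sSet)
  (b b' : sOb D) (u : Hom D b b') (c c' : sOb C) (h : Hom C c c') :
  act_r X b h ∘ act_l X u c = act_l X u c' ∘ act_r X b' h.
Proof.
rewrite /act_r /act_l -!(@fmap_comp (sprodc (sop D) C) sSet X).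
congr fmap; congr (_, _) => /=; last by rewrite compm_idl compm_idr.
by rewrite compm_idl compm_idr.
Qed.

Section TensorOver.

Variables (S : category) (cS : cocomplete S) (E : simplicial_structure S).
Variables (T : tensor_structure E) (D C : small_category).

(* X ⊗_D^C Y at c is the coequalizer [over_ob X Y c] of
   coprod_(u : b -> b') X(b', c) ⊙ Y(b) ==> coprod_a X(a, c) ⊙ Y(a). *)

Definition over_arrows (X : Fun (sprodc (sop D) C) sSet) (Y : Fun D S)
  (c : sOb C) : coproduct _ :=
  coprod cS (fun u : arrow D =>
    tensor T (fob X (tgt u, c), fob Y (src u))).

Definition over_objects (X : Fun (sprodc (sop D) C) sSet) (Y : Fun D S)
  (c : sOb C) : coproduct _ :=
  coprod cS (fun a : sOb D => tensor T (fob X (a, c), fob Y a)).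

Definition over_maps_l (X : Fun (sprodc (sop D) C) sSet) (Y : Fun D S)
  (c : sOb C) : Hom S (over_arrows X Y c) (over_objects X Y c) :=
  cp_desc (over_arrows X Y c) (fun u =>
    cp_in (over_objects X Y c) (src u) ∘ tmap_l T (act_l X (arr u) c) _).

Definition over_maps_r (X : Fun (sprodc (sop D) C) sSet) (Y : Fun D S)
  (c : sOb C) : Hom S (over_arrows X Y c) (over_objects X Y c) :=
  cp_desc (over_arrows X Y c) (fun u =>
    cp_in (over_objects X Y c) (tgt u) ∘ tmap_r T _ (fmap Y (arr u))).

Definition over_ob (X : Fun (sprodc (sop D) C) sSet) (Y : Fun D S)
  (c : sOb C) : coequalizer (over_maps_l X Y c) (over_maps_r X Y c) :=
  coeq cS (over_maps_l X Y c) (over_maps_r X Y c).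

Definition over_in (X : Fun (sprodc (sop D) C) sSet) (Y : Fun D S)
  (c : sOb C) (a : sOb D) :
  Hom S (tensor T (fob X (a, c), fob Y a)) (over_ob X Y c) :=
  ce_proj (over_ob X Y c) ∘ cp_in (over_objects X Y c) a.

Definition balanced (X : Fun (sprodc (sop D) C) sSet) (Y : Fun D S)
  (c : sOb C) (Z : S)
  (g : forall a : sOb D, Hom S (tensor T (fob X (a, c), fob Y a)) Z) : Prop :=
  forall (b b' : sOb D) (u : Hom D b b'),
    g b ∘ tmap_l T (act_l X u c) _ = g b' ∘ tmap_r T _ (fmap Y u).

Lemma over_in_balanced X Y c : balanced (@over_in X Y c).
Proof.
move=> b b' u; have := ce_eq (over_ob X Y c).
move/(congr1 (fun h => h ∘ cp_in (over_arrows X Y c) (Arrow u))).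
by rewrite -!compmA !cp_fac /= !compmA.
Qed.

Lemma over_desc_eq X Y c Z g : @balanced X Y c Z g ->
  cp_desc (over_objects X Y c) g ∘ over_maps_l X Y c =
  cp_desc (over_objects X Y c) g ∘ over_maps_r X Y c.
Proof.
move=> Hg.
rewrite [LHS](cp_uniq (over_arrows X Y c)
  (fun u => g (src u) ∘ tmap_l T (act_l X (arr u) c) _)); last first.
  by move=> u; rewrite -compmA cp_fac compmA cp_fac.
apply/esym/cp_uniq => u.
by rewrite -compmA cp_fac compmA cp_fac Hg.
Qed.

Definition over_desc X Y c Z g (Hg : @balanced X Y c Z g) :
  Hom S (over_ob X Y c) Z := ce_desc (over_ob X Y c) (over_desc_eq Hg).

Lemma over_fac X Y c Z g (Hg : @balanced X Y c Z g) a :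
  over_desc Hg ∘ over_in X Y c a = g a.
Proof. by rewrite /over_desc /over_in compmA ce_fac cp_fac. Qed.

Lemma over_ext X Y c Z (f f' : Hom S (over_ob X Y c) Z) :
  (forall a, f ∘ over_in X Y c a = f' ∘ over_in X Y c a) -> f = f'.
Proof.
move=> H.
have e : (f ∘ ce_proj (over_ob X Y c)) ∘ over_maps_l X Y c =
         (f ∘ ce_proj (over_ob X Y c)) ∘ over_maps_r X Y c.
  by rewrite -!compmA ce_eq.
rewrite (ce_uniq (over_ob X Y c) e erefl); apply/esym/ce_uniq.
rewrite [RHS](cp_uniq (over_objects X Y c)
  (fun a => f ∘ over_in X Y c a)); last by move=> a; rewrite -compmA.
by apply: cp_uniq => a; rewrite H -compmA.
Qed.

Lemma over_map_balanced (X X' : Fun (sprodc (sop D) C) sSet) (Y : Fun D S)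
  (c c' : sOb C)
  (k : forall a : sOb D, Hom sSet (fob X (a, c)) (fob X' (a, c')))
  (kP : forall (b b' : sOb D) (u : Hom D b b'),
    k b ∘ act_l X u c = act_l X' u c' ∘ k b') :
  @balanced X Y c _ (fun a => over_in X' Y c' a ∘ tmap_l T (k a) _).
Proof.
move=> b b' u.
rewrite -compmA -tmap_l_comp kP tmap_l_comp compmA over_in_balanced.
by rewrite -!compmA tmap_lr.
Qed.

Definition over_map (X X' : Fun (sprodc (sop D) C) sSet) (Y : Fun D S)
  (c c' : sOb C) k kP : Hom S (over_ob X Y c) (over_ob X' Y c') :=
  over_desc (@over_map_balanced X X' Y c c' k kP).

Definition over_act (X : Fun (sprodc (sop D) C) sSet) (Y : Fun D S)
  (c c' : sOb C) (h : Hom C c c') :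
  Hom S (over_ob X Y c) (over_ob X Y c') :=
  over_map Y (fun b b' u => act_lr X u h).

Lemma over_act_in (X : Fun (sprodc (sop D) C) sSet) (Y : Fun D S)
  (c c' : sOb C) (h : Hom C c c') a :
  over_act X Y h ∘ over_in X Y c a =
  over_in X Y c' a ∘ tmap_l T (act_r X a h) _.
Proof. exact: over_fac. Qed.

Definition tensor_over (X : Fun (sprodc (sop D) C) sSet) (Y : Fun D S) : Fun C S.
Proof.
refine (@Functor C S (fun c => over_ob X Y c : S)
  (fun c c' h => over_act X Y h) _ _).
- move=> c; apply: over_ext => a.
  by rewrite over_act_in act_r_id tmap_l_id compm_idl compm_idr.
- move=> c c' c'' h' h; apply: over_ext => a.
  rewrite over_act_in act_r_comp tmap_l_comp compmA -(over_act_in X Y h').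
  by rewrite -[LHS]compmA -(over_act_in X Y h) compmA.
Defined.

Lemma nt_act_l (X X' : Fun (sprodc (sop D) C) sSet)
  (f : Hom (Fun (sprodc (sop D) C) sSet) X X') (c : sOb C)
  (b b' : sOb D) (u : Hom D b b') :
  nt f (b, c) ∘ act_l X u c = act_l X' u c ∘ nt f (b', c).
Proof. exact: (@nt_nat (sprodc (sop D) C) sSet X X' f (b', c) (b, c)). Qed.

Lemma nt_act_r (X X' : Fun (sprodc (sop D) C) sSet)
  (f : Hom (Fun (sprodc (sop D) C) sSet) X X') (a : sOb D)
  (c c' : sOb C) (h : Hom C c c') :
  nt f (a, c') ∘ act_r X a h = act_r X' a h ∘ nt f (a, c).
Proof. exact: (@nt_nat (sprodc (sop D) C) sSet X X' f (a, c) (a, c')). Qed.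

Definition tensor_over_map (X X' : Fun (sprodc (sop D) C) sSet)
  (f : Hom (Fun (sprodc (sop D) C) sSet) X X') (Y : Fun D S) :
  Hom (Fun C S) (tensor_over X Y) (tensor_over X' Y).
Proof.
refine (@NatTrans C S (tensor_over X Y) (tensor_over X' Y)
  (fun c => over_map Y (nt_act_l f c)) _).
move=> c c' h; apply: over_ext => a /=.
rewrite -!compmA over_act_in over_fac compmA over_fac compmA over_act_in.
by rewrite -!compmA -!tmap_l_comp nt_act_r.
Defined.

End TensorOver.

(* For a full subcategory D of C: (d, c) |-> mor_C(d, c), seen as discrete
   simplicial sets. *)
Definition mor_diagram (C : small_category) (P : sOb C -> Prop) :
  Fun (sprodc (sop (full_sub P)) C) sSet.
Proof.
refine (@Functor (sprodc (sop (full_sub P)) C) sSet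
  (fun dc => sdisc (Hom C (sval dc.1) dc.2))
  (fun dc dc' uh => sdisc_map (fun f => uh.2 ∘ f ∘ uh.1)) _ _).
- by move=> [d c]; apply: shom_eq => n f; rewrite /= compm_idr compm_idl.
- move=> [d c] [d' c'] [d'' c''] [u' h'] [u h]; apply: shom_eq => n f.
  by rewrite /= !compmA.
Defined.

Lemma adj_tmap_l (S : category) (E : simplicial_structure S)
  (T : tensor_structure E) (K K' : sSet) (k : Hom sSet K K') (Y Z : S)
  (f : Hom S (tensor T (K', Y)) Z) : adj (f ∘ tmap_l T k Y) = adj f ∘ k.
Proof.
have := adj_nat k (idm S Y) (idm S Z) f.
by rewrite compm_idl Map_pre_id Map_post_id !compm_idl.
Qed.

Lemma adj_tmap_r (S : category) (E : simplicial_structure S)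
  (T : tensor_structure E) (K : sSet) (Y Y' Z : S) (h : Hom S Y Y')
  (f : Hom S (tensor T (K, Y')) Z) :
  adj (f ∘ tmap_r T K h) = Map_pre E Z h ∘ adj f.
Proof.
have := adj_nat (idm sSet K) h (idm S Z) f.
by rewrite compm_idl Map_post_id !compm_idr.
Qed.

Lemma adj_disc_desc (S : category) (E : simplicial_structure S)
  (T : tensor_structure E) (A : small) (Y Z : S) (g : A -> Hom S Y Z) :
  adj (cp_desc (disc_tensor T A Y) g : Hom S (tensor T (sdisc A, Y)) Z) =
  disc_tr E g.
Proof. exact: unadjK. Qed.

Section Xi.

Variables (S : simplicial_model_category) (C : small_category).
Variable P : sOb C -> Prop.

Local Notation cS := (mod_cocomplete (smc_mod S)).
Local Notation T := (smc_tens S).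

(* On the summand f of F(d, c) ⊙ Y(d) = coprod_(f : d -> c) Y(d), this is
   Y(f). *)
Definition ev_at (Y : Fun C S) (c : sOb C) (d : sOb (full_sub P)) :
  Hom S (tensor T (fob (mor_diagram P) (d, c), fob (res P Y) d)) (fob Y c) :=
  cp_desc (disc_tensor T (Hom C (sval d) c) (fob Y (sval d)))
    (fun f => fmap Y f).

Lemma ev_balanced (Y : Fun C S) (c : sOb C) :
  balanced (T := smc_tens S) (Y := res P Y) (@ev_at Y c).
Proof.
move=> b b' u; apply: (can_inj (@adjK S _ T _ _ _)).
rewrite adj_tmap_l adj_tmap_r !adj_disc_desc; apply: shom_eq => n f /=.
rewrite compm_idl fmap_comp vert_comp.
exact: esym (sapp_sdeg (mcomp _ _ _ _) n (spair _ _)).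
Qed.

Definition ev (Y : Fun C S) :
  Hom (Fun C S) (tensor_over cS T (mor_diagram P) (res P Y)) Y.
Proof.
refine (@NatTrans C S (tensor_over cS T (mor_diagram P) (res P Y)) Y
  (fun c => over_desc cS (ev_balanced Y c)) _).
move=> c c' h; apply: over_ext => d.
rewrite -!compmA over_act_in over_fac.
rewrite [LHS](compmA (over_desc cS (ev_balanced Y c'))) over_fac.
apply: (can_inj (@adjK S _ T _ _ _)).
rewrite adj_tmap_l adj_post !adj_disc_desc; apply: shom_eq => n f /=.
rewrite compm_idr fmap_comp vert_comp.
exact: esym (sapp_sdeg (mcomp _ _ _ _) n (spair _ _)).
Defined.

Definition xi (E : Fun (sprodc (sop (full_sub P)) C) sSet)
  (theta : Hom (Fun (sprodc (sop (full_sub P)) C) sSet) E (mor_diagram P))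
  (qX X : Fun C S) (eta : Hom (Fun C S) qX X) :
  Hom (Fun C S) (tensor_over cS T E (res P qX)) X :=
  eta ∘ ev qX ∘ tensor_over_map cS T theta (res P qX).

End Xi.

(* Main.v *)
From mathcomp Require Import all_boot zify.
From mathcomp Require classical_sets.
From Stdlib Require Import FunctionalExtensionality ProofIrrelevance Classical
  ClassicalEpsilon.
Require Import Defs.

Set Implicit Arguments.
Unset Strict Implicit.
Unset Printing Implicit Defensive.

(** Write E_c for the diagram E(-, c) on D^op, and Z^A for the diagram
    d |-> Map(A(d), Z) in simplicial sets.  A morphism from the tensor product of
    E_c and A to Z is a natural map E_c -> Z^A.

    Cofibrancy.  By SM7 a map of S-diagrams that is a trivial fibration on the
    objects of D induces a Kan fibration and weak equivalence of mapping spaces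
    out of a cofibrant A(d); so lifting problems for the tensor product transpose
    to lifting problems that the cofibrant E solves ([tensor_over_cofibrant]).

    Weak equivalence.  For c in D the diagram F_c = mor(-, c) is representable,
    so a vertex of E(c, c) over the identity is a section s of theta : E_c -> F_c.
    It yields a section sigma of the comparison map gamma from the tensor product
    of E_c and qX to qX(c).  Hence gamma is a retract of sigma gamma, and it is
    enough that j sigma gamma is a weak equivalence for a weak equivalence j to a
    fibrant object Z ([comparison_weq]).  Transposed to the diagram
    K = Z^qX of Kan complexes, j is a natural map u : E_c -> K and j sigma gamma
    is u s theta.  A natural homotopy between the two
    ([projective_htpy]) becomes a morphism out of the tensor product with the
    cylinder of E, whose end inclusions are weak equivalences ([incl_weq]); this
    makes j sigma gamma a weak equivalence because j is one.

    The homotopy.  Factor theta as E_c -> H -> F_c, where H is obtained from E_c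
    by freely adding fillers ([completion]), so that u extends to H
    ([completion_lift]).  Each H(d) is a Kan complex, so the hypothesis on theta
    gives a homotopy from a map factoring through F(d, c) to the inclusion of
    E(d, c) in H(d).  It extends over H(d) and makes H(d) -> F(d, c) acyclic: it
    lifts against all monomorphisms ([completion_acyclic]).  Cofibrancy of E then
    gives a natural homotopy in H between the inclusion and its composite with
    s theta ([cofibrant_section]), and u carries it to K.

    The simplicial input is that Kan fibrations lift against the inclusion of
    A x I and B x {e} in B x I.  For the boundary of a simplex this is the usual
    sequence of horn fillings ([kan_prism]); the general case follows by
    induction over cells ([cyl_fill]).  Partial maps are treated throughout as
    functional relations, which spares the formation of pushouts and unions. *)

(** * Filling problems for simplicial sets *)

Definition srel (B X : sSet) := forall n, simp B n -> simp X n -> Prop.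
Definition spred (B : sSet) := forall n, simp B n -> Prop.

Definition rel_closed (B X : sSet) (R : srel B X) : Prop :=
  forall m n (t : mono_map m n) b x, R n b x -> R m (sact t b) (sact t x).

Definition pred_closed (B : sSet) (A : spred B) : Prop :=
  forall m n (t : mono_map m n) b, A n b -> A m (sact t b).

Definition rel_functional (B X : sSet) (R : srel B X) : Prop :=
  forall n b x x', R n b x -> R n b x' -> x = x'.

Definition rel_sub (B X : sSet) (R Q : srel B X) : Prop :=
  forall n b x, R n b x -> Q n b x.

Definition rel_pre (B' B X : sSet) (f : Hom sSet B' B) (R : srel B X) : srel B' X :=
  fun n b x => R n (sapp f b) x.

(** The partial maps inside this relation are the partial lifts of v through p. *)
Definition over (B X Y : sSet) (p : Hom sSet X Y) (v : Hom sSet B Y) :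
  srel B X := fun n b x => sapp p x = sapp v b.

(** Stated for a partial map R that may be defined beyond A, but is extended only
    from A.  With Phi = [over p v] and A a subcomplex this is the right lifting
    property of p against the inclusion of A in B, over v. *)
Definition fills (B : sSet) (A : spred B) (X : sSet) (Phi : srel B X) : Prop :=
  forall R : srel B X, rel_closed R -> rel_functional R -> rel_sub R Phi ->
    (forall n b, A n b -> exists x, R n b x) ->
  exists h : Hom sSet B X, (forall n (b : simp B n), Phi n b (sapp h b)) /\
    (forall n b x, A n b -> R n b x -> sapp h b = x).

Lemma rel_pre_closed (B' B X : sSet) (f : Hom sSet B' B) (R : srel B X) :
  rel_closed R -> rel_closed (rel_pre f R).
Proof. by move=> cR m n t b x /(cR _ _ t); rewrite /rel_pre sapp_nat. Qed.

Lemma over_closed (B X Y : sSet) (p : Hom sSet X Y) (v : Hom sSet B Y) :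
  rel_closed (over p v).
Proof. by move=> m n t b x; rewrite /over !sapp_nat => ->. Qed.

Lemma rel_hom (B X : sSet) (R : srel B X) : rel_closed R -> rel_functional R ->
  (forall n b, exists x, R n b x) ->
  exists h : Hom sSet B X, forall n (b : simp B n), R n b (sapp h b).
Proof.
move=> cR fR tR.
pose h n b := proj1_sig (constructive_indefinite_description _ (tR n b)).
have hP n b : R n b (h n b) by rewrite /h; case: constructive_indefinite_description.
have hN m n (t : mono_map m n) (b : simp B n) : h m (sact t b) = sact t (h n b).
  by apply: fR (hP _ _) (cR _ _ _ _ _ (hP _ _)).
by exists (mk_shom hN).
Qed.

Definition yoneda (X : sSet) n (x : simp X n) : Hom sSet (std n) X.
Proof.
refine (@mk_shom (std n) X (fun m t => sact t x) _).
by move=> m p t s; rewrite -sact_comp.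
Defined.

(** A filler over B' is glued onto a partial map along the characteristic map
    beta of a cell: outside A' the map beta is injective and meets new simplices
    only, so the union of the two graphs is again functional. *)
Lemma attach_cell (B X B' : sSet) (A' : spred B') (beta : Hom sSet B' B)
  (Phi R : srel B X) :
  fills A' (rel_pre beta Phi) -> rel_closed R -> rel_functional R -> rel_sub R Phi ->
  (forall n s, A' n s -> exists x, R n (sapp beta s) x) ->
  (forall n s x, ~ A' n s -> ~ R n (sapp beta s) x) ->
  (forall n s s', ~ A' n s -> ~ A' n s' -> sapp beta s = sapp beta s' -> s = s') ->
  exists R' : srel B X, [/\ rel_closed R', rel_functional R', rel_sub R' Phi,
      rel_sub R R' &
    (forall n s, exists x, R' n (sapp beta s) x) /\
    (forall n b x, R' n b x -> (exists x', R n b x') \/ exists s, b = sapp beta s)].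
Proof.
move=> fA cR fR sR HA HnA Hinj.
have [h [hP hR]] := fA (rel_pre beta R) (rel_pre_closed cR)
  (fun n b x x' => @fR n _ x x') (fun n b x => @sR n _ x) HA.
exists (fun n b x => R n b x \/
  exists s, [/\ ~ A' n s, b = sapp beta s & x = sapp h s]); split.
- move=> m n t b x [/cR|[s [ns -> ->]]]; first by left.
  case: (classic (A' m (sact t s))) => As.
    left; rewrite -!sapp_nat; have [x' Rx'] := HA _ _ As.
    by rewrite (hR _ _ _ As Rx').
  by right; exists (sact t s); rewrite !sapp_nat.
- move=> n b x x' [Rx|[s [ns -> ->]]] [Rx'|[s' [ns' e ->]]].
  + exact: fR Rx Rx'.
  + by case: (HnA _ _ x ns'); rewrite -e.
  + by case: (HnA _ _ x' ns).
  + by rewrite (Hinj _ _ _ ns ns' e).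
- by move=> n b x [/sR|[s [_ -> ->]]] //; apply: hP.
- by move=> n b x; left.
split.
- move=> n s; case: (classic (A' n s)) => As.
    by have [x Rx] := HA _ _ As; exists x; left.
  by exists (sapp h s); right; exists s.
- move=> n b x [Rx|[s [_ -> _]]]; [by left; exists x|by right; exists s].
Qed.

(** * Kan fibrations fill open prisms *)

Definition non_onto m n (t : mono_map m n) : Prop :=
  exists i : 'I_n.+1, forall j, t j <> i.

Definition endpt (e : bool) : 'I_2 := if e then ord_max else ord0.

Definition at_end (e : bool) m (u : mono_map m 1) : Prop := forall j, u j = endpt e.

Definition cyl (B : sSet) : sSet := sprod B (std 1).

(** The subcomplex A x I together with B x {e} of the cylinder on B. *)
Definition open_cyl (e : bool) (B : sSet) (A : spred B) : spred (cyl B) :=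
  fun m s => A m s.1 \/ at_end e (s.2 : mono_map m 1).

Definition prism n : sSet := cyl (std n).

(** The maps that are not onto are the simplices of the boundary of [std n]. *)
Definition open_prism e n : spred (prism n) :=
  open_cyl e (B := std n) (fun m t => non_onto (t : mono_map m n)).

Lemma open_cyl_closed e (B : sSet) (A : spred B) : pred_closed A ->
    pred_closed (open_cyl e A).
Proof. by move=> cA m n t b [/(cA _ _ t)|h]; [left|right=> j; apply: h]. Qed.

Lemma open_prism_closed e n : pred_closed (@open_prism e n).
Proof.
apply: open_cyl_closed => m q t s [i iP]; exists i => j; exact: iP.
Qed.

(** The lifting property of Kan fibrations, restated for partial maps. *)
Lemma kan_horn (X Y : sSet) (p : Hom sSet X Y) n (v : Hom sSet (std n) Y)
  (k : 'I_n.+1) : kan_fibration p -> 0 < n ->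
  fills (fun m (s : simp (std n) m) => in_horn k s) (over p v).
Proof.
move=> pK n0 R cR fR sR HA.
have [|||u uP] := @rel_hom (horn k) X (fun m s x => R m (sval s) x).
- by move=> m q t b x /(cR _ _ t).
- by move=> m b x x'; apply: fR.
- by move=> m [s hs]; apply: HA.
have [|h [h1 h2]] := pK n k n0 u v.
  by apply: shom_eq => m s /=; apply: sR (uP m s).
exists h; split.
- by move=> m s; rewrite /over -h2.
- move=> m s x hs Rx; have <- : sapp (h ∘ horn_incl k)
    (exist _ s hs : simp (horn k) m) = sapp h s by [].
  by rewrite h1; apply: fR (uP m (exist _ s hs)) Rx.
Qed.

Section Prism.
Variable n : nat.

(** The nondegenerate top simplices of the prism are the shuffles
    (0,0) ... (i,0) (i,1) ... (n,1) for i <= n. *)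
Definition shuffle1_fun (i : nat) (q : 'I_n.+2) : 'I_n.+1 :=
  inord (if q <= i then q : nat else q.-1).
Definition shuffle2_fun (i : nat) (q : 'I_n.+2) : 'I_2 :=
  inord (if q <= i then 0 else 1).

Lemma shuffle1_mono i (q r : 'I_n.+2) : i <= n -> q <= r ->
  shuffle1_fun i q <= shuffle1_fun i r.
Proof.
move=> iN qr; rewrite /shuffle1_fun.
rewrite !inordK; have := ltn_ord q; have := ltn_ord r; do ?case: ifP; lia.
Qed.

Lemma shuffle2_mono i (q r : 'I_n.+2) : q <= r ->
  shuffle2_fun i q <= shuffle2_fun i r.
Proof.
by move=> qr; rewrite /shuffle2_fun; rewrite !inordK; do ?case: ifP => //; lia.
Qed.

Definition shuffle i (iN : i <= n) : simp (prism n) n.+1 :=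
  (MonoMap (fun q r => @shuffle1_mono i q r iN), MonoMap (@shuffle2_mono i)).

Definition px m (s : simp (prism n) m) (q : 'I_m.+1) : nat := (s.1 : mono_map m n) q.
Definition py m (s : simp (prism n) m) (q : 'I_m.+1) : nat := (s.2 : mono_map m 1) q.

Lemma px_le m (s : simp (prism n) m) q : px s q <= n.
Proof. by rewrite -ltnS; apply: ltn_ord. Qed.

Lemma py_le m (s : simp (prism n) m) q : py s q <= 1.
Proof. by rewrite -ltnS; apply: ltn_ord. Qed.

Lemma px_mono m (s : simp (prism n) m) (q r : 'I_m.+1) : q <= r -> px s q <= px s r.
Proof. exact: mfun_mono. Qed.

Lemma py_mono m (s : simp (prism n) m) (q r : 'I_m.+1) : q <= r -> py s q <= py s r.
Proof. exact: mfun_mono. Qed.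

Lemma prism_eq m (s s' : simp (prism n) m) :
  (forall q, px s q = px s' q) -> (forall q, py s q = py s' q) -> s = s'.
Proof.
case: s s' => [s1 s2] [s1' s2'] h1 h2.
by congr (_, _); apply: mono_map_eq => q; apply: val_inj; [apply: h1|apply: h2].
Qed.

Definition in_shuffle i : spred (prism n) := fun m s =>
  forall q, if py s q == 0 then px s q <= i else i <= px s q.

Lemma px_shuffle i (iN : i <= n) m (t : simp (std n.+1) m) q :
  px (sapp (yoneda (shuffle iN)) t) q =
  let r : nat := (t : mono_map m n.+1) q in if r <= i then r else r.-1.
Proof.
rewrite /px /= /shuffle1_fun inordK //.
by have := ltn_ord ((t : mono_map m n.+1) q); case: ifP; lia.
Qed.

Lemma py_shuffle i (iN : i <= n) m (t : simp (std n.+1) m) q :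
  py (sapp (yoneda (shuffle iN)) t) q =
  if (t : mono_map m n.+1) q <= i then 0 else 1.
Proof. by rewrite /py /= /shuffle2_fun inordK //; case: ifP. Qed.

Lemma in_shuffleP i (iN : i <= n) m (s : simp (prism n) m) :
  in_shuffle i s -> exists t : simp (std n.+1) m, s = sapp (yoneda (shuffle iN)) t.
Proof.
move=> H.
pose f q : nat := if py s q == 0 then px s q else (px s q).+1.
have fl q : f q < n.+2 by rewrite /f; have := px_le s q; case: ifP; lia.
have fm (q r : 'I_m.+1) : q <= r -> Ordinal (fl q) <= Ordinal (fl r).
  move=> qr; rewrite /= /f; have := px_mono s qr; have := py_mono s qr.
  by do ?case: eqP; lia.
exists (MonoMap fm); apply: prism_eq => q; rewrite ?px_shuffle ?py_shuffle /= /f;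
  have := H q; have := py_le s q; case: eqP => /=; do ?case: ifP; lia.
Qed.

Lemma shuffle_in i (iN : i <= n) m (t : simp (std n.+1) m) :
  in_shuffle i (sapp (yoneda (shuffle iN)) t).
Proof. by move=> q; rewrite px_shuffle py_shuffle /=; case: leqP => h /=; lia. Qed.

Lemma shuffle_inj i (iN : i <= n) m (t t' : simp (std n.+1) m) :
  sapp (yoneda (shuffle iN)) t = sapp (yoneda (shuffle iN)) t' -> t = t'.
Proof.
move=> e; apply: mono_map_eq => q; apply: val_inj => /=.
have := px_shuffle iN t q; have := py_shuffle iN t q; rewrite e px_shuffle py_shuffle /=.
by do ?case: ifP; lia.
Qed.

Variable e : bool.

Lemma at_endP m (s : simp (prism n) m) :
  at_end e (s.2 : mono_map m 1) <-> forall q, py s q = e.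
Proof.
split=> [h q|h q]; first by rewrite /py h; case: (e).
by apply: val_inj; rewrite /= -/(py s q) h; case: (e).
Qed.

Lemma non_ontoP m (s : simp (prism n) m) :
  non_onto (s.1 : mono_map m n) <-> exists2 l, l <= n & forall q, px s q <> l.
Proof.
split=> [[i iP]|[l ln lP]].
  exists i => [|q pq]; first by rewrite -ltnS; apply: ltn_ord.
  by apply: (iP q); apply: val_inj.
by exists (Ordinal (ln : l < n.+1)) => q /(congr1 val); apply: lP.
Qed.

(** The order in which the shuffles are attached: each new one then meets what is
    already present, starting from the end e, in a single horn. *)
Definition shuffle_rank k := if e then k else n - k.

Definition prism_part k : spred (prism n) := fun m s =>
  @open_prism e n m s \/ exists i, [/\ i < k, i <= n & in_shuffle (shuffle_rank i) s].

(** The faces of the shuffle i = [shuffle_rank k] other than i and i + 1 lie in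
    the boundary of [std n] times I.  The face i + ~~ e is shared with the shuffle
    attached just before, or lies in the end e when k = 0.  So the only face that
    is missing is i + e. *)
Lemma prism_partP k (kn : k <= n) (iN : shuffle_rank k <= n) m (t : simp (std n.+1) m) :
  in_horn (inord (shuffle_rank k + e)) t <-> prism_part k (sapp (yoneda (shuffle iN)) t).
Proof.
set i := shuffle_rank k in iN *; set s := sapp _ t.
have xE q : px s q = let r : nat := (t : mono_map m n.+1) q in if r <= i then r else r.-1
  by apply: px_shuffle.
have yE q : py s q = if (t : mono_map m n.+1) q <= i then 0 else 1 by apply: py_shuffle.
have hE : (inord (i + e) : 'I_n.+2) = i + e :> nat.
  by rewrite inordK //; case: (e) => /=; lia.
split.
- move=> [l [/(contra_not (fun h => val_inj h))]].
  rewrite /= hE => li lP.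
  have {}lP q : ((t : mono_map m n.+1) q : nat) <> l by move=> h; apply: (lP q);
      apply: val_inj.
  have ln := ltn_ord l.
  case: (l =P i + ~~ e :> nat) => [ls|ls]; last first.
    left; left; apply/non_ontoP; exists (if l <= i then l : nat else l.-1).
      by case: (leqP l i); lia.
    move=> q; rewrite xE /=; have := lP q.
    case: (leqP ((t : mono_map m n.+1) q) i); case: (leqP l i) => h1 h2;
      move: li ls; case: (e) => /=; lia.
  case: (posnP k) => k0.
    left; right; apply/at_endP => q; rewrite yE; have := lP q.
    have := ltn_ord ((t : mono_map m n.+1) q); move: ls; rewrite /i /shuffle_rank k0.
    by case: (leqP ((t : mono_map m n.+1) q)); case: (e) => /=; lia.
  right; exists k.-1; split; [lia|lia|] => q; rewrite xE yE; have := lP q.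
  move: ls; rewrite /i /shuffle_rank; case: (leqP ((t : mono_map m n.+1) q));
    case: (e) => /=; lia.
- move=> H; apply: NNPP => nh.
  have hit (l : nat) : l <= n.+1 -> l <> i + e ->
      exists q, ((t : mono_map m n.+1) q : nat) = l.
    move=> lN li; apply: NNPP => nq; apply: nh; exists (inord l); split.
      by move=> /(congr1 val) /=; rewrite hE inordK //; lia.
    by move=> q /(congr1 val) /=; rewrite inordK // => h; apply: nq; exists q.
  (* This vertex witnesses that t is neither at the end e nor in an earlier
     shuffle. *)
  have [||q1 q1P] := hit (i + ~~ e); [case: (e) => /=; lia|case: (e) => /=; lia|].
  have q1x : px s q1 = i.
    by rewrite xE q1P /=; case: leqP; case: (e) => /=; lia.
  have q1y : py s q1 = ~~ e.
    by rewrite yE q1P /=; case: leqP; case: (e) => /=; lia.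
  case: H => [[/non_ontoP [l ln lP]|/at_endP /(_ q1)]|[l [lk ln /(_ q1)]]].
  + case: (ltngtP l i) => li.
    * have [||q qP] := hit l; [lia|lia|].
      by apply: (lP q); rewrite xE qP /=; case: leqP; lia.
    * have [||q qP] := hit l.+1; [lia|case: (e) => /=; lia|].
      by apply: (lP q); rewrite xE qP /=; case: leqP; lia.
    * by apply: (lP q1); rewrite q1x.
  + by rewrite q1y; case: (e).
  + rewrite q1x q1y /i /shuffle_rank; case: (e) => /=; lia.
Qed.

(** A simplex lies in the shuffle at its largest first coordinate on the bottom. *)
Lemma prism_total m (s : simp (prism n) m) : prism_part n.+1 s.
Proof.
pose i := \max_(q : 'I_m.+1 | py s q == 0) px s q.
have iN : i <= n by apply/bigmax_leqP => q _; apply: px_le.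
right; exists (shuffle_rank i); split.
- by rewrite /shuffle_rank; case: (e); lia.
- by rewrite /shuffle_rank; case: (e); lia.
have -> : shuffle_rank (shuffle_rank i) = i by rewrite /shuffle_rank; case: (e); lia.
have iq q : py s q == 0 -> px s q <= i by move=> h;
    exact: (@leq_bigmax_cond _ (fun q => py s q == 0) (px s)).
move=> q; case: ifP => h; first exact: iq.
apply/bigmax_leqP => r /eqP hr; apply: px_mono.
by rewrite leqNgt; apply/negP => /ltnW /(py_mono s); move: h => /eqP; lia.
Qed.

(** The shuffles are attached one after the other, each by filling a horn. *)
Lemma kan_prism (X Y : sSet) (p : Hom sSet X Y) (v : Hom sSet (prism n) Y) :
  kan_fibration p -> fills (@open_prism e n) (over p v).
Proof.
move=> pK R cR fR sR HA.
have step k : k <= n.+1 -> exists R' : srel (prism n) X,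
   [/\ rel_closed R', rel_functional R', rel_sub R' (over p v),
    forall m b x, @open_prism e n m b -> R m b x -> R' m b x &
    forall m b, prism_part k b <-> exists x, R' m b x].
  elim: k => [|k IH] kn.
    exists (fun m b x => @open_prism e n m b /\ R m b x); split.
    - by move=> m q t b x [/(open_prism_closed t) ? /(cR _ _ t) ?].
    - by move=> m b x x' [_ h] [_ h']; apply: fR h h'.
    - by move=> m b x [_ /sR].
    - by [].
    move=> m b; split; last by case=> x [h _]; left.
    case; last by case=> i [].
    by move=> h; have [x Rx] := HA _ _ h; exists x.
  have [R' [cR' fR' sR' eR' dR']] := IH (ltnW kn).
  have iN : shuffle_rank k <= n by rewrite /shuffle_rank; case: (e); lia.
  have [||||R2 [cR2 fR2 sR2 eR2 [dR2 dR2']]] := @attach_cell _ _ (std n.+1)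
    (fun m s => in_horn (inord (shuffle_rank k + e)) s) (yoneda (shuffle iN)) (over p v)
        R'
    _ cR' fR' sR'.
  - exact: (@kan_horn X Y p n.+1 (v ∘ yoneda (shuffle iN)) (inord (shuffle_rank k + e))
      pK).
  - by move=> m s /(prism_partP kn iN)/dR'.
  - by move=> m s x ns Rx; apply/ns/(prism_partP kn iN)/dR'; exists x.
  - by move=> m s s' _ _; apply: shuffle_inj.
  exists R2; split=> //.
    by move=> m b x h Rx; apply: eR2; apply: eR'.
  move=> m b; split.
  - case=> [h|[i [ki iN' hi]]].
      have [|x Rx] := proj1 (dR' m b); first by left.
      by exists x; apply: eR2.
    case: (i =P k) => [eq|ne].
      by move: hi; rewrite eq => /(in_shuffleP iN) [t ->]; apply: dR2.
    have [|x Rx] := proj1 (dR' m b); first by right; exists i; split=> //; lia.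
    by exists x; apply: eR2.
  - case=> x /dR2' [/dR' [h|[i [ki iN' hi]]]|[t ->]].
    + by left.
    + by right; exists i; split=> //; lia.
    + by right; exists k; split=> //; apply: shuffle_in.
have [R' [cR' fR' sR' eR' dR']] := step n.+1 (leqnn _).
have [|h hP] := rel_hom cR' fR'.
  by move=> m b; apply/dR'/prism_total.
exists h; split; first by move=> m b; apply: sR'.
by move=> m b x Ab Rx; apply: fR' (hP _ _) (eR' _ _ _ Ab Rx).
Qed.

End Prism.

(** * Cell induction over an arbitrary cylinder *)

Lemma lift_mono n (i : 'I_n.+1) (j k : 'I_n) : j <= k -> lift i j <= lift i k.
Proof. by rewrite /= leq_bump2. Qed.

Lemma non_onto_factor m n (t : mono_map m n) : non_onto t ->
  exists k (d : mono_map k n) (t' : mono_map m k), k < n /\ t = mono_comp d t'.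
Proof.
case=> i iP; case: n t i iP => [|n] t i iP.
  by case: (iP ord0); rewrite [t _]ord1 [i]ord1.
have ex j : exists k : 'I_n.+1, t j = lift i k.
  have ne : t j != i by apply/eqP/iP.
  have : i != t j by rewrite eq_sym.
  by case/unlift_some => k e _; exists k.
pose f j := proj1_sig (constructive_indefinite_description _ (ex j)).
have fP j : t j = lift i (f j) by rewrite /f; case: constructive_indefinite_description.
have fm (j k : 'I_m.+1) : j <= k -> f j <= f k.
  by move=> jk; have := mfun_mono t jk; rewrite !fP /= leq_bump2.
exists n, (MonoMap (@lift_mono _ i)), (MonoMap fm); split=> //.
by apply: mono_map_eq => j; rewrite fP.
Qed.

Lemma strict_mono_id n (f : 'I_n.+1 -> 'I_n.+1) :
  (forall i j : 'I_n.+1, i < j -> f i < f j) -> forall i, f i = i.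
Proof.
move=> H.
have lo k : forall i : 'I_n.+1, i = k :> nat -> k <= f i.
  elim: k => // k IH i ik.
  have kn : k < n.+1 by rewrite -ik ltnW // ltnS -ltnS -ik.
  by have := IH (Ordinal kn) erefl; have := H (Ordinal kn) i; rewrite /= ik; lia.
have hi k : forall i : 'I_n.+1, i = n - k :> nat -> f i <= n - k.
  elim: k => [|k IH] i ik; first by have := ltn_ord (f i); lia.
  case: (leqP n k) => nk; first by have e : n - k.+1 = n - k by [lia]; rewrite e;
      apply: IH; lia.
  have kn : n - k < n.+1 by lia.
  by have := IH (Ordinal kn) erefl; have := H i (Ordinal kn); rewrite /= ik; lia.
move=> i; apply: val_inj; have := lo i i erefl; have := hi (n - i) i.
by have := ltn_ord i; simpl; lia.
Qed.

Lemma onto_endo_id n (e : mono_map n n) : ~ non_onto e -> e = mono_id n.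
Proof.
move=> H.
have sur i : exists j, e j = i.
  by apply: NNPP => h; apply: H; exists i => j ej; apply: h; exists j.
pose g i := proj1_sig (constructive_indefinite_description _ (sur i)).
have gP i : e (g i) = i by rewrite /g; case: constructive_indefinite_description.
have gs (i j : 'I_n.+1) : i < j -> g i < g j.
  move=> ij; rewrite ltnNge; apply/negP => /(mfun_mono e); rewrite !gP; lia.
by apply: mono_map_eq => i /=; rewrite -{1}(strict_mono_id gs i) gP.
Qed.

Lemma onto_section m n (t : mono_map m n) (j : 'I_m.+1) : ~ non_onto t ->
  exists d : mono_map n m, mono_comp t d = mono_id n /\ d (t j) = j.
Proof.
move=> H.
have sur i : exists k, t k = i /\ (i = t j -> k = j).
  case: (i =P t j) => [->|ne]; first by exists j.
  by apply: NNPP => h; apply: H; exists i => k ek; apply: h; exists k; split=> // /ne.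
pose g i := proj1_sig (constructive_indefinite_description _ (sur i)).
have gP i : t (g i) = i /\ (i = t j -> g i = j).
  by rewrite /g; case: constructive_indefinite_description.
have gm (i k : 'I_n.+1) : i <= k -> g i <= g k.
  move=> ik; rewrite leqNgt; apply/negP => lt.
  have := mfun_mono t (ltnW lt); rewrite !(proj1 (gP _)) => ki.
  by have e : i = k by [apply: val_inj => /=; lia]; rewrite e ltnn in lt.
exists (MonoMap gm); split; last exact: (proj2 (gP (t j)) erefl).
by apply: mono_map_eq => i; apply: (proj1 (gP i)).
Qed.

(** The part of the Eilenberg-Zilber lemma that is needed to attach a cell: if all
    simplices of lower dimension lie in N and x does not, then the degeneracies of
    x are pairwise distinct.  For a section d of t, the endomorphism t' d fixes x,
    so it is onto, hence the identity; and d may be chosen through any vertex. *)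
Lemma nondegenerate_inj (X : sSet) (N : spred X) n (x : simp X n) :
  pred_closed N -> (forall k (y : simp X k), k < n -> N k y) -> ~ N n x ->
  forall m (t t' : mono_map m n), ~ non_onto t -> sact t x = sact t' x -> t = t'.
Proof.
move=> cN low Nx m t t' ot e; apply: mono_map_eq => j.
have [d [dt dj]] := onto_section j ot.
have ex : sact (mono_comp t' d) x = x.
  by rewrite sact_comp -e -sact_comp dt sact_id.
case: (classic (non_onto (mono_comp t' d))) => [|/onto_endo_id]; last first.
  by move/(congr1 (fun f : mono_map n n => f (t j))); rewrite /= dj.
move=> /non_onto_factor [k [d1 [d2 [kn e2]]]]; case: Nx.
by rewrite -ex e2 sact_comp; apply: cN; apply: low.
Qed.

Definition cyl_map (B B' : sSet) (f : Hom sSet B B') : Hom sSet (cyl B) (cyl B') :=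
  sprod_map f (idm sSet (std 1)).

(** Lifting against A x I, B x {e} in B x I follows from the case of simplices:
    a maximal partial lift whose domain is again of this shape is total, since
    otherwise a simplex of least dimension outside its domain would allow one more
    prism to be attached. *)
Lemma cyl_fill (e : bool) (B X : sSet) (Psi : srel (cyl B) X) (A : spred B) :
  pred_closed A ->
  (forall n (b : simp B n), fills (@open_prism e n) (rel_pre (cyl_map (yoneda b)) Psi)) ->
  fills (open_cyl e A) Psi.
Proof.
move=> cA HP R0 cR0 fR0 sR0 HA.
pose T := {n : nat & (simp (cyl B) n * simp X n)%type}.
(* The initial partial map is added by hand: the union of an empty chain is
   empty. *)
pose rel (S : T -> Prop) : srel (cyl B) X :=
  fun n c x => S (existT _ n (c, x)) \/ (open_cyl e A c /\ R0 n c x).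
have cO : pred_closed (open_cyl e A) by apply: open_cyl_closed.
(* The last clause says that off the end e the domain is of the form A' x I. *)
pose good (R : srel (cyl B) X) := [/\ rel_closed R, rel_functional R, rel_sub R Psi &
  forall n (b : simp B n) (u : mono_map n 1) x, ~ at_end e u -> R n (b, u) x ->
  forall m (t : mono_map m n) (u' : mono_map m 1), exists x', R m (sact t b, u') x'].
have good0 : good (fun n c x => open_cyl e A c /\ R0 n c x).
  split.
  - by move=> m n t b x [/(cO _ _ t) ? /(cR0 _ _ t) ?].
  - by move=> n b x x' [_ h] [_]; apply: fR0.
  - by move=> n b x [_ /sR0].
  - move=> n b u x nu [[/= Ab|//] _] m t u'.
    have O : open_cyl e A (sact t b, u' : simp (std 1) m) by left; apply: cA.
    by have [x' Rx'] := HA _ _ O; exists x'.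
have [|S [gS maxS]] := @classical_sets.Zorn_bigcup T (fun S => good (rel S)).
  move=> F FP FT.
  have up n c x : rel (classical_sets.bigcup F id) n c x ->
     (open_cyl e A c /\ R0 n c x) \/ exists S, F S /\ rel S n c x.
    by case=> [[S FS Sx]|]; [right; exists S; split=> //; left|left].
  have dn S n c x : F S -> rel S n c x -> rel (classical_sets.bigcup F id) n c x.
    by move=> FS [Sx|]; [left; exists S|right].
  have dn0 n c x : open_cyl e A c /\ R0 n c x -> rel (classical_sets.bigcup F id) n c x.
    by right.
  case: good0 => c0 f0 s0 d0.
  split.
  - move=> m n t b x /up [/(c0 _ _ t)/dn0 //|[S [FS Sx]]].
    by apply: (dn S) => //; have [h _ _ _] := FP _ FS; apply: h.
  - move=> n b x x' /up [h|[S [FS Sx]]] /up [h'|[S' [FS' Sx']]].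
    + exact: f0 h h'.
    + have [_ f _ _] := FP _ FS'; apply: (f _ _ _ _ _ Sx'); by right.
    + have [_ f _ _] := FP _ FS; apply: (f _ _ _ _ Sx); by right.
    + case: (FT _ _ FS FS') => sub.
      * have [_ f _ _] := FP _ FS'; apply: (f _ _ _ _ _ Sx').
        by case: Sx => [/sub|]; [left|right].
      * have [_ f _ _] := FP _ FS; apply: (f _ _ _ _ Sx).
        by case: Sx' => [/sub|]; [left|right].
  - move=> n b x /up [/s0 //|[S [FS Sx]]].
    by have [_ _ f _] := FP _ FS; apply: f.
  - move=> n b u x nu /up [h|[S [FS Sx]]] m t u'.
    + by have [x' h'] := d0 _ _ _ _ nu h m t u'; exists x'; apply: dn0.
    + have [_ _ _ f] := FP _ FS; have [x' h'] := f _ _ _ _ nu Sx m t u'.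
      by exists x'; apply: dn FS h'.
case: (gS) => cS fS sS dS.
pose A' : spred B := fun n b => forall m (t : mono_map m n) (u' : mono_map m 1),
  exists x', rel S m (sact t b, u') x'.
have cA' : pred_closed A'.
  by move=> m n t b Ab q t' u'; rewrite -sact_comp; apply: Ab.
have base n (c : simp (cyl B) n) : at_end e (c.2 : mono_map n 1) -> exists x, rel S n c x.
  move=> h; have O : open_cyl e A c by right.
  by have [x Rx] := HA _ _ O; exists x; right.
have tot n : forall b : simp B n, A' n b.
  elim/ltn_ind: n => n IH b; apply: NNPP => nA.
  pose beta := cyl_map (yoneda b).
  have new m (s : simp (prism n) m) x : ~ @open_prism e n m s ->
      ~ rel S m (sapp beta s) x.
    move=> ns Rx; apply: nA.
    have o1 : ~ non_onto (s.1 : mono_map m n) by move=> h; apply: ns; left.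
    have o2 : ~ at_end e (s.2 : mono_map m 1) by move=> h; apply: ns; right.
    have [d [dt _]] := onto_section ord0 o1.
    have := dS _ _ _ _ o2 Rx => h; move=> q t u'.
    have := h q (mono_comp d t) u'.
    by rewrite -sact_comp (_ : mono_comp _ _ = t) //; apply: mono_map_eq => j;
      apply: (congr1 (fun f : mono_map n n => f (t j)) dt).
  have [|||R' [cR' fR' sR' eR' [dR' dR'']]] :=
    @attach_cell _ _ _ _ beta Psi (rel S) (HP n b) cS fS sS.
  - move=> m s [/non_onto_factor [k [d1 [d2 [kn e2]]]]|]; last by move=> h;
      exact: (base m (sapp beta s) h).
    have := IH k kn (sact d1 b) m d2 (s.2 : mono_map m 1).
    by rewrite -sact_comp -e2.
  - exact: new.
  - move=> m [t u] [t' u'] ns ns' [eb ->]; congr (_, _).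
    apply: (@nondegenerate_inj B A' n b cA' (fun k y h => IH k h y) nA m t t') => //.
    by move=> h; apply: ns; left.
  - pose S' : T -> Prop := fun x => R' (projT1 x) (projT2 x).1 (projT2 x).2.
    have eS' n' c x : rel S' n' c x <-> R' n' c x.
      by split=> [[//|h]|h]; [apply: eR'; right|left].
    apply: (maxS S').
      split; first by move=> [n' [c x]] h; apply: eR'; left.
      move=> sub; have [x Rx] := dR' n (mono_id n, vtx (endpt (~~ e)) n).
      apply: (@new n (mono_id n, vtx (endpt (~~ e)) n) x).
        by case=> [[i /(_ i)]|/(_ ord0)] //=; case: (e).
      by left; apply: (sub (existT _ n (sapp beta (mono_id n, vtx (endpt (~~ e)) n), x))).
    split.
    + by move=> m q t c x /eS' /cR' h; apply/eS'.
    + by move=> m c x x' /eS' h /eS'; apply: fR' h.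
    + by move=> m c x /eS' /sR'.
    + move=> m c u x nu /eS' /dR'' [[x' Sx']|[[t u0] eb]] q t' u'.
        have [x2 Sx2] := dS _ _ _ _ nu Sx' q t' u'.
        by exists x2; apply/eS'/eR'.
      have [x2 Rx2] := dR' q (mono_comp (t : mono_map m n) t', u').
      exists x2; apply/eS'; move: Rx2; case: eb => -> _.
      by rewrite /= sact_comp.
have [|h hP] := rel_hom cS fS.
  move=> n [b u]; have := tot n b n (mono_id n) u.
  by rewrite sact_id.
exists h; split; first by move=> n b; apply: sS.
move=> n b x Ab Rx; apply: fS (hP _ _) _; by right.
Qed.

(** * Acyclic maps and discrete simplicial sets *)

(** The right lifting property against all monomorphisms.  A cofibrant diagram
    lifts against acyclic maps by [acyclic_kan] and [acyclic_weq]. *)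
Definition acyclic (X Y : sSet) (p : Hom sSet X Y) : Prop :=
  forall (B : sSet) (A : spred B) (v : Hom sSet B Y),
    pred_closed A -> fills A (over p v).

Lemma in_horn_closed n (k : 'I_n.+1) :
  pred_closed (B := std n) (fun m (s : mono_map m n) => in_horn k s).
Proof. by move=> m q t s [i [ik iP]]; exists i; split=> // j; apply: iP. Qed.

Lemma acyclic_kan (X Y : sSet) (p : Hom sSet X Y) : acyclic p -> kan_fibration p.
Proof.
move=> pA n k n0 u v e.
have [||||h [hv hu]] := pA (std n) (fun m s => in_horn k s) v
  (@in_horn_closed n k) (fun m s x => exists hs : in_horn k s,
  x = sapp u (exist _ s hs : simp (horn k) m)).
- move=> m q t s x [hs ->]; exists (in_horn_closed t hs); rewrite -sapp_nat.
  by congr sapp; apply: sig_eq.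
- by move=> m s x x' [hs ->] [hs' ->]; congr sapp; apply: sig_eq.
- move=> m s x [hs ->]; rewrite /over.
  exact: (congr1 (fun f => sapp f (exist _ s hs : simp (horn k) m)) e).
- by move=> m s hs; exists (sapp u (exist _ s hs : simp (horn k) m)), hs.
exists h; split; apply: shom_eq => m; last exact: hv.
by case=> s hs; apply: (hu m s) => //; exists hs.
Qed.

Lemma vtx_neq (n : nat) (e e' : bool) : vtx (endpt e) n = vtx (endpt e') n -> e = e'.
Proof.
by move/(congr1 (fun u : mono_map n 1 => u ord0)); rewrite /=; case: e e' => [] [].
Qed.

Lemma at_end_vtx e n (u : mono_map n 1) : at_end e u <-> u = vtx (endpt e) n.
Proof. by split=> [h|-> //]; apply: mono_map_eq => j; rewrite h. Qed.

Lemma sact_vtx n (i : 'I_n.+1) m q (t : mono_map q m) :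
  sact (X := std n) t (vtx i m) = vtx i q.
Proof. exact: mono_map_eq. Qed.

Lemma cyl_vtx (B : sSet) n (c : simp (cyl B) n) i m (t : mono_map m n) :
  c.2 = vtx i n -> (sact t c).2 = vtx i m.
Proof. by move=> h; rewrite -(sact_vtx i t) -h. Qed.

(** A lift of the identity is a strict section s, and a lift over the cylinder of
    X is a homotopy from s p to the identity, so homotopy classes of maps out of X
    and Y correspond without any use of transitivity of homotopy. *)
Lemma acyclic_weq (X Y : sSet) (p : Hom sSet X Y) :
  acyclic p -> weak_homotopy_equivalence p.
Proof.
move=> pA.
have [|||||s [sP _]] := pA Y (fun _ _ => False) (idm sSet Y) _ (fun _ _ _ => False) => //.
have ps n (y : simp Y n) : sapp p (sapp s y) = y by apply: sP.
have [|||||H [HP HR]] := pA (cyl X) (fun m c => c.2 = vtx ord0 m \/ c.2 = vtx ord_max m)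
   (p ∘ sprod_fst X (std 1)) _ (fun m c x =>
     (c.2 = vtx ord0 m /\ x = sapp s (sapp p c.1)) \/
     (c.2 = vtx ord_max m /\ x = c.1)) => //.
- by move=> m n t c [h|h]; [left|right]; apply: cyl_vtx.
- move=> m n t c x [[h ->]|[h ->]]; [left|right]; rewrite (cyl_vtx t h) //.
  by rewrite -!sapp_nat.
- move=> n c x x' [[h ->]|[h ->]] [[h' ->]|[h' ->]] //; move: h'; rewrite h.
    by move/(@vtx_neq n false true).
  by move/(@vtx_neq n true false).
- by move=> n c x [[h ->]|[h ->]]; rewrite /over //= ps.
- by move=> n c [h|h]; eexists; [left|right].
move=> K _; split.
- move=> u; exists (u ∘ s), (u ∘ H) => n x; split.
  + exact: (congr1 (@sapp X K u n) (HR n (spair x (vtx ord0 n : simp (std 1) n))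
      _ (or_introl erefl) (or_introl (conj erefl erefl)))).
  + exact: (congr1 (@sapp X K u n) (HR n (spair x (vtx ord_max n : simp (std 1) n))
      _ (or_intror erefl) (or_intror (conj erefl erefl)))).
- move=> v w [Q QP]; exists (Q ∘ cyl_map s) => n y.
  have [q0 q1] := QP n (sapp s y).
  split; [exact: (etrans q0 (congr1 (@sapp Y K v n) (ps n y)))|].
  exact: (etrans q1 (congr1 (@sapp Y K w n) (ps n y))).
Qed.

(** Every vertex of a horn is joined to the vertex k inside the horn. *)
Lemma horn_disc_const n (k : 'I_n.+1) (A : small) (u : Hom sSet (horn k) (sdisc A)) :
  0 < n -> exists a : A, forall m (s : simp (horn k) m), sapp u s = a.
Proof.
move=> n0.
have [i0 ik0] : exists i : 'I_n.+1, i <> k.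
  case: (k =P ord0) => [->|h]; last by exists ord0 => e; apply: h.
  by exists (Ordinal (n0 : 1 < n.+1)) => /(congr1 val).
have hk m : in_horn k (vtx k m) by exists i0; split=> // j e; apply: ik0.
exists (sapp u (exist _ (vtx k 0) (hk 0) : simp (horn k) 0)) => m [s [i [ik iP]]].
have um q (t : mono_map q n) (ht : in_horn k t) r (t' : mono_map r q) ht' :
   sapp u (exist _ t ht : simp (horn k) q) =
   sapp u (exist _ (mono_comp t t') ht' : simp (horn k) r).
  rewrite -[LHS](sapp_nat u t' (exist _ t ht : simp (horn k) q)).
  by apply: (congr1 (@sapp (horn k) (sdisc A) u r)); apply: sig_eq.
(* The edge from k to the first vertex of s; it misses the vertex i, as s does. *)
have [e eP] : exists e : mono_map 1 n, (forall j, e j <> i) /\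
    exists j0 j1 : mono_map 0 1, mono_comp e j0 = vtx (s ord0) 0 /\ mono_comp e j1 =
        vtx k 0.
  have vE (f : mono_map 1 n) j x : f j = x -> mono_comp f (vtx j 0) = vtx x 0.
    by move=> h; apply: mono_map_eq => y /=.
  case: (leqP (s ord0) k) => sk.
  - have em (a b : 'I_2) : a <= b ->
      (if a == ord0 then s ord0 else k) <= (if b == ord0 then s ord0 else k).
      case: (a =P ord0) (b =P ord0) => [_|na] [e|_] // ab; case: na.
      by apply: val_inj; move: ab; rewrite e /= leqn0 => /eqP.
    exists (MonoMap em); split; first by move=> j /=; case: ifP => _;
        [apply: iP|move/esym].
    by exists (vtx ord0 0), (vtx ord_max 0); split; apply: vE.
  - have em (a b : 'I_2) : a <= b ->
      (if a == ord0 then k else s ord0) <= (if b == ord0 then k else s ord0).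
      case: (a =P ord0) (b =P ord0) => [_|na] [e|_] // ab; first exact: ltnW.
      by case: na; apply: val_inj; move: ab; rewrite e /= leqn0 => /eqP.
    exists (MonoMap em); split; first by move=> j /=; case: ifP => _;
        [move/esym|apply: iP].
    by exists (vtx ord_max 0), (vtx ord0 0); split; apply: vE.
case: eP => ei [j0 [j1 [e0 e1]]].
have he : in_horn k e by exists i.
have hs0 : in_horn k (mono_comp s (vtx ord0 0)) by exists i; split=> // j; apply: iP.
rewrite (um _ _ _ _ (vtx ord0 0) hs0).
have he0 : in_horn k (mono_comp e j0) by exists i; split=> // j; apply: ei.
have he1 : in_horn k (mono_comp e j1) by exists i; split=> // j; apply: ei.
transitivity (sapp u (exist _ e he : simp (horn k) 1)).
- rewrite (um _ _ he _ j0 he0); apply: (congr1 (@sapp (horn k) (sdisc A) u 0)).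
  apply: sig_eq => /=; rewrite e0.
  exact: mono_map_eq.
- by rewrite (um _ _ he _ j1 he1); apply: (congr1 (@sapp (horn k) (sdisc A) u 0));
    apply: sig_eq.
Qed.

Lemma sdisc_kan (A : small) : kan_complex (sdisc A).
Proof.
move=> n k u n0; have [a aP] := horn_disc_const u n0.
exists (@mk_shom (std n) (sdisc A) (fun _ _ => a) (fun _ _ _ _ => erefl)).
by apply: shom_eq => m s; rewrite aP.
Qed.

Definition to_pt (X : sSet) : Hom sSet X (sdisc unit) :=
  @mk_shom X (sdisc unit) (fun _ _ => tt) (fun _ _ _ _ => erefl).

Lemma kan_complex_fib (X : sSet) : kan_complex X -> kan_fibration (to_pt X).
Proof.
move=> kX n k n0 u v _; have [h hu] := kX n k u n0.
by exists h; split=> //; apply: shom_eq => m s; case: (sapp v s).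
Qed.

Lemma sapp_disc_sact (X : sSet) (A : small) (f : Hom sSet X (sdisc A)) m n
  (t : mono_map m n) (x : simp X n) : sapp f (sact t x) = sapp f x :> A.
Proof. exact: (sapp_nat f t x). Qed.

(** * Sections of acyclic relations over a cofibrant bimodule *)

Definition dact (D : small_category) (G : Fun (sop D) sSet) (d d' : sOb D)
  (a : Hom D d' d) : Hom sSet (fob G d) (fob G d') := @fmap (sop D) sSet G d d' a.

Lemma dact_id (D : small_category) (G : Fun (sop D) sSet) d n (x : simp (fob G d) n) :
  sapp (dact G (idm D d)) x = x.
Proof. exact: (congr1 (fun f => sapp f x) (@fmap_id (sop D) sSet G d)). Qed.

Lemma dact_comp (D : small_category) (G : Fun (sop D) sSet) d d' d''
  (a : Hom D d' d) (a' : Hom D d'' d') n (x : simp (fob G d) n) :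
  sapp (dact G (a ∘ a')) x = sapp (dact G a') (sapp (dact G a) x).
Proof.
exact: (congr1 (fun f => sapp f x) (@fmap_comp (sop D) sSet G d d' d'' a' a)).
Qed.

Lemma dact_nat (D : small_category) (G G' : Fun (sop D) sSet)
  (f : Hom (Fun (sop D) sSet) G G') d d' (a : Hom D d' d) n (x : simp (fob G d) n) :
  sapp (nt f d') (sapp (dact G a) x) = sapp (dact G' a) (sapp (nt f d) x).
Proof. exact: (congr1 (fun h => sapp h x) (@nt_nat (sop D) sSet G G' f d d' a)). Qed.

Section Slice.

Variables (D C : small_category) (E : Fun (sprodc (sop D) C) sSet).

Definition slice (c : sOb C) : Fun (sop D) sSet.
Proof.
refine (@Functor (sop D) sSet (fun d => fob E (d, c))
  (fun d d' a => @act_l D C E d' d a c) _ _).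
- by move=> d; apply: (@fmap_id (sprodc (sop D) C) sSet E (d, c)).
- move=> d d' d'' a' a; rewrite /act_l -(@fmap_comp (sprodc (sop D) C) sSet E).
  by congr fmap; congr (_, _); rewrite /= compm_idl.
Defined.

Variable (c : sOb C) (X : Fun (sop D) sSet).
Variable Phi : forall d, srel (fob (slice c) d) (fob X d).
Hypothesis PhiS : forall d, rel_closed (@Phi d).
Hypothesis PhiD : forall d d' (a : Hom D d' d) n e x,
  @Phi d n e x -> @Phi d' n (sapp (dact (slice c) a) e) (sapp (dact X a) x).

(** The test object: over E(d, c') it consists of a simplex e with a choice of a
    partner in X(d), related by Phi, for each of the images of e in E(d, c).  This
    is the pullback to E of the right Kan extension from c of Phi -> E(-, c), and
    the family indexed by the arrows c' -> c makes it functorial in c'. *)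
Definition coind_simp (d : sOb D) (c' : sOb C) (n : nat) : small :=
  {p : simp (fob E (d, c')) n * (Hom C c' c -> simp (fob X d) n) |
    forall k : Hom C c' c, Phi (sapp (act_r E d k) p.1) (p.2 k)}.

Definition coind_ob (d : sOb D) (c' : sOb C) : sSet.
Proof.
refine (@mk_sSet (coind_simp d c') (fun m n t p =>
  exist _ (sact t (sval p).1, fun k => sact t ((sval p).2 k)) _) _ _).
Unshelve.
- move=> n [[e psi] h]; apply: sig_eq => /=; rewrite sact_id; congr (_, _).
  by apply: functional_extensionality => k; rewrite sact_id.
- move=> m n q s t [[e psi] h]; apply: sig_eq => /=; rewrite sact_comp; congr (_, _).
  by apply: functional_extensionality => k; rewrite sact_comp.
- by move=> k; rewrite sapp_nat; apply: PhiS; apply: (proj2_sig p k).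
Defined.

Lemma act_lr_simp d d' c' c'' (a : Hom D d' d) (k0 : Hom C c' c'') (k : Hom C c'' c)
  n (e : simp (fob E (d, c')) n) :
  sapp (act_r E d' k) (sapp (@fmap (sprodc (sop D) C) sSet E (d, c') (d', c'') (a, k0)) e)
  = sapp (dact (slice c) a) (sapp (act_r E d (k ∘ k0)) e).
Proof.
apply: (congr1 (fun f => sapp f e) (_ : act_r E d' k ∘ _ = act_l E a c ∘ act_r E d
    (k ∘ k0))).
rewrite /act_r /act_l -!(@fmap_comp (sprodc (sop D) C) sSet E).
by congr fmap; congr (_, _); rewrite /= ?compm_idl ?compm_idr.
Qed.

Definition coind_map (d d' : sOb D) (c' c'' : sOb C) (a : Hom D d' d)
  (k0 : Hom C c' c'') : Hom sSet (coind_ob d c') (coind_ob d' c'').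
Proof.
refine (@mk_shom (coind_ob d c') (coind_ob d' c'') (fun n p =>
  exist _ (sapp (@fmap (sprodc (sop D) C) sSet E (d, c') (d', c'') (a, k0)) (sval p).1,
    fun k => sapp (dact X a) ((sval p).2 (k ∘ k0))) _) _).
Unshelve.
- move=> m n t [[e psi] h]; apply: sig_eq; rewrite /= sapp_nat; congr (_, _).
  by apply: functional_extensionality => k; rewrite sapp_nat.
- by move=> k /=; rewrite act_lr_simp; apply: PhiD; apply: (proj2_sig p).
Defined.

Definition coind : Fun (sprodc (sop D) C) sSet.
Proof.
refine (@Functor (sprodc (sop D) C) sSet (fun dc => coind_ob dc.1 dc.2)
  (fun dc dc' ak => @coind_map dc.1 dc'.1 dc.2 dc'.2 ak.1 ak.2) _ _).
- move=> [d c']; apply: shom_eq => n [[e psi] h]; apply: sig_eq => /=.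
  congr (_, _).
    exact: (congr1 (fun f => sapp f e) (@fmap_id (sprodc (sop D) C) sSet E (d, c'))).
  by apply: functional_extensionality => k; rewrite dact_id compm_idr.
- move=> [d c'] [d' c''] [d'' c'''] [a' k'] [a k]; apply: shom_eq => n [[e psi] h].
  apply: sig_eq => /=; congr (_, _).
    exact: (congr1 (fun f => sapp f e) (@fmap_comp (sprodc (sop D) C) sSet E
      (d, c') (d', c'') (d'', c''') (a', k') (a, k))).
  by apply: functional_extensionality => k0; rewrite dact_comp compmA.
Defined.

Definition coind_proj : Hom (Fun (sprodc (sop D) C) sSet) coind E.
Proof.
refine (@NatTrans (sprodc (sop D) C) sSet coind E
  (fun dc => match dc return Hom sSet (coind_ob dc.1 dc.2) (fob E dc) with
     (d, c') => @mk_shom (coind_ob d c') (fob E (d, c'))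
       (fun n p => (sval p).1) (fun _ _ _ _ => erefl) end) _).
by move=> [d c'] [d' c''] [a k]; apply: shom_eq => n p.
Defined.

Hypothesis PhiA : forall d (B : sSet) (A : spred B) (b : Hom sSet B (fob (slice c) d)),
  pred_closed A -> fills A (rel_pre b (@Phi d)).

Lemma coind_acyclic d c' : acyclic (nt coind_proj (d, c')).
Proof.
move=> B A v cA R cR fR sR HA.
have psiP (k : Hom C c' c) : exists psi : Hom sSet B (fob X d),
   (forall n (b : simp B n), Phi (sapp (act_r E d k) (sapp v b)) (sapp psi b)) /\
   forall n b (p : simp (coind_ob d c') n), A n b -> R n b p -> sapp psi b = (sval p).2 k.
  have [||||psi [p1 p2]] := @PhiA d B A (act_r E d k ∘ v) cA
    (fun n b x => exists p, R n b p /\ x = (sval p).2 k).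
  - by move=> m n t b x [p [/(cR _ _ t) h ->]]; exists (sact t p).
  - by move=> n b x x' [p [h ->]] [p' [h' ->]]; rewrite (fR _ _ _ _ h h').
  - move=> n b x [p [/sR h ->]]; rewrite /rel_pre.
    rewrite (_ : sapp (_ ∘ v) b = sapp (act_r E d k) (sval p).1);
        first exact: (proj2_sig p k).
    exact: (congr1 (@sapp (fob E (d, c')) (fob E (d, c)) (act_r E d k) n) (esym h)).
  - by move=> n b /HA [p h]; exists ((sval p).2 k), p.
  exists psi; split; first exact: p1.
  by move=> n b p Ab Rp; apply: p2 => //; exists p.
pose psi k := proj1_sig (constructive_indefinite_description _ (psiP k)).
have psiQ k : (forall n (b : simp B n), Phi (sapp (act_r E d k) (sapp v b))
    (sapp (psi k) b)) /\
   forall n b (p : simp (coind_ob d c') n), A n b -> R n b p ->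
       sapp (psi k) b = (sval p).2 k.
  by rewrite /psi; case: constructive_indefinite_description.
pose h n (b : simp B n) : simp (coind_ob d c') n :=
  exist (fun p : simp (fob E (d, c')) n * (Hom C c' c -> simp (fob X d) n) =>
      forall k, Phi (sapp (act_r E d k) p.1) (p.2 k))
    (sapp v b, fun k => sapp (psi k) b) (fun k => proj1 (psiQ k) n b).
have hN m n (t : mono_map m n) (b : simp B n) : h m (sact t b) = sact t (h n b).
  apply: sig_eq => /=; rewrite sapp_nat; congr (_, _).
  by apply: functional_extensionality => k; rewrite sapp_nat.
exists (@mk_shom B (coind_ob d c') h hN); split=> //.
move=> n b p Ab Rp; apply: sig_eq; have := sR _ _ _ Rp; rewrite /over /=.
have : forall k, sapp (psi k) b = (sval p).2 k by move=> k; apply: (proj2 (psiQ k)).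
case: p Rp => -[e f] hp _ /= H <-; congr (_, _).
by apply: functional_extensionality => k.
Qed.

(** A cofibrant E lifts against [coind_proj], which is acyclic at every pair of
    objects; evaluating the resulting section at c and the identity of c gives
    the natural map h. *)
Lemma cofibrant_section (P : sOb (sprodc (sop D) C) -> Prop) :
  cofibrant (relative_model P kan_quillen) E ->
  exists h : Hom (Fun (sop D) sSet) (slice c) X,
    forall d n (e : simp (fob (slice c) d) n), Phi e (sapp (nt h d) e).
Proof.
case=> o [f [oI fC]].
have [u _] := oI coind.
have [|||h [_ h2]] := fC coind E coind_proj _ _ u (idm _ E).
- by move=> [d c'] _; apply: acyclic_kan; apply: coind_acyclic.
- by move=> [d c'] _; apply: acyclic_weq; apply: coind_acyclic.
- by have [f0 [_ f0P]] := oI E; rewrite -(f0P (coind_proj ∘ u)) // -(f0P (idm _ E ∘ f)).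
have hP d c' n (e : simp (fob E (d, c')) n) : (sval (sapp (nt h (d, c')) e)).1 = e.
  exact: (congr1 (fun g : nat_trans E E =>
    @sapp (fob E (d, c')) (fob E (d, c')) (nt g (d, c')) n e) h2).
have hn d d' (a : Hom D d' d) n (e : simp (fob (slice c) d) n) :
  (sval (sapp (nt h (d', c)) (sapp (dact (slice c) a) e))).2 (idm C c) =
  sapp (dact X a) ((sval (sapp (nt h (d, c)) e)).2 (idm C c)).
  have := congr1 (fun g => sapp g e) (@nt_nat _ _ _ _ h (d, c) (d', c) (a, idm C c)).
  move/(congr1 (fun p => (sval p).2 (idm C c))) => H; apply: etrans H _ => /=.
  by rewrite compm_idl.
have hs m n d (t : mono_map m n) (e : simp (fob E (d, c)) n) :
  (sval (sapp (nt h (d, c)) (sact t e))).2 (idm C c) =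
  sact t ((sval (sapp (nt h (d, c)) e)).2 (idm C c)).
  by rewrite sapp_nat.
pose g d : Hom sSet (fob (slice c) d) (fob X d) := @mk_shom (fob (slice c) d) (fob X d)
  (fun n e => (sval (sapp (nt h (d, c)) e)).2 (idm C c)) (fun m n t e => hs m n d t e).
have gN (d d' : sOb D) (a : Hom (sop D) d d') :
  g d' ∘ fmap (slice c) a = fmap X a ∘ g d.
  by apply: shom_eq => n e; apply: hn.
exists (@NatTrans (sop D) sSet (slice c) X g gN) => d n e /=.
have := proj2_sig (sapp (nt h (d, c)) e) (idm C c).
by rewrite hP act_r_id.
Qed.

End Slice.

(** * The free completion of a diagram under fillers *)

Section Completion.

Variables (D : small_category) (G : Fun (sop D) sSet).
Variables (J : small) (cell : J -> sSet) (bdry : forall j, spred (cell j)).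
Hypothesis bdry_closed : forall j, pred_closed (@bdry j).

(** The formal fillers.  A term [Fill phi a s] is the simplex s of the cell k, in
    the filler of the partial map phi, restricted along a.  The family phi is
    given on all restrictions of the boundary of the cell, so that terms form a
    diagram on D^op, and maps to a diagram with objectwise fillers extend
    naturally: fillers are to be chosen for phi only, not for its restrictions. *)
Inductive term : sOb D -> nat -> small :=
| Base (d : sOb D) n (x : simp (fob G d) n) : term d n
| Fill (d : sOb D) k (phi : forall (d' : sOb D) m (a : Hom D d' d)
    (s : simp (cell k) m), bdry s -> term d' m)
    (d' : sOb D) n (a : Hom D d' d) (s : simp (cell k) n) : term d' n.

Definition family (d : sOb D) k : small :=
    forall (d' : sOb D) m (a : Hom D d' d) (s : simp (cell k) m),
  bdry s -> term d' m.

(** On the boundary the filler of phi is phi itself, so that no quotient is needed. *)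
Definition fill_val d k (phi : family d k) d' n (a : Hom D d' d)
  (s : simp (cell k) n) : term d' n :=
  match excluded_middle_informative (bdry s) with
  | left H => phi d' n a s H
  | right _ => Fill phi a s
  end.

Definition term_act d' m d n (b : Hom D d' d) (t : mono_map m n) (x : term d n) : term
    d' m :=
  match x in term d n return Hom D d' d -> mono_map m n -> term d' m with
  | Base d n x => fun b t => Base (sact t (sapp (dact G b) x))
  | Fill d0 k phi d n a s => fun b t => fill_val phi (a ∘ b) (sact t s)
  end b t.

Lemma term_act_Base d n (x : simp (fob G d) n) d' m (b : Hom D d' d) (t : mono_map m n) :
  term_act b t (Base x) = Base (sact t (sapp (dact G b) x)).
Proof. by []. Qed.

Lemma term_act_Fill d k (phi : family d k) d' n (a : Hom D d' d) (s : simp (cell k) n)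
  d'' m (b : Hom D d'' d') (t : mono_map m n) :
  term_act b t (Fill phi a s) = fill_val phi (a ∘ b) (sact t s).
Proof. by []. Qed.

Definition matching d k (phi : family d k) : Prop :=
  forall d' m (a : Hom D d' d) (s : simp (cell k) m) H d'' m' (b : Hom D d'' d')
    (t : mono_map m' m) H',
    phi d'' m' (a ∘ b) (sact t s) H' = term_act b t (phi d' m a s H).

(** Normal forms: no [Fill] node sits over the boundary of its cell. *)
Fixpoint well_formed d n (x : term d n) : Prop :=
  match x with
  | Base _ _ _ => True
  | Fill d0 k phi d n a s => [/\ ~ bdry s,
      forall d' m (a : Hom D d' d0) (s : simp (cell k) m) H, well_formed (phi d' m a s H)
      & matching phi]
  end.

Definition good d k (phi : family d k) : Prop :=
  (forall d' m (a : Hom D d' d) (s : simp (cell k) m) H, well_formed (phi d' m a s H)) /\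
  matching phi.

Lemma fill_val_bdry d k (phi : family d k) d' n (a : Hom D d' d)
  (s : simp (cell k) n) (H : bdry s) : fill_val phi a s = phi d' n a s H.
Proof.
by rewrite /fill_val; case: excluded_middle_informative => // H'; congr phi;
    apply: proof_irrelevance.
Qed.

Lemma fill_val_new d k (phi : family d k) d' n (a : Hom D d' d)
  (s : simp (cell k) n) : ~ bdry s -> fill_val phi a s = Fill phi a s.
Proof. by rewrite /fill_val; case: excluded_middle_informative. Qed.

Lemma term_act_fill_val d k (phi : family d k) d' n (a : Hom D d' d)
  (s : simp (cell k) n) d'' m (b : Hom D d'' d') (t : mono_map m n) :
  matching phi -> term_act b t (fill_val phi a s) = fill_val phi (a ∘ b) (sact t s).
Proof.
move=> mP; case: (classic (bdry s)) => H; last by rewrite (fill_val_new _ _ H).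
rewrite (fill_val_bdry _ _ H) (fill_val_bdry _ _ (bdry_closed t H)).
by rewrite (mP _ _ _ _ H).
Qed.

Lemma well_formed_fill_val d k (phi : family d k) d' n (a : Hom D d' d)
  (s : simp (cell k) n) : good phi -> well_formed (fill_val phi a s).
Proof.
move=> [gw gm]; case: (classic (bdry s)) => H.
  by rewrite (fill_val_bdry _ _ H); apply: gw.
by rewrite fill_val_new.
Qed.

Lemma well_formed_act d n (x : term d n) d' m (b : Hom D d' d) (t : mono_map m n) :
  well_formed x -> well_formed (term_act b t x).
Proof. by case: x b t => // d0 k phi d1 n1 a s b t [_ h1 h2];
    apply: well_formed_fill_val. Qed.

Lemma term_act_comp d n (x : term d n) d' m (b : Hom D d' d) (t : mono_map m n)
  d'' q (b' : Hom D d'' d') (t' : mono_map q m) : well_formed x ->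
  term_act b' t' (term_act b t x) = term_act (b ∘ b') (mono_comp t t') x.
Proof.
case: x b t => [d0 n0 x|d0 k phi d1 n1 a s] b t.
  by move=> _; rewrite !term_act_Base sact_comp dact_comp sapp_nat.
by case=> _ _ mP; rewrite !term_act_Fill term_act_fill_val // compmA sact_comp.
Qed.

Lemma term_act_id d n (x : term d n) : well_formed x ->
    term_act (idm D d) (mono_id n) x = x.
Proof.
case: x => [d0 n0 x|d0 k phi d1 n1 a s]; first by rewrite term_act_Base sact_id dact_id.
by case=> ns _ _; rewrite term_act_Fill compm_idr sact_id fill_val_new.
Qed.

Definition completion_simp d n : small := {x : term d n | well_formed x}.

Definition completion_act d' m d n (b : Hom D d' d) (t : mono_map m n)
  (x : completion_simp d n) : completion_simp d' m :=
  exist _ (term_act b t (sval x)) (well_formed_act b t (proj2_sig x)).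

Lemma completion_act_comp d n (x : completion_simp d n) d' m (b : Hom D d' d)
    (t : mono_map m n)
  d'' q (b' : Hom D d'' d') (t' : mono_map q m) :
  completion_act b' t' (completion_act b t x) = completion_act (b ∘ b') (mono_comp t t')
      x.
Proof. by apply: sig_eq => /=; rewrite term_act_comp //; apply: (proj2_sig x). Qed.

Lemma completion_act_id d n (x : completion_simp d n) : completion_act (idm D d)
    (mono_id n) x = x.
Proof. by apply: sig_eq => /=; rewrite term_act_id //; apply: (proj2_sig x). Qed.

Definition completion_ob (d : sOb D) : sSet.
Proof.
refine (@mk_sSet (completion_simp d) (fun m n t x => completion_act (idm D d) t x) _ _).
- by move=> n x; apply: completion_act_id.
- by move=> m n p s t x; rewrite completion_act_comp compm_idl.
Defined.

Definition completion_map (d d' : sOb D) (a : Hom D d' d) : Hom sSet (completion_ob d)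
    (completion_ob d').
Proof.
refine (@mk_shom (completion_ob d) (completion_ob d')
    (fun n x => completion_act a (mono_id n) x) _).
move=> m n t x; rewrite [LHS]completion_act_comp [RHS]completion_act_comp compm_idl
    compm_idr.
by congr completion_act; apply: mono_map_eq.
Defined.

Definition completion : Fun (sop D) sSet.
Proof.
refine (@Functor (sop D) sSet completion_ob (fun d d' a => @completion_map d d' a) _ _).
- by move=> d; apply: shom_eq => n x; apply: completion_act_id.
- move=> d d' d'' a' a; apply: shom_eq => n x; rewrite [RHS]completion_act_comp.
  by congr completion_act; apply: mono_map_eq.
Defined.

Definition completion_in : Hom (Fun (sop D) sSet) G completion.
Proof.
refine (@NatTrans (sop D) sSet G completion (fun d =>
  @mk_shom (fob G d) (completion_ob d) (fun n x => exist _ (Base x) I : completion_simp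
      d n) _) _).
- move=> d d' a; apply: shom_eq => n x; apply: sig_eq; congr Base.
  by rewrite sact_id.
Unshelve.
- by move=> m n t x; apply: sig_eq; congr Base; rewrite dact_id.
Defined.

(** The filler of a partial map R is the formal one. *)
Lemma completion_fills d k :
  fills (@bdry k) (fun n (_ : simp (cell k) n) (_ : simp (fob completion d) n) => True).
Proof.
move=> R cR fR _ HA.
pose v m s (H : bdry s) : simp (fob completion d) m :=
  proj1_sig (constructive_indefinite_description _ (HA m s H)).
have vP m s H : R m s (@v m s H) by rewrite /v; case: constructive_indefinite_description.
pose phi : family d k := fun d' m a s H => term_act a (mono_id m)
    (sval (v m s H : completion_simp d m)).
have vw m s H : well_formed (sval (@v m s H : completion_simp d m))
    by apply: (proj2_sig (v m s H : completion_simp d m)).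
have gP : good phi.
  split=> [d' m a s H|d' m a s H d'' m' b t H']; first exact: well_formed_act.
  rewrite /phi term_act_comp // (_ : v _ (sact t s) H' = sact t (v _ s H)); last first.
    by apply: fR (vP _ _ _) (cR _ _ _ _ _ (vP _ _ _)).
  rewrite /= term_act_comp // compm_idl; congr term_act; exact: mono_map_eq.
have gm := proj2 gP.
pose h m (s : simp (cell k) m) : simp (fob completion d) m :=
  exist _ (fill_val phi (idm D d) s) (well_formed_fill_val (idm D d) s gP) :
      completion_simp d m.
have hN m n (t : mono_map m n) (s : simp (cell k) n) : h m (sact t s) = sact t (h n s).
  by apply: sig_eq; rewrite /= term_act_fill_val ?compm_idl.
exists (@mk_shom (cell k) (fob completion d) h hN); split=> // m s x H Rx.
rewrite -(fR _ _ _ _ (vP _ _ H) Rx); apply: sig_eq.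
by rewrite /= (fill_val_bdry _ _ H) /phi term_act_id.
Qed.

Section Lift.

Variable P : Fun (sop D) sSet.
Variable Phi : forall d, srel (fob completion d) (fob P d).
Hypothesis PhiD : forall d d' (a : Hom D d' d) n e x,
  @Phi d n e x -> @Phi d' n (sapp (dact completion a) e) (sapp (dact P a) x).
Hypothesis PhiF : forall d k (b : Hom sSet (cell k) (fob completion d)),
  fills (@bdry k) (rel_pre b (@Phi d)).
Variable g : Hom (Fun (sop D) sSet) G P.
Hypothesis gP : forall d n (x : simp (fob G d) n),
  Phi (sapp (nt completion_in d) x) (sapp (nt g d) x).

(** The extension of g to terms chooses a filler in P for every [Fill] node.  It is
    partial in form because the existence of such a filler depends on naturality
    of the extension at the subterms, which [term_extP] proves by induction. *)
Fixpoint term_ext d n (x : term d n) : option (simp (fob P d) n) :=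
  match x in term d n return option (simp (fob P d) n) with
  | Base d n x => Some (sapp (nt g d) x)
  | Fill d0 k phi d n a s =>
    match excluded_middle_informative (exists h : Hom sSet (cell k) (fob P d0),
      (forall m (s : simp (cell k) m) H,
        term_ext (phi d0 m (idm D d0) s H) = Some (sapp h s)) /\
      (forall m (s : simp (cell k) m) (w : well_formed (fill_val phi (idm D d0) s)),
         Phi (exist _ _ w : simp (fob completion d0) m) (sapp h s))) with
    | left ex => Some (sapp (dact P a)
        (sapp (proj1_sig (constructive_indefinite_description _ ex)) s))
    | right _ => None
    end
  end.

Lemma term_extP d n (x : term d n) (w : well_formed x) :
  exists y, [/\ term_ext x = Some y, Phi (exist _ x w : simp (fob completion d) n) y &
    forall d' m (b : Hom D d' d) (t : mono_map m n),
      term_ext (term_act b t x) = Some (sapp (dact P b) (sact t y))].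
Proof.
elim: x w => [{}d {}n x w|d0 k phi IH {}d {}n a s w].
  exists (sapp (nt g d) x); split=> //.
    by have := gP x; congr Phi; apply: sig_eq.
  by move=> d' m b t /=; rewrite sapp_nat dact_nat sapp_nat.
have ns : ~ bdry s by case: w.
have gd : good phi by case: w.
have [gw gm] := gd.
have ex : exists h : Hom sSet (cell k) (fob P d0),
      (forall m (s : simp (cell k) m) H,
        term_ext (phi d0 m (idm D d0) s H) = Some (sapp h s)) /\
      (forall m (s : simp (cell k) m) (w : well_formed (fill_val phi (idm D d0) s)),
         Phi (exist _ _ w : simp (fob completion d0) m) (sapp h s)).
  pose b m (s0 : simp (cell k) m) : simp (fob completion d0) m :=
    exist _ (fill_val phi (idm D d0) s0) (well_formed_fill_val (idm D d0) s0 gd) :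
        completion_simp d0 m.
  have bN m q (t : mono_map m q) (s0 : simp (cell k) q) : b m (sact t s0) =
      sact t (b q s0).
    by apply: sig_eq; rewrite /= term_act_fill_val ?compm_idl.
  have [||||h [h1 h2]] := @PhiF d0 k (@mk_shom (cell k) (fob completion d0) b bN)
    (fun m s y => exists H : bdry s, term_ext (phi d0 m (idm D d0) s H) = Some y).
  - move=> m q t s' y [H e]; have [y' [e' _ /(_ _ _ (idm D d0) t)]] :=
      IH _ _ (idm D d0) s' H (gw _ _ _ _ _).
    have -> : y' = y by move: e'; rewrite e => -[].
    rewrite -(gm _ _ _ _ H _ _ _ _ (bdry_closed t H)).
    by rewrite dact_id compm_idl => e2; exists (bdry_closed t H).
  - move=> m s' y y' [H e] [H' e'].
    by move: e'; rewrite (proof_irrelevance _ H' H) e => -[].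
  - move=> m s' y [H e]; have [y' [e' + _]] := IH _ _ (idm D d0) s' H (gw _ _ _ _ _).
    have -> : y' = y by move: e'; rewrite e => -[].
    rewrite /rel_pre; congr Phi; apply: sig_eq => /=.
    by rewrite (fill_val_bdry _ _ H).
  - move=> m s' H; have [y' [e' _ _]] := IH _ _ (idm D d0) s' H (gw _ _ _ _ _).
    by exists y', H.
  exists h; split=> [m s' H|m s' w'].
    have [y' [e' _ _]] := IH _ _ (idm D d0) s' H (gw _ _ _ _ _).
    by rewrite e' (h2 _ _ y' H) //; exists H.
  by have := h1 m s'; rewrite /rel_pre; congr Phi; apply: sig_eq.
have [h [hE [h1 h2]]] : exists h : Hom sSet (cell k) (fob P d0),
  (forall d' m (b : Hom D d' d0) (s : simp (cell k) m),
    term_ext (Fill phi b s) = Some (sapp (dact P b) (sapp h s))) /\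
  ((forall m (s : simp (cell k) m) H,
        term_ext (phi d0 m (idm D d0) s H) = Some (sapp h s)) /\
      (forall m (s : simp (cell k) m) (w : well_formed (fill_val phi (idm D d0) s)),
         Phi (exist _ _ w : simp (fob completion d0) m) (sapp h s))).
  rewrite /=; case: excluded_middle_informative => // ex'.
  exists (proj1_sig (constructive_indefinite_description _ ex')); split=> //.
  by case: constructive_indefinite_description.
exists (sapp (dact P a) (sapp h s)); split; first exact: hE.
  have := PhiD a (h2 _ s (well_formed_fill_val (idm D d0) s gd)).
  congr Phi; apply: sig_eq => /=.
  by rewrite term_act_fill_val // compm_idl sact_id fill_val_new.
move=> d' m b t.
rewrite -[term_act b t _]/(fill_val phi (a ∘ b) (sact t s)).
rewrite -(sapp_nat (dact P a)) -dact_comp -sapp_nat.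
case: (classic (bdry (sact t s))) => H; last by rewrite fill_val_new // hE.
rewrite (fill_val_bdry _ _ H).
have [y [e _ /(_ _ _ (a ∘ b) (mono_id m))]] :=
    IH _ _ (idm D d0) (sact t s) H (gw _ _ _ _ _).
rewrite sact_id; have -> : y = sapp h (sact t s) by move: e; rewrite h1 => -[].
move=> <-; congr term_ext.
have H2 : bdry (sact (mono_id m) (sact t s)) by rewrite sact_id.
rewrite -(gm _ _ _ _ H _ _ _ _ H2) compm_idl.
move: H2; rewrite sact_id => H2; congr phi; exact: proof_irrelevance.
Qed.

(** The inclusion of G in its completion has the left lifting property of a
    relative cell complex, against maps with objectwise fillers, but in the
    category of diagrams.  Taking a relation Phi in place of such a map allows
    conditions on h such as prescribed values at the ends of a path. *)
Lemma completion_lift : exists h : Hom (Fun (sop D) sSet) completion P,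
  (forall d n (x : simp (fob completion d) n), Phi x (sapp (nt h d) x)) /\
  (forall d n (x : simp (fob G d) n), sapp (nt h d) (sapp (nt completion_in d) x) =
      sapp (nt g d) x).
Proof.
have ex d n (x : simp (fob completion d) n) :
  exists y, [/\ term_ext (sval (x : completion_simp d n)) = Some y, Phi x y &
    forall d' m (b : Hom D d' d) (t : mono_map m n),
      term_ext (term_act b t (sval (x : completion_simp d n))) =
          Some (sapp (dact P b) (sact t y))].
  by case: x => x w; have [y yP] := term_extP w; exists y.
pose h d n x := proj1_sig (constructive_indefinite_description _ (ex d n x)).
have hP d n x : [/\ term_ext (sval (x : completion_simp d n)) = Some (h d n x),
    Phi x (h d n x) &
    forall d' m (b : Hom D d' d) (t : mono_map m n),
      term_ext (term_act b t (sval (x : completion_simp d n))) =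
          Some (sapp (dact P b) (sact t (h d n x)))].
  by rewrite /h; case: constructive_indefinite_description.
have hA d n x d' m (b : Hom D d' d) (t : mono_map m n) :
  h d' m (completion_act b t x) = sapp (dact P b) (sact t (h d n x)).
  have [_ _ e] := hP d n x; have [e' _ _] := hP d' m (completion_act b t x).
  by move: e'; rewrite /= e => -[].
have hN d m n (t : mono_map m n) (x : simp (fob completion d) n) :
  h d m (sact t x) = sact t (h d n x) by rewrite hA dact_id.
pose f d : Hom sSet (fob completion d) (fob P d) :=
  @mk_shom (fob completion d) (fob P d) (h d) (hN d).
have fN (d d' : sOb D) (a : Hom (sop D) d d') :
  f d' ∘ fmap completion a = fmap P a ∘ f d.
  by apply: shom_eq => n x; rewrite [LHS]hA sact_id.
exists (@NatTrans (sop D) sSet completion P f fN); split=> d n x.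
  by have [] := hP d n x.
by have [/=] := hP d n (sapp (nt completion_in d) x) => -[].
Qed.

End Lift.
End Completion.

(** * Path objects and the Kan property of prism fillers *)

(** A condition that concerns A only holds for any extension from A. *)
Lemma fills_weaken (B X : sSet) (A : spred B) (Psi Psi' : srel B X) :
  fills A Psi -> rel_sub Psi' Psi ->
  (forall n b x, ~ A n b -> Psi n b x -> Psi' n b x) -> fills A Psi'.
Proof.
move=> fA sub hA R cR fR sR HA.
have [h [h1 h2]] := fA R cR fR (fun n b x Rx => sub n b x (sR n b x Rx)) HA.
exists h; split=> // n b; case: (classic (A n b)) => Ab; last exact: hA.
by have [x Rx] := HA n b Ab; rewrite (h2 _ _ _ Ab Rx); apply: sR.
Qed.

Lemma fills_iso (B B' X : sSet) (f : Hom sSet B' B) (g : Hom sSet B B')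
  (A : spred B) (A' : spred B') (Psi : srel B X) :
  (forall n (b : simp B n), sapp f (sapp g b) = b) ->
  (forall n b, A n (sapp f b) <-> A' n b) ->
  fills A' (rel_pre f Psi) -> fills A Psi.
Proof.
move=> fg hA fA R cR fR sR HA.
have [|||h [h1 h2]] := fA (rel_pre f R) (rel_pre_closed cR).
- by move=> n b x x'; apply: fR.
- by move=> n b x; apply: sR.
- by move=> n b /hA/HA.
exists (h ∘ g); split=> n b; first by have := h1 n (sapp g b); rewrite /rel_pre fg.
by move=> x Ab Rx; apply: (h2 n (sapp g b)); [apply/hA|]; rewrite /rel_pre fg.
Qed.

Definition rel_all (B X : sSet) : srel B X := fun _ _ _ => True.
Arguments rel_all : clear implicits.

Lemma kan_complex_prism e n (X : sSet) : kan_complex X ->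
  fills (@open_prism e n) (rel_all (prism n) X).
Proof.
move=> kX; apply: fills_weaken (@kan_prism n e X _ (to_pt X) (to_pt (prism n))
    (kan_complex_fib kX)) _ _ => //.
Qed.

(** The simplices of [ihom (std 1) X] are the paths in X; this is the value at the
    simplex (u, t) of the product of [std 1] and [std n]. *)
Definition path_at (X : sSet) n (g : simp (ihom (std 1) X) n) m (u : mono_map m 1)
  (t : mono_map m n) : simp X m :=
  @sapp (sprod (std 1) (std n)) X (g : Hom sSet (sprod (std 1) (std n)) X) m (u, t).

Lemma path_at_sact (X : sSet) n (g : simp (ihom (std 1) X) n) m (s : mono_map m n) q
  (u : mono_map q 1) (t : mono_map q m) :
  path_at (sact s g) u t = path_at g u (mono_comp s t).
Proof. by []. Qed.

Lemma sact_path_at (X : sSet) n (g : simp (ihom (std 1) X) n) m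
  (u : mono_map m 1) (t : mono_map m n) q (s : mono_map q m) :
  sact s (path_at g u t) = path_at g (mono_comp u s) (mono_comp t s).
Proof.
exact: (esym (@sapp_nat (sprod (std 1) (std n)) X g q m s (u, t))).
Qed.

Lemma path_ext (X : sSet) n (g g' : simp (ihom (std 1) X) n) :
  (forall m u (t : mono_map m n), path_at g u t = path_at g' u t) -> g = g'.
Proof.
move=> h; apply: (@shom_eq (sprod (std 1) (std n)) X) => m [u t]; exact: h.
Qed.

Definition curry (B X : sSet) (h : Hom sSet (cyl B) X) : Hom sSet B (ihom (std 1) X).
Proof.
refine (@mk_shom B (ihom (std 1) X) (fun n b =>
  @mk_shom (sprod (std 1) (std n)) X
    (fun m ut => sapp h (spair (sact (ut.2 : mono_map m n) b) ut.1)) _) _).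
- move=> m n s b; apply: (@shom_eq (sprod (std 1) (std m)) X) => q [u t] /=.
  by rewrite -sact_comp.
Unshelve.
- by move=> m q s [u t]; rewrite -sapp_nat; congr sapp; congr (_, _) => /=;
    rewrite -sact_comp.
Defined.

Lemma curryE (B X : sSet) (h : Hom sSet (cyl B) X) n (b : simp B n) m u
    (t : mono_map m n) :
  path_at (sapp (curry h) b) u t = sapp h (spair (sact t b) (u : simp (std 1) m)).
Proof. by []. Qed.

Definition uncurry (B X : sSet) (k : Hom sSet B (ihom (std 1) X)) : Hom sSet (cyl B) X.
Proof.
refine (@mk_shom (cyl B) X (fun n c => path_at (sapp k c.1) (c.2 : mono_map n 1)
    (mono_id n)) _).
move=> m n t [b u]; rewrite sact_path_at /= sapp_nat path_at_sact.
by congr path_at; apply: mono_map_eq.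
Defined.

(** The relation that a homotopy satisfies, transposed to the path object. *)
Definition path_rel (B X : sSet) (Psi : srel (cyl B) X) : srel B (ihom (std 1) X) :=
  fun n b g => forall m (t : mono_map m n) (u : mono_map m 1),
    Psi m (spair (sact t b) (u : simp (std 1) m)) (path_at g u t).

Lemma path_rel_closed (B X : sSet) (Psi : srel (cyl B) X) : rel_closed (path_rel Psi).
Proof.
move=> m n s b g h q t u; rewrite path_at_sact -sact_comp; exact: h.
Qed.

(** By adjunction: to extend a map into the path object from A is to extend a
    homotopy from A x I.  Homotopies that are already determined on a subcomplex Q
    of the cylinder are extended from the union of A x I and Q. *)
Lemma path_fills (B X : sSet) (A : spred B) (Q : spred (cyl B)) (Psi : srel (cyl B) X) :
  (forall m n (t : mono_map m n) c x, Q n c -> Psi n c x -> Psi m (sact t c) (sact t x))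
      ->
  pred_closed A -> pred_closed Q ->
  (forall n c x x', Q n c -> Psi n c x -> Psi n c x' -> x = x') ->
  (forall n c, Q n c -> exists x, Psi n c x) ->
  fills (fun n (c : simp (cyl B) n) => A n c.1 \/ Q n c) Psi -> fills A (path_rel Psi).
Proof.
move=> cP cA cQ uQ eQ fQ R cR fR sR HA.
have sP n (b : simp B n) g m u (t : mono_map m n) : R n b g ->
  Psi m (spair (sact t b) (u : simp (std 1) m)) (path_at g u t).
  by move=> h; apply: (sR _ _ _ h).
have sP' n (b : simp B n) u g : R n b g -> Psi n (b, u) (path_at g u (mono_id n)).
  by move=> h; have := sP _ _ _ _ u (mono_id n) h; rewrite sact_id.
have [||||h [h1 h2]] := fQ (fun n c x =>
  (exists g, [/\ A n c.1, R n c.1 g & x = path_at g (c.2 : mono_map n 1) (mono_id n)]) \/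
  (Q n c /\ Psi n c x)).
- move=> m n t c x [[g [Ac Rg ->]]|[Qc Px]]; last by right; split; [apply: cQ|apply: cP].
  left; exists (sact t g); split; [exact: cA|exact: cR|].
  by rewrite sact_path_at path_at_sact; congr path_at; apply: mono_map_eq.
- move=> n [b u] x x' [[g [_ Rg ->]]|[Qc Px]] [[g' [_ Rg' ->]]|[Qc' Px']].
  + by rewrite (fR _ _ _ _ Rg Rg').
  + exact: uQ Qc' (sP' _ _ _ _ Rg) Px'.
  + exact: uQ Qc Px (sP' _ _ _ _ Rg').
  + exact: uQ Qc Px Px'.
- by move=> n [b u] x [[g [_ Rg ->]]|[_ //]]; apply: sP'.
- move=> n [b u] [Ab|Qc]; last by have [x Px] := eQ _ _ Qc; exists x; right.
  by have [g Rg] := HA _ _ Ab; exists (path_at g u (mono_id n)); left; exists g.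
exists (curry h); split=> [n b m t u|n b g Ab Rg]; first by rewrite curryE; apply: h1.
apply: path_ext => m u t; rewrite curryE; apply: h2; left; first exact: cA.
exists (sact t g); split; [exact: cA|exact: cR|].
by rewrite path_at_sact; apply: (congr1 (path_at g u)); apply: mono_map_eq.
Qed.

Lemma fills_path_pre (B' B X : sSet) (f : Hom sSet B' B) (Psi : srel (cyl B) X) A :
  fills A (path_rel (rel_pre (cyl_map f) Psi)) -> fills A (rel_pre f (path_rel Psi)).
Proof.
move=> fA R cR fR sR HA.
have [|h [h1 h2]] := fA R cR fR _ HA.
  move=> n b g /sR h m t u; rewrite /rel_pre /= sapp_nat; exact: h.
exists h; split=> // n b m t u; have := h1 n b m t u.
by rewrite /rel_pre /= sapp_nat.
Qed.

(** The horn k in [std n] is a retract of the inclusion of horn x I and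
    [std n] x {e} in the prism.  The retraction applies min(-, k) at the end 0 when
    e = 0, and max(-, k) at the end 1 when e = 1; this end is then mapped into the
    horn if k < n, respectively if 0 < k. *)
Section Retract.
Variables (n : nat) (k : 'I_n.+1) (e : bool).

Definition clamp (i : 'I_n.+1) : 'I_n.+1 :=
  if e then (if i <= k then k else i) else (if i <= k then i else k).

Lemma horn_retraction_mono m (c : simp (prism n) m) (q r : 'I_m.+1) : q <= r ->
  let f q := let s := (c.1 : mono_map m n) q in
    if (c.2 : mono_map m 1) q == endpt e then clamp s else s in f q <= f r.
Proof.
move=> qr; have := mfun_mono (c.1 : mono_map m n) qr.
have := mfun_mono (c.2 : mono_map m 1) qr; rewrite /= /clamp -!val_eqE /=.
have := ltn_ord ((c.2 : mono_map m 1) q); have := ltn_ord ((c.2 : mono_map m 1) r).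
case: (e) => /=; do ?case: eqP; do ?case: ifP; lia.
Qed.

Definition horn_retraction : Hom sSet (prism n) (std n).
Proof.
refine (@mk_shom (prism n) (std n) (fun m c => MonoMap (@horn_retraction_mono m c)) _).
by move=> m q t c; apply: mono_map_eq.
Defined.
End Retract.

Lemma kan_of_prisms (X : sSet) :
  (forall e n, fills (@open_prism e n) (rel_all (prism n) X)) -> kan_complex X.
Proof.
move=> fX n k u n0.
have [e eP] : exists e : bool, exists i : 'I_n.+1, i <> k /\ forall j, clamp k e j <> i.
  case: (ltngtP k n) => kn.
  - exists false, ord_max; split; first by move/(congr1 val) => /=; lia.
    by move=> j /(congr1 val); rewrite /clamp; case: (leqP j k) => /=; lia.
  - by have := ltn_ord k; lia.
  - exists true, ord0; split; first by move/(congr1 val) => /=; lia.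
    by move=> j /(congr1 val); rewrite /clamp; case: (leqP j k) => /=; lia.
have cl m (s : mono_map m n) u' : in_horn k s ->
    in_horn k (sapp (horn_retraction k e) (s, u') : mono_map m n).
  case=> i [ik iP]; exists i; split=> // j /=; case: ifP => _; last exact: iP.
  by rewrite /clamp; case: (e); case: ifP => _; do ?[exact: iP|by move/esym].
have [||||h [_ h2]] := @cyl_fill e (std n) X (rel_all _ _) (fun m s => in_horn k s)
   (@in_horn_closed n k) (fun q b => fX e q) (fun m c x =>
     exists H : in_horn k (sapp (horn_retraction k e) c : mono_map m n),
       x = sapp u (exist _ _ H : simp (horn k) m)) => //.
- move=> m q t c x [H ->].
  have H2 : in_horn k (sapp (horn_retraction k e) (sact t c) : mono_map m n).
    by rewrite sapp_nat; apply: in_horn_closed.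
  exists H2; rewrite -sapp_nat; apply: (congr1 (@sapp (horn k) X u m)).
  by apply: sig_eq; apply: mono_map_eq.
- move=> m c x x' [H ->] [H' ->]; apply: (congr1 (@sapp (horn k) X u m)).
  exact: sig_eq.
- move=> m [s u'] [h|h].
    have H := cl m s u' h.
    by exists (sapp u (exist _ _ H : simp (horn k) m)), H.
  have H : in_horn k (sapp (horn_retraction k e) (s, u') : mono_map m n).
    by case: eP => i [ik iP]; exists i; split=> // j /=; rewrite h eqxx; apply: iP.
  by exists (sapp u (exist _ _ H : simp (horn k) m)), H.
have iN m q (t : mono_map m q) (s : simp (std n) q) :
   sapp h (spair (sact t s) (vtx (endpt (~~ e)) m : simp (std 1) m)) =
   sact t (sapp h (spair s (vtx (endpt (~~ e)) q : simp (std 1) q))).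
  by rewrite -sapp_nat; congr sapp; congr (_, _); apply: mono_map_eq.
exists (@mk_shom (std n) X (fun m s => sapp h
    (spair s (vtx (endpt (~~ e)) m : simp (std 1) m))) iN).
apply: shom_eq => m [s hs] /=.
apply: h2; first by left.
have rE : sapp (horn_retraction k e) (s, vtx (endpt (~~ e)) m) = s.
  by apply: mono_map_eq => j /=; case: eqP => //; case: (e).
have H : in_horn k (sapp (horn_retraction k e) (s, vtx (endpt (~~ e)) m) : mono_map m n)
    by rewrite rE.
by exists H; apply: (congr1 (@sapp (horn k) X u m)); apply: sig_eq.
Qed.

(** The value at a simplex is the value at its first vertex, and the two vertices
    of the cylinder over the first vertex of b are joined by an edge. *)
Lemma disc_homotopy_const (B : sSet) (A : small) (f : Hom sSet (cyl B) (sdisc A)) n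
  (b : simp B n) (u u' : simp (std 1) n) : sapp f (spair b u) = sapp f (spair b u').
Proof.
pose t0 : mono_map 0 n := vtx ord0 0.
pose edge : simp (cyl B) 1 := (sact (vtx ord0 1 : mono_map 1 0) (sact t0 b), mono_id 1).
suff E (w : simp (std 1) n) : sapp f (spair b w) = sapp f edge by rewrite !E.
rewrite -(sapp_disc_sact f t0) -(sapp_disc_sact f (vtx ((w : mono_map n 1) ord0) 0) edge).
apply: (congr1 (@sapp (cyl B) (sdisc A) f 0)); congr (_, _); last by apply: mono_map_eq.
rewrite -sact_comp (_ : mono_comp _ _ = mono_id 0) ?sact_id //.
by apply: mono_map_eq => j; rewrite [j]ord1; apply: val_inj.
Qed.

(** * Contracting a cofibrant diagram onto a representable one *)

Definition path_diagram (D : small_category) (X : Fun (sop D) sSet) : Fun (sop D) sSet.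
Proof.
refine (@Functor (sop D) sSet (fun d => ihom (std 1) (fob X d))
  (fun d d' a => ihom_map (idm sSet (std 1)) (@dact D X d d' a)) _ _).
- move=> d; apply: shom_eq => n g; apply: path_ext => m u t.
  exact: (dact_id (path_at g u t)).
- move=> d d' d'' a' a; apply: shom_eq => n g; apply: path_ext => m u t.
  exact: (@dact_comp D X d d' d'' a a' m (path_at g u t)).
Defined.

Lemma path_at_dact (D : small_category) (X : Fun (sop D) sSet) d d' (a : Hom D d' d)
  n (g : simp (fob (path_diagram X) d) n) m u (t : mono_map m n) :
  path_at (sapp (dact (path_diagram X) a) g) u t = sapp (dact X a) (path_at g u t).
Proof. by []. Qed.

(** Cofibrancy of a diagram on D^op, phrased with relations: every relation over G
    whose fibre problems are acyclic has a natural section. *)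
Definition projective (D : small_category) (G : Fun (sop D) sSet) : Prop :=
  forall (X : Fun (sop D) sSet) (Phi : forall d, srel (fob G d) (fob X d)),
    (forall d, rel_closed (@Phi d)) ->
    (forall d d' (a : Hom D d' d) n e x,
      @Phi d n e x -> @Phi d' n (sapp (dact G a) e) (sapp (dact X a) x)) ->
    (forall d (B : sSet) (A : spred B) (b : Hom sSet B (fob G d)),
      pred_closed A -> fills A (rel_pre b (@Phi d))) ->
  exists h : Hom (Fun (sop D) sSet) G X,
    forall d n (e : simp (fob G d) n), Phi d n e (sapp (nt h d) e).

(** Homotopies out of a cofibrant diagram, with prescribed values on a subdiagram
    Q of its cylinder: the section of the corresponding relation on paths. *)
Lemma projective_cyl (D : small_category) (G X : Fun (sop D) sSet)
  (Q : forall d, spred (cyl (fob G d))) (Psi : forall d, srel (cyl (fob G d)) (fob X d)) :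
  projective G ->
  (forall d m n (t : mono_map m n) c x,
     Q d n c -> Psi d n c x -> Psi d m (sact t c) (sact t x)) ->
  (forall d, pred_closed (@Q d)) ->
  (forall d d' (a : Hom D d' d) n c x,
     @Psi d n c x -> @Psi d' n (sapp (cyl_map (dact G a)) c) (sapp (dact X a) x)) ->
  (forall d n c x x', Q d n c -> Psi d n c x -> Psi d n c x' -> x = x') ->
  (forall d n c, Q d n c -> exists x, Psi d n c x) ->
  (forall d (B : sSet) (A : spred B) (b : Hom sSet B (fob G d)), pred_closed A ->
    fills (fun n (c : simp (cyl B) n) => A n c.1 \/ Q d n (sapp (cyl_map b) c))
      (rel_pre (cyl_map b) (@Psi d))) ->
  exists h : forall d, Hom sSet (cyl (fob G d)) (fob X d),
    (forall d n (c : simp (cyl (fob G d)) n), Psi d n c (sapp (h d) c)) /\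
    (forall d d' (a : Hom D d' d) n (c : simp (cyl (fob G d)) n),
      sapp (h d') (sapp (cyl_map (dact G a)) c) = sapp (dact X a) (sapp (h d) c)).
Proof.
move=> pG cP cQ dP uQ eQ fP.
have [|||h hP] := pG (path_diagram X) (fun d => path_rel (@Psi d)).
- by move=> d; apply: path_rel_closed.
- move=> d d' a n e g H m t u; rewrite path_at_dact -sapp_nat.
  exact: (dP _ _ a _ _ _ (H m t u)).
- move=> d B A b cA; apply: fills_path_pre.
  apply: (@path_fills _ _ _ (fun n c => Q d n (sapp (cyl_map b) c))) => //.
  + by move=> m n t c x Qc; rewrite /rel_pre sapp_nat; apply: cP.
  + by move=> m n t c; rewrite sapp_nat; apply: cQ.
  + by move=> n c x x' Qc; apply: uQ.
  + by move=> n c /eQ.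
  + exact: fP.
exists (fun d => uncurry (nt h d)); split.
- by move=> d n [e u]; have := hP d n e n (mono_id n) u; rewrite sact_id.
- move=> d d' a n [e u]; rewrite -[LHS]/(path_at (sapp (nt h d') (sapp (dact G a) e))
    (u : mono_map n 1) (mono_id n)) dact_nat.
  exact: path_at_dact.
Qed.

(** Maps from a diagram G to the cofree diagram on Y at d0 are the maps from
    G(d0) to Y, without any naturality. *)
Section Cofree.
Variables (D : small_category) (d0 : sOb D) (Y : sSet).

Definition cofree_ob (d : sOb D) : sSet.
Proof.
refine (@mk_sSet (fun n => Hom D d0 d -> simp Y n) (fun m n t psi k => sact t (psi k)) _
    _).
- by move=> n psi; apply: functional_extensionality => k; rewrite sact_id.
- by move=> m n p s t psi; apply: functional_extensionality => k; rewrite sact_comp.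
Defined.

Definition cofree : Fun (sop D) sSet.
Proof.
refine (@Functor (sop D) sSet cofree_ob (fun d d' (a : Hom D d' d) =>
  @mk_shom (cofree_ob d) (cofree_ob d') (fun n psi k => psi (a ∘ k))
      (fun _ _ _ _ => erefl)) _ _).
- move=> d; apply: shom_eq => n psi; apply: functional_extensionality => k /=.
  by rewrite compm_idl.
- move=> d d' d'' a' a; apply: shom_eq => n psi; apply: functional_extensionality => k /=.
  by rewrite compmA.
Defined.

Lemma fills_cofree d (B : sSet) (A : spred B) (Phi : Hom D d0 d -> srel B Y) :
  (forall k, fills A (Phi k)) ->
  fills A (X := fob cofree d) (fun n b psi => forall k, Phi k n b (psi k)).
Proof.
move=> fA R cR fR sR HA.
have ex k : exists h : Hom sSet B Y, (forall n (b : simp B n), Phi k n b (sapp h b)) /\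
  forall n b (psi : simp (fob cofree d) n), A n b -> R n b psi -> sapp h b = psi k.
  have [||||h [h1 h2]] := fA k (fun n b x => exists psi, R n b psi /\ x = psi k).
  - by move=> m n t b x [psi [/(cR _ _ t) h ->]]; exists (sact t psi).
  - by move=> n b x x' [psi [h ->]] [psi' [h' ->]]; rewrite (fR _ _ _ _ h h').
  - by move=> n b x [psi [/sR h ->]]; apply: h.
  - by move=> n b /HA [psi h]; exists (psi k), psi.
  by exists h; split=> // n b psi Ab Rp; apply: h2 => //; exists psi.
pose h k := proj1_sig (constructive_indefinite_description _ (ex k)).
have hP k : (forall n (b : simp B n), Phi k n b (sapp (h k) b)) /\
  forall n b (psi : simp (fob cofree d) n), A n b -> R n b psi -> sapp (h k) b = psi k.
  by rewrite /h; case: constructive_indefinite_description.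
have hN m n (t : mono_map m n) (b : simp B n) :
  (fun k => sapp (h k) (sact t b)) = sact (X := fob cofree d) t (fun k => sapp (h k) b).
  by apply: functional_extensionality => k; rewrite sapp_nat.
exists (@mk_shom B (fob cofree d) (fun n b k => sapp (h k) b) hN); split.
- by move=> n b k; apply: (proj1 (hP k)).
- by move=> n b psi Ab Rb; apply: functional_extensionality => k; apply: (proj2 (hP k)).
Qed.

Definition to_cofree (G : Fun (sop D) sSet) (f : Hom sSet (fob G d0) Y) :
  Hom (Fun (sop D) sSet) G cofree.
Proof.
refine (@NatTrans (sop D) sSet G cofree (fun d => @mk_shom (fob G d) (fob cofree d)
  (fun n x (k : Hom D d0 d) => sapp f (sapp (dact G k) x)) _) _).
- move=> d d' a; apply: shom_eq => n x; apply: functional_extensionality => k /=.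
  by rewrite dact_comp.
Unshelve.
- by move=> m n t x; apply: functional_extensionality => k; rewrite !sapp_nat.
Defined.

End Cofree.

Definition rep (D : small_category) (c0 : sOb D) : Fun (sop D) sSet.
Proof.
refine (@Functor (sop D) sSet (fun d => sdisc (Hom D d c0))
  (fun d d' (a : Hom D d' d) => sdisc_map (fun f : Hom D d c0 => f ∘ a)) _ _).
- by move=> d; apply: shom_eq => n f /=; rewrite compm_idr.
- by move=> d d' d'' a' a; apply: shom_eq => n f /=; rewrite compmA.
Defined.

(** If a were outside the image, two maps to a discrete simplicial set that differ
    only at a would agree after composition with f. *)
Lemma weq_disc_onto (X : sSet) (A : small) (f : Hom sSet X (sdisc A)) (a : A) :
  weak_homotopy_equivalence f -> exists x : simp X 0, sapp f x = a.
Proof.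
move=> fW; apply: NNPP => nx.
pose v : Hom sSet (sdisc A) (sdisc bool) := sdisc_map (fun _ => true).
pose w : Hom sSet (sdisc A) (sdisc bool) :=
  sdisc_map (fun a' => if excluded_middle_informative (a' = a) then false else true).
have e : v ∘ f = w ∘ f.
  apply: shom_eq => n x /=; case: excluded_middle_informative => // fx.
  case: nx; exists (sact (vtx ord0 0 : mono_map 0 n) x).
  by rewrite sapp_disc_sact.
have [_ /(_ v w) [|h hP]] := fW _ (@sdisc_kan bool).
  by rewrite e; exists (w ∘ f ∘ sprod_fst X (std 1)) => n x.
have [h0 h1] := hP 0 (a : simp (sdisc A) 0).
have := etrans (etrans (esym h0) (disc_homotopy_const h _ _ _)) h1.
by rewrite /=; case: excluded_middle_informative.
Qed.

Definition cyl_ends (B : sSet) : spred (cyl B) := fun n c =>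
  exists i : bool, (c.2 : mono_map n 1) = vtx (endpt i) n.

Lemma cyl_ends_closed B : pred_closed (@cyl_ends B).
Proof. by move=> m n t c [i h]; exists i; apply: cyl_vtx. Qed.

(** The homotopies from a to b inside Psi.  Only the ends are constrained, so this
    relation is known to be closed under the action on [cyl_ends] only. *)
Definition htpy (B X : sSet) (Psi : srel (cyl B) X) (a b : Hom sSet B X) :
  srel (cyl B) X := fun n c x => Psi n c x /\
  forall i : bool, (c.2 : mono_map n 1) = vtx (endpt i) n ->
    x = sapp (if i then b else a) c.1.

Section Htpy.

Variables (B X : sSet) (Psi : srel (cyl B) X) (a b : Hom sSet B X).
Hypothesis cP : rel_closed Psi.

Lemma htpy_closed m n (t : mono_map m n) (c : simp (cyl B) n) x : cyl_ends c ->
  htpy Psi a b c x -> htpy Psi a b (sact t c) (sact t x).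
Proof.
move=> [i ci] [Px Hx]; split=> [|j]; first exact: cP.
rewrite (cyl_vtx t ci) => /vtx_neq <-.
by rewrite (Hx i ci) -sapp_nat.
Qed.

Lemma htpy_fun n (c : simp (cyl B) n) x x' :
  cyl_ends c -> htpy Psi a b c x -> htpy Psi a b c x' -> x = x'.
Proof. by move=> [i ci] [_ h] [_ h']; rewrite (h i ci) (h' i ci). Qed.

Hypothesis aP : forall n y, @Psi n (y, vtx (endpt false) n) (sapp a y).
Hypothesis bP : forall n y, @Psi n (y, vtx (endpt true) n) (sapp b y).

Lemma htpy_ex n (c : simp (cyl B) n) : cyl_ends c -> exists x, htpy Psi a b c x.
Proof.
case: c => y u [i /= ->]; exists (sapp (if i then b else a) y); split.
  by case: i.
by move=> j /= /vtx_neq <-.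
Qed.

End Htpy.

(** The section s of theta is given by its vertices, the other simplices of the
    representable diagram being degenerate. *)
Section Contract.

Variables (D : small_category) (G : Fun (sop D) sSet) (c0 : sOb D).
Variable th : Hom (Fun (sop D) sSet) G (rep c0).
Hypothesis thW : forall d, weak_homotopy_equivalence (nt th d).
Variable s : forall d, Hom D d c0 -> simp (fob G d) 0.
Hypothesis sN : forall d d' (a : Hom D d' d) f, s (f ∘ a) = sapp (dact G a) (s f).
Hypothesis sP : forall d (f : Hom D d c0), sapp (nt th d) (s f) = f.

(** Prisms open at either end are attached.  This class of fillers is inherited by
    path objects, by [cyl_fill] alone, and it still yields Kan complexes. *)
Definition prism_cell (j : bool * nat) : sSet := prism j.2.
Definition prism_bdry (j : bool * nat) : spred (prism_cell j) := @open_prism j.1 j.2.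
Lemma prism_bdry_closed j : pred_closed (@prism_bdry j).
Proof. exact: open_prism_closed. Qed.

Let H := completion G prism_bdry_closed.
Let inc := completion_in G prism_bdry_closed.

Lemma H_prism d e n : fills (@open_prism e n) (rel_all (prism n) (fob H d)).
Proof. exact: (@completion_fills D G _ _ _ prism_bdry_closed d (e, n)). Qed.

Lemma H_kan d : kan_complex (fob H d).
Proof. by apply: kan_of_prisms => e n; apply: H_prism. Qed.

Lemma lift_kan (K : Fun (sop D) sSet) (u : Hom (Fun (sop D) sSet) G K) :
  (forall d, kan_complex (fob K d)) ->
  exists h : Hom (Fun (sop D) sSet) H K,
    forall d n (x : simp (fob G d) n), sapp (nt h d) (sapp (nt inc d) x) =
        sapp (nt u d) x.
Proof.
move=> kK.
have [|||h [_ hP]] := @completion_lift D G _ _ _ prism_bdry_closed K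
    (fun d => rel_all _ _) _ _ u _ => //.
- by move=> d [e n] b; apply: (@kan_complex_prism e n _ (kK d)).
- by exists h.
Qed.

(** The union of (open prism) x I and (prism) x {0, 1} becomes an open cylinder
    once the two copies of I are exchanged. *)
Lemma completion_cyl_fills d e k :
  fills (fun n (c : simp (cyl (prism k)) n) => @open_prism e k n c.1 \/ cyl_ends c)
    (rel_all (cyl (prism k)) (fob H d)).
Proof.
pose sw : Hom sSet (cyl (prism k)) (cyl (prism k)) :=
  @mk_shom (cyl (prism k)) (cyl (prism k)) (fun n c => ((c.1.1, c.2), c.1.2))
      (fun _ _ _ _ => erefl).
pose A' : spred (prism k) := fun n c => non_onto (c.1 : mono_map n k) \/ cyl_ends c.
apply: (@fills_iso _ _ _ sw sw _ (open_cyl e A')).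
- by move=> n [[x u] w].
- move=> n [[x u] w]; split.
  + by case=> [[h|h]|h]; [left; left|right|left; right].
  + by case=> [[h|h]|h]; [left; left|right|left; right].
have cA : pred_closed A'.
  move=> m n t c [[i iP]|h]; [left; exists i => j; exact: iP|right;
      exact: cyl_ends_closed].
have := @cyl_fill e (prism k) (fob H d) (rel_all _ _) A' cA.
by apply=> n b; apply: H_prism.
Qed.

Lemma htpy_prism_fills d (a b : Hom sSet (fob H d) (fob H d)) e k
  (f : Hom sSet (prism k) (fob H d)) :
  fills (@open_prism e k) (rel_pre f (path_rel (htpy (rel_all _ _) a b))).
Proof.
apply: fills_path_pre.
apply: (@path_fills _ _ _ (@cyl_ends (prism k))
    (rel_pre (cyl_map f) (htpy (rel_all _ _) a b))).
- move=> m n t c x ci; rewrite /rel_pre sapp_nat; apply: htpy_closed => //.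
- exact: open_prism_closed.
- exact: cyl_ends_closed.
- by move=> n c x x' ci; apply: htpy_fun.
- by move=> n c ci; apply: htpy_ex.
- apply: (@fills_weaken _ _ _ (rel_all _ _)); first exact: completion_cyl_fills.
    by [].
  by move=> n c x nA _; split=> // i ci; case: nA; right; exists i.
Qed.

(** The homotopy on G(d) provided by the weak equivalence theta extends to H(d).
    The lifting property of G -> H concerns diagrams; it applies at the single
    object d because the path object of H(d) is made into a cofree diagram. *)
Lemma completion_contract (th' : Hom (Fun (sop D) sSet) H (rep c0)) d :
  (forall d n (x : simp (fob G d) n), sapp (nt th' d) (sapp (nt inc d) x) =
      sapp (nt th d) x) ->
  exists v : Hom sSet (fob (rep c0) d) (fob H d),
    (forall n (f : simp (fob (rep c0) d) n), sapp (nt th' d) (sapp v f) = f) /\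
  exists M : Hom sSet (cyl (fob H d)) (fob H d),
    forall n (x : simp (fob H d) n),
      sapp M (spair x (vtx ord0 n : simp (std 1) n)) = sapp v (sapp (nt th' d) x) /\
      sapp M (spair x (vtx ord_max n : simp (std 1) n)) = x.
Proof.
move=> th'I.
have [v [M MP]] := proj1 (@thW d _ (@H_kan d)) (nt inc d).
exists v; split.
  move=> n f.
  have fE : sapp (nt th d) (sact (vtx ord0 n : mono_map n 0) (s (f : Hom D d c0))) = f.
    by rewrite sapp_disc_sact sP.
  have [M0 M1] := MP n (sact (vtx ord0 n : mono_map n 0) (s (f : Hom D d c0))).
  set x := sact _ _ in fE M0 M1.
  have E := disc_homotopy_const (nt th' d ∘ M) x (vtx ord0 n : simp (std 1) n)
    (vtx ord_max n : simp (std 1) n).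
  have : sapp (nt th' d) (sapp v (sapp (nt th d) x)) =
      sapp (nt th' d) (sapp (nt inc d) x).
    exact: (etrans (etrans (congr1 (@sapp _ _ (nt th' d) n) (esym M0)) E)
      (congr1 (@sapp _ _ (nt th' d) n) M1)).
  by rewrite th'I fE.
pose P := @cofree D d (ihom (std 1) (fob H d)).
pose Hr := path_rel (htpy (rel_all _ _) (v ∘ nt th' d) (idm sSet (fob H d))).
have [|||h [hP _]] := @completion_lift D G _ _ _ prism_bdry_closed P
  (fun d' n x psi => forall k : Hom D d d', Hr n (sapp (dact H k) x) (psi k)) _ _
  (@to_cofree D d (ihom (std 1) (fob H d)) G (curry M)) _.
- move=> d' d'' a n x psi hx k.
  by rewrite -dact_comp; apply: (hx (a ∘ k)).
- move=> d' [e k] b.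
  have := @fills_cofree D d (ihom (std 1) (fob H d)) d' (prism k) (@open_prism e k)
    (fun k' => rel_pre (dact H k' ∘ b) Hr).
  by apply=> k'; apply: htpy_prism_fills.
- move=> d' n x k m t u; rewrite -(dact_nat inc).
  rewrite -[path_at _ _ _]/(sapp M (spair (sact t (sapp (dact G k) x))
      (u : simp (std 1) m))).
  split=> // i ui; have {}ui : u = vtx (endpt i) m by []; rewrite ui.
  rewrite -[RHS]/(sapp (if i then idm sSet (fob H d) else v ∘ nt th' d)
    (sact t (sapp (nt inc d) (sapp (dact G k) x)))) -(sapp_nat (nt inc d)).
  have [M0 M1] := MP m (sact t (sapp (dact G k) x)).
  case: i ui => _; first exact: M1.
  apply: etrans M0 _; exact: (congr1 (@sapp _ _ v m) (esym (th'I _ _ _))).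
have kP n (x : simp (fob H d) n) m (t : mono_map m n) (u : mono_map m 1) :
   htpy (rel_all _ _) (v ∘ nt th' d) (idm sSet (fob H d)) (sact t x, u : simp (std 1) m)
     (path_at (sapp (nt h d) x (idm D d)) u t).
  by have := hP d n x (idm D d) m t u; rewrite dact_id.
have kN m n (t : mono_map m n) (x : simp (fob H d) n) :
   sapp (nt h d) (sact t x) (idm D d) = sact t (sapp (nt h d) x (idm D d)).
  by rewrite sapp_nat.
pose kap : Hom sSet (fob H d) (ihom (std 1) (fob H d)) :=
  @mk_shom (fob H d) (ihom (std 1) (fob H d)) (fun n x => sapp (nt h d) x (idm D d)) kN.
exists (uncurry kap) => n x.
have [_ k0] := kP n x n (mono_id n) (vtx ord0 n).
have [_ k1] := kP n x n (mono_id n) (vtx ord_max n).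
split; first exact: (etrans (k0 false erefl)
  (congr1 (fun y : simp (fob H d) n => sapp v (sapp (nt th' d) y)) (sact_id x))).
exact: (etrans (k1 true erefl) (sact_id x)).
Qed.

(** A partial lift is moved along the contraction M into the image of v, where it
    extends, and the homotopy is extended backwards.  The extension remains in the
    right fibre because the base is discrete. *)
Lemma completion_acyclic (th' : Hom (Fun (sop D) sSet) H (rep c0)) d :
  (forall d n (x : simp (fob G d) n), sapp (nt th' d) (sapp (nt inc d) x) =
      sapp (nt th d) x) ->
  acyclic (nt th' d).
Proof.
move=> th'I; have [v [vP [M MP]]] := completion_contract d th'I.
move=> B A v0 cA R cR fR sR HA.
have M0 n (x : simp (fob H d) n) (u : mono_map n 1) : at_end false u ->
  sapp M (spair x (u : simp (std 1) n)) = sapp v (sapp (nt th' d) x).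
  by move=> /at_end_vtx ->; apply: (proj1 (MP n x)).
have [||||h [_ hP]] := @cyl_fill false B (fob H d) (rel_all _ _) A cA
  (fun n b => @H_prism d false n) (fun n (c : simp (cyl B) n) z =>
    (exists x, [/\ A n c.1, R n c.1 x & z = sapp M (spair x c.2)]) \/
    (at_end false (c.2 : mono_map n 1) /\ z = sapp v (sapp v0 c.1))) => //.
- move=> m n t c z [[x [Ac Rx ->]]|[c0' ->]].
    by left; exists (sact t x); rewrite -sapp_nat; split; [apply: cA|apply: cR|].
  by right; rewrite -!sapp_nat; split=> // j; apply: c0'.
- move=> n c z z' [[x [Ac Rx ->]]|[h ->]] [[x' [Ac' Rx' ->]]|[h' ->]] //.
  + by rewrite (fR _ _ _ _ Rx Rx').
  + by rewrite M0 // (sR _ _ _ Rx).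
  + by rewrite M0 // (sR _ _ _ Rx').
- move=> n c [Ac|h]; last by exists (sapp v (sapp v0 c.1)); right.
  by have [x Rx] := HA _ _ Ac; exists (sapp M (spair x c.2)); left; exists x.
have kN m n (t : mono_map m n) (b : simp B n) :
   sapp h (spair (sact t b) (vtx ord_max m : simp (std 1) m)) =
   sact t (sapp h (spair b (vtx ord_max n : simp (std 1) n))).
  by rewrite -sapp_nat.
exists (@mk_shom B (fob H d) (fun n b => sapp h
    (spair b (vtx ord_max n : simp (std 1) n))) kN).
split=> [n b|n b x Ab Rx].
- have e1 := disc_homotopy_const (nt th' d ∘ h) b (vtx ord_max n : simp (std 1) n)
    (vtx ord0 n : simp (std 1) n).
  have e0 : sapp h (spair b (vtx ord0 n : simp (std 1) n)) = sapp v (sapp v0 b).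
    by apply: hP; [right|right].
  exact: (etrans e1 (etrans (congr1 (@sapp _ _ (nt th' d) n) e0) (vP _ _))).
- have h1 := hP n (spair b (vtx ord_max n : simp (std 1) n))
    (sapp M (spair x (vtx ord_max n : simp (std 1) n))).
  rewrite -[LHS]/(sapp h (spair b (vtx ord_max n : simp (std 1) n))) h1.
  + exact: (proj2 (MP n x)).
  + by left.
  + by left; exists x.
Qed.

(** Two natural lifts of theta to the acyclic diagram H are homotopic; the
    homotopy between the inclusion and its composite with s theta is pushed
    forward along the extension u' of u. *)
Lemma projective_htpy (K : Fun (sop D) sSet) (u : Hom (Fun (sop D) sSet) G K) :
  projective G -> (forall d, kan_complex (fob K d)) ->
  exists h : forall d, Hom sSet (cyl (fob G d)) (fob K d),
   [/\ forall d n (x : simp (fob G d) n),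
       sapp (h d) (spair x (vtx ord0 n : simp (std 1) n)) =
         sapp (nt u d) (sdeg n (s (sapp (nt th d) x))),
       forall d n (x : simp (fob G d) n),
           sapp (h d) (spair x (vtx ord_max n : simp (std 1) n)) =
         sapp (nt u d) x &
       forall d d' (a : Hom D d' d) n (c : simp (cyl (fob G d)) n),
        sapp (h d') (sapp (cyl_map (dact G a)) c) = sapp (dact K a) (sapp (h d) c)].
Proof.
move=> pG kK.
have [th' th'I] := lift_kan th (fun d => @sdisc_kan (Hom D d c0)).
have [u' u'I] := lift_kan u kK.
have sgN d m n (t : mono_map m n) (x : simp (fob G d) n) :
  sapp (nt inc d) (sdeg m (s (sapp (nt th d) (sact t x)))) =
  sact t (sapp (nt inc d) (sdeg n (s (sapp (nt th d) x)))).
  by rewrite -sapp_nat sact_sdeg sapp_disc_sact.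
pose sg d : Hom sSet (fob G d) (fob H d) := @mk_shom (fob G d) (fob H d)
  (fun n x => sapp (nt inc d) (sdeg n (s (sapp (nt th d) x)))) (sgN d).
have sD d d' (a : Hom D d' d) n (x : simp (fob G d) n) :
  sdeg n (s (sapp (nt th d') (sapp (dact G a) x))) =
  sapp (dact G a) (sdeg n (s (sapp (nt th d) x))).
  by rewrite dact_nat sapp_sdeg -sN.
pose Psi d := htpy (over (nt th' d) (nt th d ∘ sprod_fst (fob G d) (std 1))) (sg d)
    (nt inc d).
have aP d n (y : simp (fob G d) n) :
  over (nt th' d) (nt th d ∘ sprod_fst (fob G d) (std 1))
      (y, vtx (endpt false) n : simp (std 1) n) (sapp (sg d) y).
  by rewrite /over /= th'I sapp_disc_sact sP.
have bP d n (y : simp (fob G d) n) :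
  over (nt th' d) (nt th d ∘ sprod_fst (fob G d) (std 1))
      (y, vtx (endpt true) n : simp (std 1) n) (sapp (nt inc d) y).
  by rewrite /over /= th'I.
have [||||||h [hP hN]] := @projective_cyl D G H (fun d => @cyl_ends (fob G d)) Psi pG.
- by move=> d m n t c x; apply: htpy_closed; apply: over_closed.
- by move=> d; apply: cyl_ends_closed.
- move=> d d' a n c x [h1 h2]; split.
    rewrite /over dact_nat h1 /=; exact: esym (dact_nat th a _).
  move=> i /= ci; rewrite (h2 i ci) /=.
  case: i ci => ci; first exact: esym (dact_nat inc a c.1).
  exact: (etrans (esym (dact_nat inc a _))
      (congr1 (@sapp _ _ (nt inc d') n) (esym (sD _ _ a n c.1)))).
- by move=> d n c x x'; apply: htpy_fun.
- by move=> d n c; apply: htpy_ex.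
- move=> d B A b cA.
  apply: (@fills_weaken _ _ _ (over (nt th' d) (nt th d ∘ sprod_fst (fob G d) (std 1) ∘
      cyl_map b))).
  + apply: (completion_acyclic (d := d) th'I (B := cyl B)
      (A := fun n c => A n c.1 \/ cyl_ends (sapp (cyl_map b) c))) => m n t c [Ac|Qc];
          [left|right].
      exact: cA.
    by rewrite sapp_nat; apply: cyl_ends_closed.
  + by move=> n c x [].
  + by move=> n c x nA ov; split=> // i ci; case: nA; right; exists i.
exists (fun d => nt u' d ∘ h d); split.
- move=> d n x; have [_ /(_ false erefl) e] :=
    hP d n (spair x (vtx ord0 n : simp (std 1) n)).
  exact: (etrans (congr1 (@sapp _ _ (nt u' d) n) e) (u'I d n _)).
- move=> d n x; have [_ /(_ true erefl) e] :=
    hP d n (spair x (vtx ord_max n : simp (std 1) n)).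
  exact: (etrans (congr1 (@sapp _ _ (nt u' d) n) e) (u'I d n _)).
- move=> d d' a n c.
  exact: (etrans (congr1 (@sapp _ _ (nt u' d') n) (hN d d' a n c)) (dact_nat u' a _)).
Qed.

End Contract.

(** * Model categories and mapping spaces *)

Section Model.
Variables (S : category) (M : model_structure S).

(** Such a map is a retract of the first factor of its factorization. *)
Lemma lift_fib_weq (A B : S) (i : Hom S A B) :
  (forall X Y (p : Hom S X Y), fib M p -> has_lift i p) -> weq M i.
Proof.
move=> iL; pose ff := mod_fac_fib M.
have [lc lw] := ff_lP ff i.
have e : ff_r ff i ∘ ff_l ff i = idm S B ∘ i by rewrite ff_fac compm_idl.
have [h [h1 h2]] := iL _ _ _ (ff_rP ff i) _ _ e.
have R : is_retract i (ff_l ff i).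
  exists (idm S A), (idm S A), h, (ff_r ff i).
  by split; rewrite ?compm_idl ?compm_idr // ff_fac.
by have [w _ _] := mod_retract M R; apply: w.
Qed.

Lemma weq_id (A : S) : weq M (idm S A).
Proof.
apply: lift_fib_weq => X Y p _ u v e.
by exists u; rewrite compm_idr; split=> //; rewrite e compm_idr.
Qed.

(** Here g is a retract of s g. *)
Lemma weq_section (A B : S) (g : Hom S A B) (s : Hom S B A) :
  g ∘ s = idm S B -> weq M (s ∘ g) -> weq M g.
Proof.
move=> gs; have R : is_retract g (s ∘ g).
  exists (idm S A), (idm S A), s, g.
  by split; rewrite ?compm_idl ?compm_idr // compmA gs compm_idl.
by have [w _ _] := mod_retract M R.
Qed.

End Model.

Lemma has_initial (S : category) : cocomplete S -> exists o : S, is_initial o.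
Proof.
move=> cS; pose o := coprod cS (fun v : void => match v with end : S); exists o.
move=> y; pose f : Hom S o y := cp_desc o (fun v : void => match v with end).
exists f; split=> // g _; apply/esym; apply: cp_uniq; by case.
Qed.

Lemma initial_eq (S : category) (o y : S) (f g : Hom S o y) : is_initial o -> f = g.
Proof. by move=> oI; have [h [_ hP]] := oI y; rewrite -(hP f) // -(hP g). Qed.

Section Simplicial.
Variables (S : category) (E : simplicial_structure S) (T : tensor_structure E).

Lemma sdeg0 (X : sSet) (x : simp X 0) : sdeg 0 x = x.
Proof.
rewrite -[RHS](@sact_id X 0); congr sact.
by apply: mono_map_eq => j; rewrite [j]ord1; apply: val_inj.
Qed.

Lemma vert_post (A X Y : S) (p : Hom S X Y) (f : Hom S A X) :
  vert E (p ∘ f) = sapp (Map_post E A p) (vert E f).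
Proof. by rewrite vert_comp /= sdeg0. Qed.

Lemma vert_pre (A B X : S) (i : Hom S A B) (f : Hom S B X) :
  vert E (f ∘ i) = sapp (Map_pre E X i) (vert E f).
Proof. by rewrite vert_comp /= sdeg0. Qed.

Lemma sdeg_mcomp (X Y Z : S) n (g : simp (Map E Y Z) 0) (f : simp (Map E X Y) 0) :
  sdeg n (sapp (mcomp E X Y Z) (spair g f)) =
  sapp (mcomp E X Y Z) (spair (sdeg n g) (sdeg n f)).
Proof. exact: esym (sapp_sdeg (mcomp E X Y Z) n (spair g f)). Qed.

Lemma Map_post_comp (A X Y Z : S) (q : Hom S Y Z) (p : Hom S X Y) :
  Map_post E A (q ∘ p) = Map_post E A q ∘ Map_post E A p.
Proof. by apply: shom_eq => n f; rewrite /= vert_comp sdeg_mcomp mcompA. Qed.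

Lemma Map_pre_comp (A B C X : S) (j : Hom S B C) (i : Hom S A B) :
  Map_pre E X (j ∘ i) = Map_pre E X i ∘ Map_pre E X j.
Proof. by apply: shom_eq => n f; rewrite /= vert_comp sdeg_mcomp -mcompA. Qed.

Lemma Map_pre_post (A B X Y : S) (i : Hom S A B) (p : Hom S X Y) :
  Map_pre E Y i ∘ Map_post E B p = Map_post E A p ∘ Map_pre E X i.
Proof. by apply: shom_eq => n f; rewrite /= mcompA. Qed.

(** The cotensor turns simplices of Map(o, Z), and more generally maps from K to
    it, into morphisms out of the initial object o. *)
Lemma Map_initial_eq (o Z : S) (K : sSet) (f g : Hom sSet K (Map E o Z)) :
  is_initial o -> f = g.
Proof.
move=> oI.
pose tr (f : Hom sSet K (Map E o Z)) : simp (ihom K (Map E o Z)) 0 :=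
    f ∘ sprod_fst K (std 0).
have trK f' : (tr f' : Hom sSet (sprod K (std 0)) (Map E o Z)) ∘ sprod_pt K = f'.
  by apply: shom_eq.
have isoK h : sapp (iso_to (cotensor_iso T K o Z))
    (sapp (iso_from (cotensor_iso T K o Z)) h) = h.
  exact: (congr1 (fun k : Hom sSet _ _ => sapp k h) (iso_to_from (cotensor_iso T K o Z))).
have e : sapp (iso_from (cotensor_iso T K o Z)) (tr f) =
         sapp (iso_from (cotensor_iso T K o Z)) (tr g).
  by rewrite -[LHS]unvertK -[RHS]unvertK; congr vert; apply: initial_eq.
have {}e : tr f = tr g by rewrite -(isoK _ (tr f)) -(isoK _ (tr g)) e.
by rewrite -(trK f) -(trK g) e.
Qed.

Lemma Map_initial_ex (o Z : S) (K : sSet) : is_initial o ->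
    exists f : Hom sSet K (Map E o Z), True.
Proof.
move=> oI; have [h _] := oI (fob (cotensor T) (K, Z)).
by exists ((sapp (iso_to (cotensor_iso T K o Z)) (vert E h) :
  Hom sSet (sprod K (std 0)) (Map E o Z)) ∘ sprod_pt K).
Qed.

Lemma Map_terminal_eq (Y e : S) (K : sSet) (f g : Hom sSet K (Map E Y e)) :
  is_initial (C := op S) e -> f = g.
Proof.
move=> eT; rewrite -(@unadjK S E T K Y e f) -(@unadjK S E T K Y e g); congr adj.
exact: (@initial_eq (op S)).
Qed.

Lemma Map_terminal_ex (Y e : S) (K : sSet) :
  is_initial (C := op S) e -> exists f : Hom sSet K (Map E Y e), True.
Proof.
by move=> eT; have [h _] := eT (tensor T (K, Y));
    exists (adj (h : Hom S (tensor T (K, Y)) e)).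
Qed.

End Simplicial.

Section SM7.

Variable S : simplicial_model_category.
Local Notation E := (smc_simp S).
Local Notation M := (smc_mod S).
Local Notation T := (smc_tens S).

(** For i : o -> Y with o initial, the target of the pullback-hom of SM7 is
    Map(Y, W), so that SM7 speaks about composition with p. *)
Section Post.
Variables (o Y X W : S) (i : Hom S o Y) (p : Hom S X W).
Hypothesis oI : is_initial o.

Let pb : sSet := spullback (Map_post E o p) (Map_pre E W i).
Let pr2 : Hom sSet pb (Map E Y W) :=
  @mk_shom pb (Map E Y W) (fun n x => (sval x).2) (fun _ _ _ _ => erefl).
Let pr1 : Hom sSet pb (Map E o X) :=
  @mk_shom pb (Map E o X) (fun n x => (sval x).1) (fun _ _ _ _ => erefl).

Lemma pb_eq (K : sSet) (a b : Hom sSet K pb) : pr2 ∘ a = pr2 ∘ b -> a = b.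
Proof.
move=> e; apply: shom_eq => n x; apply: sig_eq.
have e1 : pr1 ∘ a = pr1 ∘ b by apply: (Map_initial_eq T).
have := congr1 (fun f => sapp f x) e; have := congr1 (fun f => sapp f x) e1.
rewrite /=; case: (sval (nt a n x)) => [a1 a2]; case: (sval (nt b n x)) => [b1 b2] /=.
by move=> -> ->.
Qed.

Lemma pb_ex (K : sSet) (v : Hom sSet K (Map E Y W)) : exists a : Hom sSet K pb,
    pr2 ∘ a = v.
Proof.
have [w _] := Map_initial_ex T X K oI.
have e : Map_post E o p ∘ w = Map_pre E W i ∘ v by apply: (Map_initial_eq T).
pose a n (x : simp K n) : simp pb n :=
  exist (fun q : simp (Map E o X) n * simp (Map E Y W) n =>
    sapp (Map_post E o p) q.1 = sapp (Map_pre E W i) q.2)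
   (sapp w x, sapp v x) (congr1 (fun f : Hom sSet K (Map E o W) => sapp f x) e).
have aN m n (t : mono_map m n) (x : simp K n) : a m (sact t x) = sact t (a n x).
  by apply: sig_eq; rewrite /= !sapp_nat.
by exists (@mk_shom K pb a aN); apply: shom_eq.
Qed.

Lemma pb_post : pr2 ∘ pullback_hom E i p = Map_post E Y p.
Proof. exact: shom_eq. Qed.

Lemma Map_post_kan : cof M i -> fib M p -> kan_fibration (Map_post E Y p).
Proof.
move=> ci fp n k n0 u v e.
have [v' v'P] := pb_ex v.
have [|h [h1 h2]] := proj1 (smc_SM7 ci fp) n k n0 u v'.
  by apply: pb_eq; rewrite !compmA pb_post v'P.
by exists h; split=> //; rewrite -pb_post -compmA h2.
Qed.

Lemma Map_post_weq : cof M i -> fib M p -> weq M p ->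
  weak_homotopy_equivalence (Map_post E Y p).
Proof.
move=> ci fp wp K kK.
have [q qP] := pb_ex (idm sSet _).
have qP' : q ∘ pr2 = idm sSet pb by apply: pb_eq; rewrite compmA qP compm_idl compm_idr.
have [h1 h2] := proj2 (smc_SM7 ci fp) (or_intror wp) K kK.
split.
- move=> u; have [v vP] := h1 u; exists (v ∘ q).
  by rewrite -pb_post -compmA (compmA q) qP' compm_idl.
- move=> v w; rewrite -pb_post !compmA => /h2 [H HP].
  exists (H ∘ sprod_map q (idm sSet (std 1))) => n x.
  have [e0 e1] := HP n (sapp q x).
  have qx : sapp pr2 (sapp q x) = x by apply: (congr1 (fun f => sapp f x) qP).
  split; [apply: etrans e0 _|apply: etrans e1 _].
    exact: (congr1 (@sapp _ _ v n) qx).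
  exact: (congr1 (@sapp _ _ w n) qx).
Qed.

End Post.

(** Apply [Map_post_kan] to Z -> e, where Map(Y, e) is a point. *)
Lemma Map_kan (Y Z e : S) (p : Hom S Z e) : is_initial (C := op S) e ->
  cofibrant M Y -> fib M p -> kan_complex (Map E Y Z).
Proof.
move=> eT [o [i [oI ci]]] fp n k u n0.
have [v _] := Map_terminal_ex T Y (std n) eT.
have [|h [h1 _]] := Map_post_kan oI ci fp n0 (u := u) (v := v).
  exact: (Map_terminal_eq T).
by exists h.
Qed.

End SM7.

(** * The tensor product over D and its right adjoint *)

Section OverAdj.

Variables (S : category) (cS : cocomplete S) (E : simplicial_structure S).
Variables (T : tensor_structure E) (D C : small_category).
Variables (X : Fun (sprodc (sop D) C) sSet) (Y : Fun D S).

(** The component at d of the transpose of g : the natural maps X(d, c) -> Map(Y d, Z). *)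
Definition over_adj (c : sOb C) (Z : S) (g : Hom S (over_ob cS T X Y c) Z) (d : sOb D) :
  Hom sSet (fob X (d, c)) (Map E (fob Y d) Z) := adj (g ∘ over_in cS T X Y c d).

Lemma over_adj_nat c Z (g : Hom S (over_ob cS T X Y c) Z) (b b' : sOb D)
    (u : Hom D b b') :
  over_adj g b ∘ act_l X u c = Map_pre E Z (fmap Y u) ∘ over_adj g b'.
Proof.
rewrite /over_adj -adj_tmap_l -compmA over_in_balanced compmA adj_tmap_r.
by [].
Qed.

Lemma over_adj_inj c Z (g g' : Hom S (over_ob cS T X Y c) Z) :
  (forall d, over_adj g d = over_adj g' d) -> g = g'.
Proof. move=> e; apply: over_ext => d; apply: (can_inj (@adjK S E T _ _ _));
    exact: e. Qed.

Lemma over_adj_ex c Z (k : forall d : sOb D, Hom sSet (fob X (d, c))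
    (Map E (fob Y d) Z)) :
  (forall (b b' : sOb D) (u : Hom D b b'),
    k b ∘ act_l X u c = Map_pre E Z (fmap Y u) ∘ k b') ->
  exists g : Hom S (over_ob cS T X Y c) Z, forall d, over_adj g d = k d.
Proof.
move=> kN.
have bal : balanced (T := T) (X := X) (Y := Y) (c := c) (fun d => unadj T (k d)).
  move=> b b' u; apply: (can_inj (@adjK S E T _ _ _)).
  by rewrite adj_tmap_l adj_tmap_r !unadjK.
by exists (over_desc cS bal) => d; rewrite /over_adj over_fac unadjK.
Qed.

Lemma over_adj_post c Z Z' (p : Hom S Z Z') (g : Hom S (over_ob cS T X Y c) Z) d :
  over_adj (p ∘ g) d = Map_post E (fob Y d) p ∘ over_adj g d.
Proof. by rewrite /over_adj -compmA adj_post. Qed.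

Lemma over_adj_act c c' (h : Hom C c c') Z (g : Hom S (over_ob cS T X Y c') Z) d :
  over_adj (g ∘ over_act cS T X Y h) d = over_adj g d ∘ act_r X d h.
Proof. by rewrite /over_adj -compmA over_act_in compmA adj_tmap_l. Qed.

End OverAdj.

Lemma over_adj_map (S : category) (cS : cocomplete S) (E : simplicial_structure S)
  (T : tensor_structure E) (D C : small_category)
  (X X' : Fun (sprodc (sop D) C) sSet) (Y : Fun D S) c c'
  (k : forall a : sOb D, Hom sSet (fob X (a, c)) (fob X' (a, c')))
  (kP : forall (b b' : sOb D) (u : Hom D b b'), k b ∘ act_l X u c = act_l X' u c' ∘ k b')
  Z (g : Hom S (over_ob cS T X' Y c') Z) d :
  over_adj (g ∘ over_map cS T Y kP) d = over_adj g d ∘ k d.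
Proof. by rewrite /over_adj -compmA over_fac compmA adj_tmap_l. Qed.

Section MapDiagram.

Variables (S : category) (E : simplicial_structure S) (D C : small_category).

(** The right adjoint of the tensor product with Y. *)
Definition map_diagram (Y : Fun D S) (Z : Fun C S) : Fun (sprodc (sop D) C) sSet.
Proof.
refine (@Functor (sprodc (sop D) C) sSet (fun dc => Map E (fob Y dc.1) (fob Z dc.2))
  (fun dc dc' ak => Map_pre E (fob Z dc'.2) (@fmap D S Y dc'.1 dc.1 ak.1) ∘
     Map_post E (fob Y dc.1) (fmap Z ak.2)) _ _).
- move=> [d c].
  have e : Map_pre E (fob Z c) (fmap Y (idm D d)) ∘ Map_post E (fob Y d)
      (fmap Z (idm C c))
    = idm sSet (Map E (fob Y d) (fob Z c)).
    by rewrite !fmap_id Map_pre_id Map_post_id compm_idl.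
  exact: e.
- move=> [d c] [d' c'] [d'' c''] [a' k'] [a k].
  have e : Map_pre E (fob Z c'') (fmap Y ((a : Hom D d' d) ∘ (a' : Hom D d'' d'))) ∘
      Map_post E (fob Y d) (fmap Z ((k' : Hom C c' c'') ∘ (k : Hom C c c'))) =
    (Map_pre E (fob Z c'') (fmap Y (a' : Hom D d'' d')) ∘ Map_post E (fob Y d')
        (fmap Z k')) ∘
    (Map_pre E (fob Z c') (fmap Y (a : Hom D d' d)) ∘ Map_post E (fob Y d) (fmap Z k)).
    rewrite !fmap_comp Map_pre_comp Map_post_comp -!compmA; congr (_ ∘ _).
    by rewrite !compmA; congr (_ ∘ _); rewrite Map_pre_post.
  exact: e.
Defined.

Definition map_diagram_post (Y : Fun D S) (Z W : Fun C S) (p : Hom (Fun C S) Z W) :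
  Hom (Fun (sprodc (sop D) C) sSet) (map_diagram Y Z) (map_diagram Y W).
Proof.
refine (@NatTrans (sprodc (sop D) C) sSet (map_diagram Y Z) (map_diagram Y W)
  (fun dc => Map_post E (fob Y dc.1) (nt p dc.2)) _).
move=> [d c] [d' c'] [a k].
have e : Map_post E (fob Y d') (nt p c') ∘
    (Map_pre E (fob Z c') (fmap Y (a : Hom D d' d)) ∘ Map_post E (fob Y d) (fmap Z k)) =
  (Map_pre E (fob W c') (fmap Y (a : Hom D d' d)) ∘ Map_post E (fob Y d) (fmap W k)) ∘
  Map_post E (fob Y d) (nt p c).
  by rewrite compmA -Map_pre_post -!compmA -!Map_post_comp nt_nat.
exact: e.
Defined.

(** The right adjoint of the tensor product with Y at a fixed object c. *)
Definition map_slice (Y : Fun D S) (Z : S) : Fun (sop D) sSet.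
Proof.
refine (@Functor (sop D) sSet (fun d => Map E (fob Y d) Z)
  (fun d d' (a : Hom D d' d) => Map_pre E Z (fmap Y a)) _ _).
- by move=> d; rewrite -(Map_pre_id E (fob Y d) Z); congr Map_pre; exact: fmap_id.
- by move=> d d' d'' a' a; rewrite -Map_pre_comp; congr Map_pre; exact: fmap_comp.
Defined.

End MapDiagram.

Section Cofibrancy.

Variables (S : simplicial_model_category) (D C : small_category).
Local Notation cS := (mod_cocomplete (smc_mod S)).
Local Notation T := (smc_tens S).
Local Notation Es := (smc_simp S).

(** Lifting problems are transposed along the adjunction and solved for X. *)
Lemma tensor_over_cofibrant (P : sOb C -> Prop) (X : Fun (sprodc (sop D) C) sSet)
  (Y : Fun D S) :
  cofibrant (relative_model (C := sprodc (sop D) C) (fun dc => P (snd dc)) kan_quillen)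
      X ->
  (forall d, cofibrant (smc_mod S) (fob Y d)) ->
  cofibrant (relative_model P (smc_mod S)) (tensor_over cS T X Y).
Proof.
move=> [o' [f' [oI' f'C]]] Yc.
have [o oI] := has_initial cS.
pose O : Fun C S := @Functor C S (fun _ => o) (fun _ _ _ => idm S o)
  (fun _ => erefl) (fun _ _ _ _ _ => esym (compm_idl _)).
have OI : is_initial O.
  move=> Z; pose f c := proj1_sig (constructive_indefinite_description _ (oI (fob Z c))).
  have fN (c c' : sOb C) (u : Hom C c c') : f c' ∘ fmap O u = fmap Z u ∘ f c.
    exact: initial_eq.
  exists (@NatTrans C S O Z f fN); split=> // g _.
  by apply: nat_trans_eq => c; apply: initial_eq.
have [f _] := OI (tensor_over cS T X Y).
exists O, f; split; first exact: OI.
move=> Z W p pF pW u v e.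
pose va c d : Hom sSet (fob X (d, c)) (Map Es (fob Y d) (fob W c)) := over_adj (nt v c) d.
have vN d c d' c' (a : Hom D d' d) (k : Hom C c c') :
  va c' d' ∘ @fmap (sprodc (sop D) C) sSet X (d, c) (d', c') (a, k) =
  (Map_pre Es (fob W c') (fmap Y a) ∘ Map_post Es (fob Y d) (fmap W k)) ∘ va c d.
  have -> : @fmap (sprodc (sop D) C) sSet X (d, c) (d', c') (a, k) =
    act_r X d' k ∘ act_l X a c.
    rewrite /act_r /act_l -(@fmap_comp (sprodc (sop D) C) sSet X).
    by congr fmap; congr (_, _); rewrite /= ?compm_idl ?compm_idr.
  rewrite compmA -over_adj_act.
  have -> : nt v c' ∘ over_act cS T X Y k =
      fmap W k ∘ nt v c by apply: (@nt_nat C S _ _ v).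
  by rewrite over_adj_nat over_adj_post compmA.
pose V : Hom (Fun (sprodc (sop D) C) sSet) X (map_diagram Es Y W) :=
  @NatTrans (sprodc (sop D) C) sSet X (map_diagram Es Y W)
   (fun dc => match dc return Hom sSet (fob X dc) (Map Es (fob Y dc.1) (fob W dc.2)) with
     (d, c) => va c d end)
   (fun dc dc' => match dc, dc' return forall ak : Hom (sprodc (sop D) C) dc dc',
      match dc' return Hom sSet (fob X dc') (Map Es (fob Y dc'.1) (fob W dc'.2)) with
        (d, c) => va c d end ∘ fmap X ak = fmap (map_diagram Es Y W) ak ∘
      match dc return Hom sSet (fob X dc) (Map Es (fob Y dc.1) (fob W dc.2)) with
        (d, c) => va c d end with
     (d, c), (d', c') => fun ak => match ak with (a, k) => vN d c d' c' a k end end).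
have [|||h [_ hP]] := f'C _ _ (map_diagram_post Es Y p) _ _
   (proj1_sig (constructive_indefinite_description _ (oI' (map_diagram Es Y Z)))) V.
- move=> [d c] /= Pc; have [o2 [i2 [oI2 ci2]]] := Yc d.
  exact: Map_post_kan oI2 ci2 (pF _ Pc).
- move=> [d c] /= Pc; have [o2 [i2 [oI2 ci2]]] := Yc d.
  exact: Map_post_weq oI2 ci2 (pF _ Pc) (pW _ Pc).
- exact: initial_eq.
pose hh d c : Hom sSet (fob X (d, c)) (Map Es (fob Y d) (fob Z c)) := nt h (d, c).
have hN d c d' c' (a : Hom D d' d) (k : Hom C c c') :
  hh d' c' ∘ @fmap (sprodc (sop D) C) sSet X (d, c) (d', c') (a, k) =
  (Map_pre Es (fob Z c') (fmap Y a) ∘ Map_post Es (fob Y d) (fmap Z k)) ∘ hh d c.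
  exact: (@nt_nat _ _ _ _ h (d, c) (d', c') (a, k)).
have ex c : exists g : Hom S (over_ob cS T X Y c) (fob Z c),
    forall d, over_adj g d = hh d c.
  apply: over_adj_ex => b b' a.
  by rewrite /act_l hN fmap_id Map_post_id compm_idr.
pose g c := proj1_sig (constructive_indefinite_description _ (ex c)).
have gP c d : over_adj (g c) d = hh d c.
  by move: d; rewrite /g; case: constructive_indefinite_description.
have gN (c c' : sOb C) (k : Hom C c c') :
  g c' ∘ fmap (tensor_over cS T X Y) k = fmap Z k ∘ g c.
  apply: over_adj_inj => d; rewrite over_adj_act over_adj_post !gP.
  by rewrite /act_r hN fmap_id Map_pre_id compm_idl.
exists (@NatTrans C S (tensor_over cS T X Y) Z g gN); split; first exact: initial_eq.
apply: nat_trans_eq => c; apply: over_adj_inj => d.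
rewrite over_adj_post gP.
exact: (congr1 (fun k : nat_trans X (map_diagram Es Y W) => nt k (d, c)) hP).
Qed.

End Cofibrancy.

(** * The cylinder and the comparison map *)

Definition cyl_diagram (A : small_category) (X : Fun A sSet) : Fun A sSet.
Proof.
refine (@Functor A sSet (fun a => cyl (fob X a)) (fun a a' f => cyl_map (fmap X f)) _ _).
- by move=> a; rewrite fmap_id; apply: shom_eq => n [x u].
- by move=> a a' a'' g f; rewrite fmap_comp; apply: shom_eq => n [x u].
Defined.

Section Cylinder.

Variables (S : simplicial_model_category) (D C : small_category).
Local Notation cS := (mod_cocomplete (smc_mod S)).
Local Notation M := (smc_mod S).
Local Notation T := (smc_tens S).
Local Notation Es := (smc_simp S).
Variables (X : Fun (sprodc (sop D) C) sSet) (Y : Fun D S) (c : sOb C).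
Hypothesis Xp : projective (slice X c).
Hypothesis Yc : forall d, cofibrant M (fob Y d).

Let A : S := over_ob cS T X Y c.
Let Cy : S := over_ob cS T (cyl_diagram X) Y c.

Definition cyl_end (K : sSet) (i : bool) : Hom sSet K (cyl K) :=
  @mk_shom K (cyl K) (fun n x => spair x (vtx (endpt i) n : simp (std 1) n))
    (fun m n t x => congr1 (pair _) (esym (sact_vtx _ t))).

Lemma cyl_end_nat i (b b' : sOb D) (u : Hom D b b') :
  cyl_end (fob X (b, c)) i ∘ act_l X u c =
  act_l (cyl_diagram X) u c ∘ cyl_end (fob X (b', c)) i.
Proof. exact: shom_eq. Qed.

Definition incl i : Hom S A Cy :=
  @over_map S cS Es T D C X (cyl_diagram X) Y c c
    (fun a => cyl_end (fob X (a, c)) i) (cyl_end_nat i).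

Lemma proj_nat (b b' : sOb D) (u : Hom D b b') :
  (sprod_fst (fob X (b, c)) (std 1) : Hom sSet (fob (cyl_diagram X) (b, c)) _) ∘
    act_l (cyl_diagram X) u c = act_l X u c ∘ sprod_fst (fob X (b', c)) (std 1).
Proof. exact: shom_eq. Qed.

Definition proj : Hom S Cy A :=
  @over_map S cS Es T D C (cyl_diagram X) X Y c c
    (fun a => sprod_fst (fob X (a, c)) (std 1)) proj_nat.

Lemma proj_incl i : proj ∘ incl i = idm S A.
Proof.
apply: over_adj_inj => d; rewrite over_adj_map -[proj]compm_idl over_adj_map.
exact: shom_eq.
Qed.

Lemma cyl_desc Z (h : forall d, Hom sSet (cyl (fob X (d, c))) (Map Es (fob Y d) Z)) :
  (forall (d d' : sOb D) (a : Hom D d' d) n (x : simp (cyl (fob X (d, c))) n),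
    sapp (h d') (sapp (cyl_map (act_l X a c)) x) =
    sapp (Map_pre Es Z (fmap Y a)) (sapp (h d) x)) ->
  exists g : Hom S Cy Z,
    (forall d, over_adj g d = h d) /\
    forall i d, over_adj (g ∘ incl i) d = h d ∘ cyl_end (fob X (d, c)) i.
Proof.
move=> hN.
have [|g gP] := @over_adj_ex S cS Es T D C (cyl_diagram X) Y c Z h.
  by move=> b b' u; apply: shom_eq => n x; apply: hN.
by exists g; split=> // i d; rewrite over_adj_map gP.
Qed.

(** A lifting problem against a fibration p transposes to the extension of a
    homotopy from its value at 0, over the objectwise Kan fibrations
    Map(Y d, p); these are extended by [cyl_fill] and assembled naturally because
    X(-, c) is cofibrant. *)
Lemma incl0_weq : weq M (incl false).
Proof.
apply: lift_fib_weq => Z W p fp u v e.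
pose a d : Hom sSet (fob X (d, c)) (Map Es (fob Y d) Z) := over_adj u d.
pose b d : Hom sSet (cyl (fob X (d, c))) (Map Es (fob Y d) W) := over_adj v d.
have ab d n (x : simp (fob X (d, c)) n) (w : mono_map n 1) : at_end false w ->
  sapp (Map_post Es (fob Y d) p) (sapp (a d) x) =
      sapp (b d) (spair x (w : simp (std 1) n)).
  move=> /at_end_vtx ->.
  have := congr1 (fun g : Hom S A W => over_adj g d) e.
  rewrite over_adj_post over_adj_map => E.
  exact: (congr1 (fun g => sapp g x) E).
have [||||||h [hP hN]] := @projective_cyl D (slice X c) (map_slice Es Y Z)
  (fun d n cx => at_end false (cx.2 : mono_map n 1))
  (fun d n cx x => over (Map_post Es (fob Y d) p) (b d) cx x /\
     (at_end false (cx.2 : mono_map n 1) -> x = sapp (a d) cx.1)) Xp.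
- move=> d m n t [y w] x /= w0 [h1 h2]; split; first exact: (over_closed t h1).
  by rewrite (h2 w0) -sapp_nat.
- by move=> d m n t [y w] h j; apply: h.
- move=> d d' a' n [y w] x [h1 h2]; split.
    rewrite /over in h1 *.
    have N : b d' ∘ act_l (cyl_diagram X) a' c = Map_pre Es W (fmap Y a') ∘ b d.
      exact: over_adj_nat.
    have := congr1 (fun g : Hom sSet (cyl (fob X (d, c))) _ => sapp g (y, w)) N => N1.
    apply: etrans (esym N1); apply: etrans
        (congr1 (@sapp _ _ (Map_pre Es W (fmap Y a')) n) h1).
    exact: (congr1 (fun g : Hom sSet _ _ => sapp g x)
        (esym (Map_pre_post Es (fmap Y a') p))).
  move=> /= w0; rewrite (h2 w0).
  have N : a d' ∘ act_l X a' c = Map_pre Es Z (fmap Y a') ∘ a d by apply: over_adj_nat.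
  exact: (congr1 (fun g : Hom sSet _ _ => sapp g y) (esym N)).
- by move=> d n cx x x' h [_ h1] [_ h2]; rewrite h1 // h2.
- move=> d n [y w] h; exists (sapp (a d) y); split=> //; exact: ab.
- move=> d B A0 f cA.
  apply: (@fills_weaken _ _ _ (over (Map_post Es (fob Y d) p) (b d ∘ cyl_map f))).
  + have [o [i [oI ci]]] := Yc d.
    apply: (@cyl_fill false B _ (over (Map_post Es (fob Y d) p) (b d ∘ cyl_map f))
        A0) => //.
    move=> n y; apply: (@kan_prism n false _ _ (Map_post Es (fob Y d) p)
      (b d ∘ cyl_map f ∘ cyl_map (yoneda y))).
    exact: Map_post_kan oI ci fp.
  + by move=> n cx x [].
  + by move=> n cx x nA ov; split=> // w0; case: nA; right.
have [g [gP gI]] := cyl_desc hN.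
exists g; split; apply: over_adj_inj => d.
- rewrite gI; apply: shom_eq => n x.
  by apply: (proj2 (hP d n (spair x (vtx (endpt false) n : simp (std 1) n)))).
- rewrite over_adj_post gP; apply: shom_eq => n x; exact: (proj1 (hP d n x)).
Qed.

(** Both inclusions are sections of the projection, so one may be exchanged for the other. *)
Lemma incl_weq i : weq M (incl i).
Proof.
case: i; last exact: incl0_weq.
have [_ h _] := mod_2of3 M proj (incl false).
have pw : weq M proj by apply: h incl0_weq _; rewrite proj_incl; apply: weq_id.
have [_ _ h'] := mod_2of3 M proj (incl true).
by apply: h' pw _; rewrite proj_incl; apply: weq_id.
Qed.

End Cylinder.

Section Main.

Variables (C : small_category) (P : sOb C -> Prop).
Variables (X : Fun (sprodc (sop (full_sub P)) C) sSet)
  (theta : Hom (Fun (sprodc (sop (full_sub P)) C) sSet) X (mor_diagram P)).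
Hypothesis theta_approx : cofibrant_approximation
  (relative_model (C := sprodc (sop (full_sub P)) C) (fun dc => P (snd dc)) kan_quillen)
      theta.
Variable S : simplicial_model_category.
Local Notation cS := (mod_cocomplete (smc_mod S)).
Local Notation M := (smc_mod S).
Local Notation T := (smc_tens S).
Local Notation Es := (smc_simp S).
Local Notation D := (full_sub P).

Lemma slice_projective c : projective (slice X c).
Proof.
move=> X0 Phi h1 h2 h3.
exact: (cofibrant_section h1 h2 h3 (proj1 theta_approx)).
Qed.

Section At.
Variables (c : sOb C) (Pc : P c).
Let c0 : sOb D := exist _ c Pc.

Lemma theta_slice_nat (d d' : sOb D) (a : Hom (sop D) d d') :
  (nt theta (d', c) : Hom sSet (fob (slice X c) d') (fob (rep c0) d')) ∘ fmap
      (slice X c) a =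
  fmap (rep c0) a ∘ (nt theta (d, c) : Hom sSet (fob (slice X c) d) (fob (rep c0) d)).
Proof.
apply: etrans (@nt_nat _ _ _ _ theta (d, c) (d', c) (a, idm C c)) _.
by apply: shom_eq => n x /=; rewrite compm_idl.
Qed.

Definition theta_slice : Hom (Fun (sop D) sSet) (slice X c) (rep c0) :=
  @NatTrans (sop D) sSet (slice X c) (rep c0) (fun d => nt theta (d, c)) theta_slice_nat.

Lemma theta_slice_weq d : weak_homotopy_equivalence (nt theta_slice d).
Proof. exact: (proj2 theta_approx (d, c) Pc). Qed.

Variable Y : Fun C S.
Hypothesis Yc : forall c, cofibrant M (fob Y c).

Let A : S := over_ob cS T X (res P Y) c.

Definition comparison : Hom S A (fob Y c) :=
  nt (ev P Y ∘ tensor_over_map cS T theta (res P Y)) c.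

(** The transpose of the comparison map factors through theta and is constant on
    the components of F(d, c). *)
Lemma comparison_adj d n (x : simp (fob X (d, c)) n) :
  sapp (over_adj comparison d) x = sdeg n
      (vert Es (fmap Y (sapp (nt theta (d, c)) x : Hom C (sval d) c))).
Proof.
have -> : over_adj comparison d = over_adj (nt (ev P Y) c) d ∘ nt theta (d, c).
  exact: (over_adj_map (nt_act_l theta c)).
rewrite /over_adj.
have -> : nt (ev P Y) c ∘ over_in cS T (mor_diagram P) (res P Y) c d = ev_at Y c d.
  exact: over_fac.
exact: (congr1 (fun g : Hom sSet _ _ => sapp g (sapp (nt theta (d, c)) x))
    (adj_disc_desc _ _)).
Qed.

(** The section sg is given by the vertex e0 over the identity of c.  The homotopy
    from [projective_htpy] relates j and j sg gamma, and j is a weak equivalence. *)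
Lemma comparison_weq : weq M comparison.
Proof.
have [e0 e0P] := @weq_disc_onto _ _ (nt theta_slice c0) (idm D c0) (@theta_slice_weq c0).
pose s d (f : Hom D d c0) : simp (fob (slice X c) d) 0 := sapp (dact (slice X c) f) e0.
have sN (d d' : sOb D) (a : Hom D d' d) f : s d' (f ∘ a) = sapp (dact (slice X c) a)
    (s d f).
  exact: dact_comp.
have sP d (f : Hom D d c0) : sapp (nt theta_slice d) (s d f) = f.
  rewrite dact_nat e0P; exact: (@compm_idl _ D _ _ f).
pose Ac : Hom sSet (fob X (c0, c)) (Map Es (fob Y c) A) := over_adj (idm S A) c0.
pose sg : Hom S (fob Y c) A := unvert Es (sapp Ac e0).
have Acp Z (g : Hom S A Z) : over_adj g c0 = Map_post Es (fob Y c) g ∘ Ac.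
  by rewrite -[in LHS](compm_idr g) over_adj_post.
have gsg : comparison ∘ sg = idm S (fob Y c).
  apply: (can_inj (@vertK S Es _ _)); rewrite vert_post unvertK.
  have -> : sapp (Map_post Es (fob Y c) comparison) (sapp Ac e0) =
      sapp (over_adj comparison c0) e0.
    by rewrite Acp.
  rewrite comparison_adj sdeg0; congr vert.
  have -> : (sapp (nt theta (c0, c)) e0 : Hom C c c) = idm C c by apply: e0P.
  exact: fmap_id.
apply: (weq_section gsg).
have [e eT] : exists e : S, is_initial (C := op S) e :=
  has_initial (mod_complete M).
have [bang _] := eT A.
pose ff := mod_fac_fib M.
pose Z : S := ff_ob ff (bang : Hom S A e).
pose j : Hom S A Z := ff_l ff (bang : Hom S A e).
have [_ jw] : triv_cof M j by apply: ff_lP.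
have Zf : fib M (ff_r ff (bang : Hom S A e)) by apply: ff_rP.
have uN (d d' : sOb D) (a : Hom (sop D) d d') :
  (over_adj j d' : Hom sSet (fob (slice X c) d') (Map Es (fob Y (sval d')) Z)) ∘ fmap
      (slice X c) a =
  fmap (map_slice Es (res P Y) Z) a ∘ over_adj j d.
  exact: (over_adj_nat (Y := res P Y) j a).
pose u : Hom (Fun (sop D) sSet) (slice X c) (map_slice Es (res P Y) Z) :=
  @NatTrans (sop D) sSet (slice X c) (map_slice Es (res P Y) Z) (fun d => over_adj j d)
      uN.
have kK d : kan_complex (fob (map_slice Es (res P Y) Z) d).
  exact: (Map_kan eT (Yc (sval d)) Zf).
have [h [h0 h1 hN]] := projective_htpy theta_slice_weq sN sP u (@slice_projective c) kK.
have [H [_ HI]] := cyl_desc hN.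
have H1 : H ∘ incl X (res P Y) c true = j.
  by apply: over_adj_inj => d; rewrite HI; apply: shom_eq => n x; apply: h1.
have H0 : H ∘ incl X (res P Y) c false = j ∘ (sg ∘ comparison).
  apply: over_adj_inj => d; rewrite HI compmA over_adj_post; apply: shom_eq => n x.
  apply: etrans (h0 d n x) _.
  rewrite -[RHS]/(sapp (Map_post Es (fob Y (sval d)) (j ∘ sg))
      (sapp (over_adj comparison d) x)).
  rewrite comparison_adj sapp_sdeg [RHS]sapp_sdeg; congr sdeg.
  set f : Hom D d c0 := sapp (nt theta_slice d) x.
  have E3 : sapp (over_adj j c0) e0 = vert Es (j ∘ sg) by rewrite Acp vert_post unvertK.
  apply: etrans (dact_nat u f e0) _.
  apply: etrans (congr1 (@sapp _ _ (Map_pre Es Z (fmap (res P Y) f)) 0) E3) _.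
  rewrite -vert_pre; exact: vert_post.
have Hw : weq M H.
  have [_ h2 _] := mod_2of3 M H (incl X (res P Y) c true).
  apply: h2; last by rewrite H1.
  exact: (@incl_weq S D C X (res P Y) c (@slice_projective c) (fun d => Yc (sval d))
      true).
have jsw : weq M (j ∘ (sg ∘ comparison)).
  rewrite -H0; have [h2 _ _] := mod_2of3 M H (incl X (res P Y) c false).
  apply: h2 => //.
  exact: (@incl_weq S D C X (res P Y) c (@slice_projective c) (fun d => Yc (sval d))
      false).
by have [_ _ h2] := mod_2of3 M j (sg ∘ comparison); apply: h2.
Qed.

End At.

Lemma xi_cofibrant_approximation (X0 qX : Fun C S) (eta : Hom (Fun C S) qX X0) :
  objectwise_cofibrant_approximation M eta ->
  cofibrant_approximation (relative_model P M) (xi theta eta).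
Proof.
move=> [qc ew]; split.
  apply: tensor_over_cofibrant; first exact: (proj1 theta_approx).
  by move=> d; apply: qc.
move=> c Pc.
have -> : nt (xi theta eta) c = nt eta c ∘ comparison c qX by apply: esym (compmA _ _ _).
have [h _ _] := mod_2of3 M (nt eta c) (comparison c qX).
by apply: h; [apply: comparison_weq|apply: ew].
Qed.

End Main.

Theorem theorem1p1
  (C : small_category) (D : sOb C -> Prop)
  (E : Fun (sprodc (sop (full_sub D)) C) sSet)
  (theta : Hom (Fun (sprodc (sop (full_sub D)) C) sSet) E (mor_diagram D))
  (theta_approx : cofibrant_approximation
     (relative_model (C := sprodc (sop (full_sub D)) C)
        (fun dc => D (snd dc)) kan_quillen) theta)
  (S : simplicial_model_category)
  (S_cofgen : cofibrantly_generated (smc_mod S)) :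
  (forall (X qX : Fun C S) (eta : Hom (Fun C S) qX X),
     objectwise_cofibrant_approximation (smc_mod S) eta ->
     cofibrant_approximation (relative_model D (smc_mod S)) (xi theta eta)) /\
  (forall X : Fun C S,
     objectwise_cofibrant (smc_mod S) X ->
     cofibrant_approximation (relative_model D (smc_mod S))
       (xi theta (idm (Fun C S) X))).
Proof.
split=> [X qX eta|X Xc]; first exact: xi_cofibrant_approximation.
by apply: xi_cofibrant_approximation => //; split=> // c; apply: weq_id.
Qed.
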